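(* Let $\Phi$ be a growth function of lower type. Then for every $G\in H^{\Phi}(\mathbb{D})$ with $G\not\equiv 0$, if $B$ denotes the Blaschke product associated with the sequence of zeros of $G$ in $\mathbb{D}$, the function $G/B$ belongs to $H^{\Phi}(\mathbb{D})$ and $$\|G\|_{H^{\Phi}}^{lux}\approx \|G/B\|_{H^{\Phi}}^{lux},$$ with constants independent of $G$.
   Context: $\mathbb{D}=\{z\in\mathbb{C}:|z|<1\}$, $\mathbb{T}=\{z\in\mathbb{C}:|z|=1\}$. A growth function is a nondecreasing function $\Phi:[0,\infty)\to[0,\infty)$ with $\lim_{t\to0}\Phi(t)=\Phi(0)=0$, $\Phi(t)>0$ for $t>0$, and $\lim_{t\to\infty}\Phi(t)=\infty$. It is of lower type $p\in(0,\infty)$ if there is a constant $C>1$ with $\Phi(st)\le Ct^{p}\Phi(s)$ for all $t\in[0,1]$, $s\in[0,\infty)$; it is of lower type if it is of lower type $p$ for some $p\in(0,\infty)$. For measurable $g:\mathbb{T}\to\mathbb{C}$, $\|g\|_{L^{\Phi}}^{lux}=\inf\{\lambda>0:\int_0^{2\pi}\Phi(|g(e^{i\theta})|/\lambda)\frac{d\theta}{2\pi}\le1\}$. $H^{\Phi}(\mathbb{D})$ is the space of holomorphic functions $G$ on $\mathbb{D}$ with $\|G\|_{H^{\Phi}}^{lux}:=\sup_{0\le r<1}\|G_r\|_{L^{\Phi}}^{lux}<\infty$, where $G_r(e^{i\theta})=G(re^{i\theta})$. For a (finite or infinite) sequence $(z_n)$ in $\mathbb{D}$ with $\sum_n(1-|z_n|)<\infty$,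 the associated Blaschke product is $B(z)=\prod_n\frac{|z_n|}{z_n}\frac{z_n-z}{1-\overline{z_n}z}$, with the usual conventions that a factor with $z_n=0$ is $z$ and the empty product is $1$. The zeros of $G$ are listed with multiplicity (for $0\not\equiv G\in H^{\Phi}(\mathbb{D})$ they satisfy this summability condition), and $G/B$ is understood as a holomorphic function on $\mathbb{D}$ after removing singularities. $A\approx A'$ means that $c^{-1}A'\le A\le cA'$ for a constant $c>0$ independent of the main parameters (here depending only on $\Phi$). *)

(* Defs.v *)
From HB Require Import structures.
From mathcomp Require Import all_boot all_order all_algebra complex.
From mathcomp Require Import all_classical all_reals all_analysis.

Set Implicit Arguments.
Unset Strict Implicit.
Unset Printing Implicit Defensive.

Import Order.TTheory GRing.Theory Num.Theory.
Import numFieldNormedType.Exports.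

Local Open Scope classical_set_scope.
Local Open Scope ring_scope.
Local Open Scope complex_scope.

(* Packing R[i] as a numFieldType equips it with the normed-module structure
   over itself, so that [derivable f z 1] is complex differentiability at z. *)
Definition C (R : realType) : numFieldType := R[i].

Section Definitions.
Context {R : realType}.
Implicit Types (Phi : R -> R) (G B : C R -> C R) (a w z : C R) (r : R).

(* The real-valued modulus; in C R itself, `|z| is the complex number |z| + 0i. *)
Definition modulus z : R := complex.Re `|z|.

Definition unit_disk : set (C R) := [set z | `|z| < 1].

Definition holomorphic_on_disk G := forall z, unit_disk z -> derivable G z 1.

(* Only the restriction of Phi to [0, +oo[ is ever used. *)
Definition growth_function Phi :=
  [/\ {in `[0, +oo[ &, {homo Phi : s t / s <= t}},
      Phi 0 = 0 /\ Phi t @[t --> 0^'+] --> 0,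
      forall t : R, 0 < t -> 0 < Phi t &
      Phi t @[t --> +oo] --> +oo].

Definition of_lower_type_exponent Phi (p : R) :=
  exists2 K : R, 1 < K &
    forall t s : R, 0 <= t <= 1 -> 0 <= s -> Phi (s * t) <= K * t `^ p * Phi s.

Definition of_lower_type Phi :=
  exists2 p : R, 0 < p & of_lower_type_exponent Phi p.

Definition circle_point (t : R) : C R := cos t +i* sin t.

(* The infimum is +oo when no lambda is admissible. *)
Definition lux_norm Phi (g : C R -> C R) : \bar R :=
  ereal_inf [set l%:E | l in [set l : R | 0 < l /\
    (\int[lebesgue_measure]_(t in `[0%R, (2 * pi)%R])
       (Phi (modulus (g (circle_point t)) / l) / (2 * pi))%R%:E <= 1)%E]].

Definition dilate G r : C R -> C R := fun w => G ((r%:C : C R) * w).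

Definition hardy_norm Phi G : \bar R :=
  ereal_sup [set lux_norm Phi (dilate G r) | r in `[0, 1[].

Definition hardy_orlicz Phi : set (C R -> C R) :=
  [set G | holomorphic_on_disk G /\ (hardy_norm Phi G < +oo)%E].

Definition zero_order G a (n : nat) :=
  exists h : C R -> C R,
    [/\ \forall w \near a, derivable h w 1, h a != 0 &
        \forall w \near a, G w = (w - a) ^+ n * h w].

(* A finite or infinite sequence is a map nat -> option C: the terms are the
   Some values, and the None entries are skipped. *)
Definition lists_zeros G (zs : nat -> option (C R)) :=
  (forall k a, zs k = Some a -> unit_disk a) /\
  (forall a, unit_disk a ->
     exists2 n, zero_order G a n & ([set k | zs k = Some a] #= `I_n)%card).

Definition blaschke_summable (zs : nat -> option (C R)) :=
  (\sum_(0 <= k <oo) (if zs k is Some a then 1 - modulus a else 0)%R%:E < +oo)%E.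

Definition blaschke_factor a z : C R :=
  if a == 0 then z
  else `|a| / a * ((a - z) / (1 - (conjc a : C R) * z)).

Definition blaschke (zs : nat -> option (C R)) z : C R :=
  limn (fun n : nat =>
    \prod_(0 <= k < n) (if zs k is Some a then blaschke_factor a z else 1)).

(* The quotient G / B with its removable singularities filled in; where G / B
   is continuous, the punctured limit is its value. *)
Definition quotient_removed G B : C R -> C R :=
  fun z => lim (G w / B w @[w --> z^']).

End Definitions.

(* Main.v *)
(* Replace [Phi] by [Psi s = sup_u Phi u * log^+ (s / u)]: by the lower type
   condition it is equivalent to [Phi] up to constants and a dilation, and it is
   a convex nondecreasing function of [log s].  Hence [Psi (|F| / l)] is
   subharmonic for holomorphic [F] and its means over circles [|z| = r] increase
   with [r].  If [B_n] is the product of the first [n] Blaschke factors of [G]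
   and [F_n = G / B_n], then [|F_n| <= 2 |G|] near the unit circle, so the means
   of [Psi (|F_n| / 2 l)] are bounded by those of [Psi (|G| / l)], uniformly in
   [n].  At the origin this bounds the product of the inverse moduli of the
   zeros, which gives the Blaschke condition; consequently [F_n] converges
   locally uniformly to a holomorphic [H] with [G = B H], and the bound on the
   means passes to [H].  Cauchy's formula is proved along the way, by Goursat's
   subdivision argument applied to [zeta = z + s (rho e^(it) - z)]. *)
Require Import Defs.
From mathcomp Require Import all_boot all_order all_algebra finmap complex.
From mathcomp Require Import all_classical all_reals all_analysis.
From mathcomp Require Import measurable_realfun ring lra.

Import Order.TTheory GRing.Theory Num.Theory.
Import numFieldNormedType.Exports.

Set Implicit Arguments.
Unset Strict Implicit.
Unset Printing Implicit Defensive.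

Local Open Scope classical_set_scope.
Local Open Scope ring_scope.

(** * The complex plane *)

(** [Phi] need be neither continuous nor convex in [log s], so [Phi (|F|)] itself may fail to be
    subharmonic. Lower type makes [Psi] finite: [Phi u <= K (u/s)^p Phi s] and [t^p log(1/t) <= 1/p]
    bound the supremum by [K/p * Phi s], while [u = s/e] gives [Phi (s/e) <= Psi s]. [Psi] need not
    be smooth either, so subharmonicity is not read off a Laplacian: a value is compared with the
    four values at [h, ih, -h, -ih], up to an [O(|h|^3)] error. This form follows from support lines
    of [Psi] in [log s], survives sums and rotations, and suffices for a maximum principle; applied
    to sums over rotations by roots of unity, that principle gives the growth of circle means
    through Riemann sums. The final constant is [4 * e * m]: a factor 2 from [|F_n| <= 2 |G|] near
    the unit circle, a factor 2 from [|H| <= 2 |F_n|] on a smaller disk for large [n], [e] from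
    [Phi (s/e) <= Psi s], and a dilation [m] that absorbs [K/p] by lower type. The opposite
    inequality is [|G| <= |H|]. *)

Section Modulus.
Context {R : realType}.
Implicit Types (z w : C R) (x y e : R).

Definition rc (x : R) : C R := (x +i* 0)%C.
Definition cre (z : R[i]) : R := let: Complex x _ := z in x.
Definition cim (z : R[i]) : R := let: Complex _ y := z in y.
Definition ic : C R := (0 +i* 1)%C.

Lemma normC_modulus z : `|z| = rc (modulus z).
Proof. by rewrite /modulus /rc; case: z. Qed.

Lemma modulusE z : modulus z = Num.sqrt (cre z ^+ 2 + cim z ^+ 2).
Proof. by case: z. Qed.

Lemma rc_inj : injective rc.
Proof. by move=> x y []. Qed.

Lemma rcD x y : rc (x + y) = rc x + rc y.
Proof. by rewrite /rc; apply/eqP; rewrite eq_complex /= addr0 !eqxx. Qed.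

Lemma rcN x : rc (- x) = - rc x.
Proof. by apply/eqP; rewrite eq_complex /= oppr0 !eqxx. Qed.

Lemma rcM x y : rc (x * y) = rc x * rc y.
Proof. by apply/eqP; rewrite eq_complex /= !mulr0 !mul0r subr0 addr0 !eqxx. Qed.

Lemma rc0 : rc 0 = 0. Proof. by []. Qed.
Lemma rc1 : rc 1 = 1. Proof. by []. Qed.

Lemma ler_rc x y : (rc x <= rc y) = (x <= y).
Proof. exact: lecR. Qed.

Lemma ltr_rc x y : (rc x < rc y) = (x < y).
Proof. exact: ltcR. Qed.

Lemma modulus_ge0 z : 0 <= modulus z.
Proof. by rewrite modulusE sqrtr_ge0. Qed.

Lemma modulusM z w : modulus (z * w) = modulus z * modulus w.
Proof. by apply: rc_inj; rewrite rcM -!normC_modulus normrM. Qed.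

Lemma ler_modulusD z w : modulus (z + w) <= modulus z + modulus w.
Proof. by rewrite -ler_rc rcD -!normC_modulus ler_normD. Qed.

Lemma modulusN z : modulus (- z) = modulus z.
Proof. by apply: rc_inj; rewrite -!normC_modulus normrN. Qed.

Lemma modulus_distC z w : modulus (z - w) = modulus (w - z).
Proof. by rewrite -modulusN opprB. Qed.

Lemma ler_modulusB z w : modulus (z - w) <= modulus z + modulus w.
Proof. by rewrite (le_trans (ler_modulusD _ _)) // modulusN. Qed.

Lemma ler_distD_modulus t z w : modulus (z - w) <= modulus (z - t) + modulus (t - w).
Proof. by rewrite (le_trans _ (ler_modulusD _ _)) // subrKA. Qed.

Lemma lerB_modulus z w : modulus z - modulus w <= modulus (z - w).
Proof. by rewrite lerBlDr (le_trans _ (ler_modulusD _ _)) // subrK. Qed.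

Lemma modulus0 : modulus (0 : C R) = 0.
Proof. by apply: rc_inj; rewrite -normC_modulus normr0. Qed.

Lemma modulus1 : modulus (1 : C R) = 1.
Proof. by apply: rc_inj; rewrite -normC_modulus normr1. Qed.

Lemma modulus_eq0 z : (modulus z == 0) = (z == 0).
Proof. by rewrite -(inj_eq rc_inj) -normC_modulus normr_eq0. Qed.

Lemma modulus_gt0 z : (0 < modulus z) = (z != 0).
Proof. by rewrite lt_neqAle modulus_ge0 eq_sym modulus_eq0 andbT. Qed.

Lemma modulusX z n : modulus (z ^+ n) = modulus z ^+ n.
Proof. by elim: n => [|n IH]; rewrite ?expr0 ?modulus1 // !exprS modulusM IH. Qed.

Lemma modulusV z : modulus z^-1 = (modulus z)^-1.
Proof.
have [->|z0] := eqVneq z 0; first by rewrite invr0 modulus0 invr0.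
apply: (@mulIf _ (modulus z)); first by rewrite modulus_eq0.
by rewrite -modulusM !mulVf ?modulus1 // modulus_eq0.
Qed.

Lemma modulusMV z w : modulus (z / w) = modulus z / modulus w.
Proof. by rewrite modulusM modulusV. Qed.

Lemma modulus_rc x : modulus (rc x) = `|x|.
Proof. by rewrite modulusE /= expr0n addr0 sqrtr_sqr. Qed.

Lemma modulus_ic : modulus ic = 1.
Proof. by rewrite modulusE /= expr0n expr1n add0r sqrtr1. Qed.

Lemma ic2 : ic * ic = -1.
Proof. by apply/eqP; rewrite eq_complex /= !mul0r !mulr0 !mul1r sub0r addr0 oppr0 !eqxx. Qed.

Lemma modulus_prod (I : Type) (s : seq I) (f : I -> C R) :
  modulus (\prod_(i <- s) f i) = \prod_(i <- s) modulus (f i).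
Proof. exact: (big_morph _ modulusM modulus1). Qed.

Lemma ler_Re_modulus z : `|cre z| <= modulus z.
Proof. by rewrite modulusE -sqrtr_sqr; apply: ler_wsqrtr; rewrite lerDl sqr_ge0. Qed.

Lemma ler_Im_modulus z : `|cim z| <= modulus z.
Proof. by rewrite modulusE -sqrtr_sqr; apply: ler_wsqrtr; rewrite lerDr sqr_ge0. Qed.

Lemma modulus_le_ReIm z : modulus z <= `|cre z| + `|cim z|.
Proof.
rewrite modulusE -[leRHS]ger0_norm ?addr_ge0 // -[leRHS]sqrtr_sqr; apply: ler_wsqrtr.
by rewrite sqrrD !real_normK ?num_real // lerD2r lerDl mulrn_wge0 // mulr_ge0.
Qed.

Lemma complexP z w : cre z = cre w -> cim z = cim w -> z = w.
Proof. by case: z w => [a b] [c d] /= -> ->. Qed.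

Lemma creD z w : cre (z + w) = cre z + cre w.
Proof. by case: z w => [a b] [c d]. Qed.
Lemma cimD z w : cim (z + w) = cim z + cim w.
Proof. by case: z w => [a b] [c d]. Qed.
Lemma creN z : cre (- z) = - cre z.
Proof. by case: z. Qed.
Lemma cimN z : cim (- z) = - cim z.
Proof. by case: z. Qed.
Lemma creM z w : cre (z * w) = cre z * cre w - cim z * cim w.
Proof. by case: z w => [a b] [c d]. Qed.
Lemma cimM z w : cim (z * w) = cre z * cim w + cim z * cre w.
Proof. by case: z w => [a b] [c d]. Qed.

Lemma unit_diskE z : unit_disk z <-> modulus z < 1.
Proof. by rewrite /unit_disk /= normC_modulus -rc1 ltr_rc. Qed.

Lemma nbhs_modulusP z (P : set (C R)) :
  (\forall w \near z, P w) <-> exists2 d, 0 < d & forall w, modulus (w - z) < d -> P w.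
Proof.
split.
  move/nbhs_ballP => [e /= e0 H].
  (* A complex number that is positive in the order of [R[i]] is real. *)
  have [er eE] : exists r, e = rc r.
    move: e e0 {H} => [a b]; rewrite ltcE /= => /andP[/eqP -> _]; exists a => //.
  exists er; first by rewrite -ltr_rc -eE.
  move=> w wz; apply: H; rewrite -ball_normE /ball_ /=.
  by rewrite distrC normC_modulus eE ltr_rc.
move=> [d d0 H]; apply/nbhs_ballP; exists (rc d); first by rewrite /= -rc0 ltr_rc.
by move=> w; rewrite -ball_normE /ball_ /= distrC normC_modulus ltr_rc; exact: H.
Qed.

Lemma dnbhs_modulusP z (P : set (C R)) :
  (\forall w \near z^', P w) <->
  exists2 d, 0 < d & forall w, w != z -> modulus (w - z) < d -> P w.
Proof.
rewrite /dnbhs /within /=; split.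
  by move/nbhs_modulusP => [d d0 H]; exists d => // w wz /H; exact.
by move=> [d d0 H]; apply/nbhs_modulusP; exists d => // w dw wz; exact: H.
Qed.

Lemma cvg_modulusP {T : Type} {F : set_system T} {FF : Filter F} (f : T -> C R) (l : C R) :
  f @ F --> l <-> forall e, 0 < e -> \forall t \near F, modulus (f t - l) < e.
Proof.
split.
  move=> fl e e0; apply: (fl [set w | modulus (w - l) < e]).
  by apply/nbhs_modulusP; exists e.
move=> H A /nbhs_modulusP [d d0 dA]; apply: filterS (H _ d0) => t /=; exact: dA.
Qed.

(** Clearing the denominator of the difference quotient replaces a punctured limit by a real
    inequality that also covers [w = z]. *)
Lemma derivable_modulusP (f : C R -> C R) z :
  derivable f z 1 <-> exists d : C R, forall e, 0 < e -> exists2 r, 0 < r &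
    forall w, modulus (w - z) < r -> modulus (f w - f z - d * (w - z)) <= e * modulus (w - z).
Proof.
split.
  move=> /cvg_ex [d /cvg_modulusP H]; exists d => e e0.
  have /dnbhs_modulusP [r r0 Hr] := H _ e0.
  exists r => // w wz; have [->|nwz] := eqVneq w z.
    by rewrite !subrr mulr0 subr0 modulus0 mulr0.
  have nz : w - z != 0 by rewrite subr_eq0.
  have := Hr (w - z) nz; rewrite subr0 => /(_ wz).
  rewrite /GRing.scale /= mulr1 subrK => /ltW.
  rewrite -(ler_pM2r (x := modulus (w - z))) ?modulus_gt0 // -modulusM mulrBl.
  by rewrite mulrAC mulVf // mul1r.
move=> [d H]; apply/cvg_ex; exists d; apply/cvg_modulusP => e e0.
have [r r0 Hr] := H (e / 2) (divr_gt0 e0 (ltr0n _ 2)).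
apply/dnbhs_modulusP; exists r => // h nh; rewrite subr0 => hr.
have := Hr (z + h); rewrite [z + h - z]addrAC subrr add0r => /(_ hr) Hh.
rewrite /GRing.scale /= mulr1.
have mh : 0 < modulus h by rewrite modulus_gt0.
rewrite -(ltr_pM2r mh) -modulusM mulrBl mulrAC mulVf // mul1r [h + z]addrC.
apply: le_lt_trans Hh _; rewrite ltr_pM2r // ltr_pdivrMr // ltr_pMr // ltr1n //.
Qed.

Lemma derivable_continuous (f : C R -> C R) z : derivable f z 1 -> {for z, continuous f}.
Proof. by move=> /derivable1_diffP /differentiable_continuous. Qed.

Lemma continuous_modulusP (f : C R -> C R) z : {for z, continuous f} <->
  forall e, 0 < e -> exists2 d, 0 < d & forall w, modulus (w - z) < d -> modulus (f w - f z) < e.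
Proof.
have FF : Filter (nbhs z) by exact: nbhs_filter.
split.
  by move=> /(@cvg_modulusP _ _ FF) H e /H /nbhs_modulusP.
by move=> H; apply/(@cvg_modulusP _ _ FF) => e /H /nbhs_modulusP.
Qed.

End Modulus.

(** * Integrals of complex-valued functions *)

Section Paths.
Context {R : realType}.
Implicit Types (a b c t x e : R) (z w : C R).

Lemma continuous_comp_Re (T : topologicalType) (g : T -> C R) (t : T) :
  {for t, continuous g} -> {for t, continuous (fun s => cre (g s))}.
Proof.
move=> /cvg_modulusP cg; apply/cvgrPdist_lt => e /cg.
apply: filterS => s; apply: le_lt_trans.
by rewrite distrC -creN -creD ler_Re_modulus.
Qed.

Lemma continuous_comp_Im (T : topologicalType) (g : T -> C R) (t : T) :
  {for t, continuous g} -> {for t, continuous (fun s => cim (g s))}.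
Proof.
move=> /cvg_modulusP cg; apply/cvgrPdist_lt => e /cg.
apply: filterS => s; apply: le_lt_trans.
by rewrite distrC -cimN -cimD ler_Im_modulus.
Qed.

Lemma continuous_comp_modulus (T : topologicalType) (g : T -> C R) (t : T) :
  {for t, continuous g} -> {for t, continuous (fun s => modulus (g s))}.
Proof.
move=> /cvg_modulusP cg; apply/cvgrPdist_lt => e /cg.
apply: filterS => s; apply: le_lt_trans.
by rewrite ler_norml lerNl opprB lerB_modulus modulus_distC lerB_modulus.
Qed.

Lemma continuous_comp_rc (T : topologicalType) (f : T -> R) (t : T) :
  {for t, continuous f} -> {for t, continuous (fun s => rc (f s))}.
Proof.
move=> /cvgrPdist_lt cf; apply/cvg_modulusP => e /cf.
apply: filterS => s; apply: le_lt_trans.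
by rewrite -rcN -rcD modulus_rc distrC.
Qed.

Lemma circle_pointE t : circle_point t = rc (cos t) + ic * rc (sin t).
Proof.
by apply: complexP; rewrite ?creD ?creM ?cimD ?cimM /=; ring.
Qed.

Lemma modulus_circle_point t : modulus (circle_point t) = 1.
Proof. by rewrite modulusE /= cos2Dsin2 sqrtr1. Qed.

Lemma circle_pointD s t : circle_point (s + t) = circle_point s * circle_point t.
Proof.
apply: complexP; rewrite ?creM ?cimM /=; first by rewrite cosD.
by rewrite sinD addrC.
Qed.

Lemma circle_point0 : circle_point (0 : R) = 1.
Proof. by apply: complexP; rewrite /= ?cos0 ?sin0. Qed.

Lemma circle_point2pi : circle_point (2 * pi : R) = 1.
Proof.
have -> : 2 * pi = pi *+ 2 :> R by rewrite mulr_natl.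
by apply: complexP; rewrite /= ?cos2pi ?sin2pi.
Qed.

Lemma continuous_circle_point : continuous (@circle_point R).
Proof.
move=> t.
have -> : @circle_point R = (fun t => rc (cos t) + ic * rc (sin t)).
  by apply/funext => s; rewrite circle_pointE.
apply: cvgD; first by apply: continuous_comp_rc; exact: continuous_cos.
by apply: cvgM; [exact: cvg_cst|apply: continuous_comp_rc; exact: continuous_sin].
Qed.

(** The factor 2 comes from treating the two coordinates separately, each 1-Lipschitz by the mean
    value theorem. *)
Lemma modulus_circle_pointB s t : modulus (circle_point s - circle_point t) <= 2 * `|s - t|.
Proof.
wlog st : s t / t <= s.
  move=> H; have /orP[ts|st] := le_total t s; first exact: H.
  by rewrite modulus_distC distrC H.
apply: (le_trans (modulus_le_ReIm _)).
rewrite /= mulr_natl mulr2n; apply: lerD.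
  have [|c _ ->] := @MVT_segment R cos (fun x => - sin x) t s st _.
    exact/continuous_subspaceT/continuous_cos.
  rewrite normrM normrN ler_piMl // ler_norml sin_geN1 sin_le1 //.
have [|c _ ->] := @MVT_segment R sin cos t s st _.
  exact/continuous_subspaceT/continuous_sin.
by rewrite normrM ler_piMl // ler_norml cos_geN1 cos_le1.
Qed.

Definition rint a b (f : R -> R) : R := \int[lebesgue_measure]_(t in `[a, b]) f t.

(** Continuity at the points of the segment is taken in the ambient space, so the pointwise rules
    for sums, products and compositions apply directly. *)
Definition cont_on (T : topologicalType) a b (g : R -> T) :=
  forall t, a <= t <= b -> {for t, continuous g}.

Lemma cont_on_within (T : topologicalType) a b (g : R -> T) :
  cont_on a b g -> {within `[a, b], continuous g}.
Proof.
move=> cg; apply: continuous_in_subspaceT => t.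
by rewrite inE /= in_itv /=; exact: cg.
Qed.

Lemma integrable_cont_on a b (f : R -> R) :
  cont_on a b f -> lebesgue_measure.-integrable `[a, b] (EFin \o f).
Proof.
move=> cf; apply: continuous_compact_integrable; first exact: segment_compact.
exact: cont_on_within.
Qed.

Lemma rint_cst a b (r : R) : a <= b -> rint a b (fun=> r) = r * (b - a).
Proof.
move=> ab; rewrite /rint Rintegral_cst //= (@lebesgue_measure_itv R `[a, b]) /= lte_fin.
case: ltP => // ba; have -> : b = a by apply/eqP; rewrite eq_le ab ba.
by rewrite subrr.
Qed.

Lemma rintD a b (f g : R -> R) : cont_on a b f -> cont_on a b g ->
  rint a b (fun t => f t + g t) = rint a b f + rint a b g.
Proof. by move=> cf cg; rewrite /rint RintegralD //; exact: integrable_cont_on. Qed.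

Lemma rintZ a b (r : R) (f : R -> R) : cont_on a b f -> rint a b (fun t => r * f t) = r * rint a b f.
Proof. by move=> cf; rewrite /rint RintegralZl //; exact: integrable_cont_on. Qed.

Lemma rint_le a b (f g : R -> R) : cont_on a b f -> cont_on a b g ->
  (forall t, a <= t <= b -> f t <= g t) -> rint a b f <= rint a b g.
Proof.
move=> cf cg fg; apply: le_Rintegral => //; try exact: integrable_cont_on.
Qed.

Lemma eq_rint a b (f g : R -> R) : (forall t, a <= t <= b -> f t = g t) -> rint a b f = rint a b g.
Proof. by move=> fg; apply: eq_Rintegral => t; rewrite inE /= in_itv /=; exact: fg. Qed.

Lemma rint_split b a c (f : R -> R) : a <= b -> b <= c -> cont_on a c f ->
  rint a c f = rint a b f + rint b c f.
Proof.
move=> ab bc cf; rewrite /rint -[RHS]addrC; apply/eqP; rewrite -subr_eq; apply/eqP.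
rewrite Rintegral_itvB ?bnd_simp //; last exact: (integrable_cont_on cf).
rewrite Rintegral_itv_obnd_cbnd //.
apply: (@integrableS _ _ _ lebesgue_measure `[a, c]) => //; last exact: integrable_cont_on.
by move=> t /=; rewrite !in_itv /= => /andP[bt ->]; rewrite (le_trans ab) // ltW.
Qed.

Lemma rint_FTC a b (f F : R -> R) : a <= b -> (forall t : R, is_derive t (1:R) F (f t)) -> continuous f ->
  rint a b f = F b - F a.
Proof.
move=> ab dF cf.
have cF : continuous F.
  by move=> t; apply/differentiable_continuous/derivable1_diffP; have [] := dF t.
move: ab; rewrite le_eqVlt => /predU1P[->|ab].
  by rewrite /rint set_itv1 Rintegral_set1 subrr.
rewrite /rint /Rintegral (continuous_FTC2 (F := F)) //=.
- exact: continuous_subspaceT.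
- by split; [move=> t _; have [] := dF t | exact: cvg_at_right_filter (cF a)
  | exact: cvg_at_left_filter (cF b)].
- by move=> t _; rewrite derive1E; have [_ ->] := dF t.
Qed.

End Paths.

Section ComplexIntegral.
Context {R : realType}.
Implicit Types (a b c t x e : R) (z w : C R) (g h : R -> C R).

Definition cint a b (g : R -> C R) : C R :=
  (rint a b (fun t => cre (g t)) +i* rint a b (fun t => cim (g t)))%C.

Lemma cont_onB a b (g h : R -> C R) : cont_on a b g -> cont_on a b h ->
  cont_on a b (fun t => g t - h t).
Proof. by move=> cg ch t tab; apply: cvgB; [exact: cg|exact: ch]. Qed.

Lemma cont_onM a b (g h : R -> C R) : cont_on a b g -> cont_on a b h ->
  cont_on a b (fun t => g t * h t).
Proof. by move=> cg ch t tab; apply: cvgM; [exact: cg|exact: ch]. Qed.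

Lemma cont_on_cst a b (c : C R) : cont_on a b (fun=> c).
Proof. by move=> t _; exact: cvg_cst. Qed.

Lemma cont_on_Re a b (g : R -> C R) : cont_on a b g -> cont_on a b (fun t => cre (g t)).
Proof. by move=> cg t /cg; exact: continuous_comp_Re. Qed.

Lemma cont_on_Im a b (g : R -> C R) : cont_on a b g -> cont_on a b (fun t => cim (g t)).
Proof. by move=> cg t /cg; exact: continuous_comp_Im. Qed.

Lemma cont_on_sub (T : topologicalType) a b c d (g : R -> T) : cont_on a b g -> a <= c -> d <= b -> cont_on c d g.
Proof.
move=> cg ac db t /andP[ct td]; apply: cg.
by rewrite (le_trans ac ct) (le_trans td db).
Qed.

Lemma cont_onZr a b (r : R) (f : R -> R) : cont_on a b f -> cont_on a b (fun t => r * f t).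
Proof. by move=> cf t tab; apply: cvgM; [exact: cvg_cst|exact: cf]. Qed.

Lemma eq_cint a b g h : (forall t, a <= t <= b -> g t = h t) -> cint a b g = cint a b h.
Proof.
by move=> gh; rewrite /cint; congr (_ +i* _)%C; apply: eq_rint => t tab; rewrite gh.
Qed.

Lemma cintD a b g h : cont_on a b g -> cont_on a b h ->
  cint a b (fun t => g t + h t) = cint a b g + cint a b h.
Proof.
move=> cg ch; apply: complexP; rewrite ?creD ?cimD /= -rintD;
  do ?[exact: cont_on_Re|exact: cont_on_Im]; by apply: eq_rint => t _; rewrite ?creD ?cimD.
Qed.

Lemma cintZ a b (c : C R) g : cont_on a b g ->
  cint a b (fun t => c * g t) = c * cint a b g.
Proof.
move=> cg; have [cr ci] := (cont_on_Re cg, cont_on_Im cg).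
apply: complexP; rewrite ?creM ?cimM /=.
  rewrite -mulNr -!rintZ // -rintD; try exact: cont_onZr.
  by apply: eq_rint => t _; rewrite creM mulNr.
rewrite -!rintZ // -rintD; try exact: cont_onZr.
by apply: eq_rint => t _; rewrite cimM.
Qed.

Lemma cintB a b g h : cont_on a b g -> cont_on a b h ->
  cint a b (fun t => g t - h t) = cint a b g - cint a b h.
Proof.
move=> cg ch; rewrite -(mulN1r (cint a b h)) -(cintZ (-1) ch) -(cintD cg).
  by apply: eq_cint => t _; rewrite mulN1r.
by apply: cont_onM ch; exact: cont_on_cst.
Qed.

Lemma cint_cst a b (c : C R) : a <= b -> cint a b (fun=> c) = c * rc (b - a).
Proof.
by move=> ab; apply: complexP; rewrite ?creM ?cimM /= rint_cst //; ring.
Qed.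

Lemma cint_split b a c g : a <= b -> b <= c -> cont_on a c g ->
  cint a c g = cint a b g + cint b c g.
Proof.
move=> ab bc cg; apply: complexP; rewrite ?creD ?cimD /= -rint_split //;
  by [exact: cont_on_Re|exact: cont_on_Im].
Qed.

Lemma cint_conjc a b g : cont_on a b g ->
  cint a b (fun t => conjc (g t) : C R) = conjc (cint a b g).
Proof.
move=> cg; apply: complexP => /=; first by apply: eq_rint => t _; case: (g t).
rewrite -mulN1r -rintZ; last exact: cont_on_Im.
by apply: eq_rint => t _; case: (g t) => p q; rewrite mulN1r.
Qed.

(** The factor 2 is the price of bounding the real and imaginary parts separately. *)
Lemma cint_bound a b (M : R) g : a <= b -> cont_on a b g ->
  (forall t, a <= t <= b -> modulus (g t) <= M) -> modulus (cint a b g) <= 2 * M * (b - a).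
Proof.
move=> ab cg gM; rewrite (le_trans (modulus_le_ReIm _)) //= -mulrA mulr_natl mulr2n.
have H (f : R -> R) : cont_on a b f -> (forall t, a <= t <= b -> `|f t| <= M) ->
    `|rint a b f| <= M * (b - a).
  move=> cf fM; rewrite ler_norml -mulNr -!rint_cst // !rint_le //;
    try (by move=> t tab; exact: cvg_cst);
    by move=> t /fM; rewrite ler_norml => /andP[].
by apply: lerD; apply: H; do ?[exact: cont_on_Re|exact: cont_on_Im];
  move=> t /gM; apply: le_trans; rewrite ?ler_Re_modulus ?ler_Im_modulus.
Qed.

Lemma cint_circle_point a b : a <= b ->
  cint a b (@circle_point R) = - ic * (circle_point b - circle_point a).
Proof.
move=> ab; apply: complexP; rewrite ?creM ?cimM /=.
  rewrite (@rint_FTC _ _ _ _ sin) //; last exact: continuous_cos.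
  by ring.
have dF (t : R) : is_derive t (1 : R) (fun t : R => - cos t) (sin t).
  by rewrite -[X in is_derive _ _ _ X]opprK; apply: is_deriveN.
rewrite (rint_FTC ab dF); last exact: continuous_sin.
by ring.
Qed.

End ComplexIntegral.

(** * Bisection of the unit square *)

Section Bisection.
Context {R : realType}.

(** Goursat's subdivision in abstract form, [E h x y] being attached to the square of side [h] with
    corner [(x, y)]. If [E 1 0 0] were positive, repeatedly keeping a quarter with at least a
    quarter of the value would give nested squares with [E >= E 1 0 0 * h^2], against the local
    estimate at their common point. *)
Lemma bisection_le0 (E : R -> R -> R -> R) :
  (forall h x y : R, 0 < h -> 0 <= x -> x + h <= 1 -> 0 <= y -> y + h <= 1 ->
    E h x y <= E (h / 2) x y + E (h / 2) (x + h / 2) y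
             + (E (h / 2) x (y + h / 2) + E (h / 2) (x + h / 2) (y + h / 2))) ->
  (forall p q e : R, 0 <= p <= 1 -> 0 <= q <= 1 -> 0 < e -> exists2 d : R, 0 < d &
    forall h x y : R, 0 < h < d -> 0 <= x -> x + h <= 1 -> 0 <= y -> y + h <= 1 ->
      x <= p <= x + h -> y <= q <= y + h -> E h x y <= e * h ^+ 2) ->
  E 1 0 0 <= 0.
Proof.
move=> Esub Eloc; rewrite leNgt; apply/negP; set e := E 1 0 0 => e0.
pose H (n : nat) : R := 2^-1 ^+ n.
have H0 n : 0 < H n by rewrite exprn_gt0 // invr_gt0.
have HS n : H n.+1 = H n / 2 by rewrite /H exprS mulrC.
pose good n (p : R * R) := [/\ 0 <= p.1, p.1 + H n <= 1, 0 <= p.2, p.2 + H n <= 1 &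
  e * H n ^+ 2 <= E (H n) p.1 p.2].
(* The implication makes the selection total, so that [choice] yields a function to iterate. *)
have step (np : nat * (R * R)) : exists p', good np.1 np.2 -> good np.1.+1 p' /\
    [/\ np.2.1 <= p'.1, p'.1 + H np.1.+1 <= np.2.1 + H np.1,
        np.2.2 <= p'.2 & p'.2 + H np.1.+1 <= np.2.2 + H np.1].
  case: np => n [x y] /=.
  have [gd|] := pselect (good n (x, y)); last by exists (0, 0).
  have [/= x0 x1 y0 y1 Exy] := gd.
  have h2 : 0 < H n / 2 by rewrite divr_gt0.
  have hh : H n = H n / 2 + H n / 2 by rewrite -splitr.
  have /or4P[h|h|h|h] : [|| e * H n.+1 ^+ 2 <= E (H n.+1) x y,
    e * H n.+1 ^+ 2 <= E (H n.+1) (x + H n / 2) y,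
    e * H n.+1 ^+ 2 <= E (H n.+1) x (y + H n / 2) |
    e * H n.+1 ^+ 2 <= E (H n.+1) (x + H n / 2) (y + H n / 2)].
  (* Otherwise the four quarters would add up to less than the whole. *)
  - apply: contraT; rewrite !negb_or -!ltNge => /and4P[E1 E2 E3 E4].
    have F := Esub _ _ _ (H0 n) x0 x1 y0 y1; rewrite -!HS in E2 E3 E4 F.
    have Q : e * H n ^+ 2 = 4 * (e * H n.+1 ^+ 2) by rewrite HS; field.
    by exfalso; lra.
  - exists (x, y) => _; split; first by split => //=; rewrite HS; lra.
    by split => //=; rewrite HS; lra.
  - exists (x + H n / 2, y) => _; split; first by split => //=; rewrite ?HS; lra.
    by split => //=; rewrite ?HS; lra.
  - exists (x, y + H n / 2) => _; split; first by split => //=; rewrite ?HS; lra.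
    by split => //=; rewrite ?HS; lra.
  - exists (x + H n / 2, y + H n / 2) => _; split; first by split => //=; rewrite ?HS; lra.
    by split => //=; rewrite ?HS; lra.
have [F HF] := choice step.
pose P := fix P n : R * R := if n is m.+1 then F (m, P m) else (0, 0).
have gP n : good n (P n).
  elim: n => [|n IH]; last by have [] := HF (n, P n) IH.
  by split; rewrite /= ?/H ?expr0 ?add0r // expr1n mulr1.
have inc n m : [/\ (P n).1 <= (P (n + m)%N).1, (P (n + m)%N).1 + H (n + m)%N <= (P n).1 + H n,
    (P n).2 <= (P (n + m)%N).2 & (P (n + m)%N).2 + H (n + m)%N <= (P n).2 + H n].
  elim: m => [|m [a1 a2 a3 a4]]; first by rewrite addn0.
  have [_ /= [b1 b2 b3 b4]] := HF (_, P (n + m)%N) (gP _).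
  rewrite addnS; split; [exact: le_trans a1 b1|exact: le_trans b2 a2|
    exact: le_trans a3 b3|exact: le_trans b4 a4].
have ub n m : (P m).1 <= (P n).1 + H n /\ (P m).2 <= (P n).2 + H n.
  have [nm|/ltnW mn] := leqP n m.
    have [_ a _ b] := inc n (m - n)%N; rewrite subnKC // in a b.
    by split; [move: a|move: b]; apply: le_trans; rewrite lerDl ltW.
  have [a _ b _] := inc m (n - m)%N; rewrite subnKC // in a b.
  by split; [apply: (le_trans a)|apply: (le_trans b)]; rewrite lerDl ltW.
(* The common point of the nested squares is the coordinatewise supremum of their lower left
   corners. *)
pose p := sup (range (fst \o P)); pose q := sup (range (snd \o P)).
have p1 n : (P n).1 <= p <= (P n).1 + H n.
  apply/andP; split.
    apply: ub_le_sup; last by exists n.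
    by exists ((P n).1 + H n) => _ [m _ <-]; have [] := ub n m.
  apply: sup_le_ub; first by exists (P 0).1; exists 0%N.
  by move=> _ [m _ <-]; have [] := ub n m.
have q1 n : (P n).2 <= q <= (P n).2 + H n.
  apply/andP; split.
    apply: ub_le_sup; last by exists n.
    by exists ((P n).2 + H n) => _ [m _ <-]; have [] := ub n m.
  apply: sup_le_ub; first by exists (P 0).2; exists 0%N.
  by move=> _ [m _ <-]; have [] := ub n m.
have p01 : 0 <= p <= 1 by have := p1 0%N; rewrite /= add0r /H expr0.
have q01 : 0 <= q <= 1 by have := q1 0%N; rewrite /= add0r /H expr0.
(* Tolerance [e / 2] contradicts the lower bound [e * H n ^+ 2] once a square is small enough. *)
have [d d0 Hd] := Eloc p q (e / 2) p01 q01 (divr_gt0 e0 (ltr0n _ 2)).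
have [n Hn] : exists n, H n < d.
  have : H n @[n --> \oo] --> 0 by apply: cvg_expr; rewrite ger0_norm ?invr_ge0 // invf_lt1 // ltr1n.
  move/cvgrPdist_lt => /(_ _ d0) [n _ Hn]; exists n.
  by have := Hn n (leqnn n); rewrite /= sub0r normrN ger0_norm // ltW.
have [x0 x1 y0 y1 Eg] := gP n.
have HH : 0 < H n < d by rewrite H0.
have := le_trans Eg (Hd _ _ _ HH x0 x1 y0 y1 (p1 n) (q1 n)).
by rewrite ler_pM2r ?exprn_gt0 // => h2; lra.
Qed.

End Bisection.

(** * Cauchy's formula and Taylor expansions *)

Section Goursat.
Context {R : realType}.
Implicit Types (s t : R) (U V : R -> R -> C R) (kappa : R -> C R).

(* With [U s t = f (z + s * (rho * e^(it) - z))] and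
   [kappa t = rho * e^(it) / (rho * e^(it) - z)], this is the integral over the
   boundary of [[s1, s2] * [t1, t2]] of the pullback of
   [f(zeta) dzeta / (i (zeta - z))] under [zeta = z + s * (rho * e^(it) - z)]. *)
Definition boundary_int kappa U (s1 s2 t1 t2 : R) : C R :=
  cint t1 t2 (fun t => (U s2 t - U s1 t) * kappa t)
  + ic * cint s1 s2 (fun s => (U s t2 - U s t1) * rc s^-1).

(** Each side of a rectangle varies a single coordinate, so this is what the side integrals require.
    The bound [sigma] keeps [s] away from 0, where the weight [1 / s] of [boundary_int] blows up. *)
Definition separately_continuous (sigma : R) U :=
  (forall s, sigma <= s <= 1 -> continuous (U s)) /\
  (forall t, cont_on sigma 1 (fun s => U s t)).

Context (sigma : R) (sigma0 : 0 < sigma) (kappa : R -> C R) (ckappa : continuous kappa).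

Lemma cont_on_hside U t1 t2 s1 s2 : separately_continuous sigma U ->
  sigma <= s1 <= 1 -> sigma <= s2 <= 1 ->
  cont_on t1 t2 (fun t => (U s2 t - U s1 t) * kappa t).
Proof.
move=> [cU _] h1 h2; apply: cont_onM; last by move=> t _; exact: ckappa.
by apply: cont_onB => t _; exact: cU.
Qed.

Lemma cont_on_vside U s1 s2 t1 t2 : separately_continuous sigma U ->
  sigma <= s1 -> s2 <= 1 ->
  cont_on s1 s2 (fun s => (U s t2 - U s t1) * rc s^-1).
Proof.
move=> [_ cU] h1 h2; apply: cont_onM.
  by apply: cont_onB; apply: cont_on_sub (cU _) h1 h2.
move=> s /andP[ss _]; apply: continuous_comp_rc; apply: cvgV; last exact: cvg_id.
by rewrite gt_eqF // (lt_le_trans sigma0) // (le_trans h1).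
Qed.

(** The side [s = s2] is common to both rectangles and cancels. *)
Lemma boundary_int_split_s U s1 s2 s3 t1 t2 : separately_continuous sigma U ->
  sigma <= s1 -> s1 <= s2 -> s2 <= s3 -> s3 <= 1 ->
  boundary_int kappa U s1 s3 t1 t2 =
  boundary_int kappa U s1 s2 t1 t2 + boundary_int kappa U s2 s3 t1 t2.
Proof.
move=> okU h1 h2 h3 h4; rewrite /boundary_int.
have [i1 i2 i3] : [/\ sigma <= s1 <= 1, sigma <= s2 <= 1 & sigma <= s3 <= 1].
  by split; lra.
rewrite (cint_split h2 h3); last exact: cont_on_vside.
rewrite addrACA -mulrDr -cintD; try exact: cont_on_hside.
by congr (_ + _); apply: eq_cint => t _; ring.
Qed.

Lemma boundary_int_split_t U s1 s2 t1 t2 t3 : separately_continuous sigma U ->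
  sigma <= s1 -> s1 <= s2 -> s2 <= 1 -> t1 <= t2 -> t2 <= t3 ->
  boundary_int kappa U s1 s2 t1 t3 =
  boundary_int kappa U s1 s2 t1 t2 + boundary_int kappa U s1 s2 t2 t3.
Proof.
move=> okU h1 h2 h4 h5 h6; rewrite /boundary_int.
have [i1 i2] : sigma <= s1 <= 1 /\ sigma <= s2 <= 1 by split; lra.
rewrite (cint_split h5 h6); last exact: cont_on_hside.
rewrite addrACA -mulrDr -cintD; try exact: cont_on_vside.
by congr (_ + _ * _); apply: eq_cint => t _; ring.
Qed.

Lemma boundary_intD U V s1 s2 t1 t2 : separately_continuous sigma U ->
  separately_continuous sigma V -> sigma <= s1 -> s1 <= s2 -> s2 <= 1 ->
  boundary_int kappa (fun s t => U s t + V s t) s1 s2 t1 t2 =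
  boundary_int kappa U s1 s2 t1 t2 + boundary_int kappa V s1 s2 t1 t2.
Proof.
move=> okU okV h1 h2 h3; rewrite /boundary_int.
have [i1 i2] : sigma <= s1 <= 1 /\ sigma <= s2 <= 1 by split; lra.
rewrite addrACA -mulrDr -(cintD (cont_on_hside okU i1 i2) (cont_on_hside okV i1 i2)).
rewrite -(cintD (cont_on_vside okU h1 h3) (cont_on_vside okV h1 h3)).
by congr (_ + _ * _); apply: eq_cint => t _; ring.
Qed.

(** [4 * M] is the 2 of [cint_bound] times the bound [2 * M] for a difference of two values; the
    last factor adds the weighted side lengths, with [1 / s <= sigma^-1]. *)
Lemma boundary_int_bound U s1 s2 t1 t2 (M K : R) : separately_continuous sigma U ->
  sigma <= s1 -> s1 <= s2 -> s2 <= 1 -> t1 <= t2 ->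
  (forall s t, s1 <= s <= s2 -> t1 <= t <= t2 -> modulus (U s t) <= M) ->
  (forall t, modulus (kappa t) <= K) ->
  modulus (boundary_int kappa U s1 s2 t1 t2) <=
  4 * M * (K * (t2 - t1) + sigma^-1 * (s2 - s1)).
Proof.
move=> okU h1 h2 h3 h5 UM kK; rewrite /boundary_int.
have [i1 i2] : sigma <= s1 <= 1 /\ sigma <= s2 <= 1 by split; lra.
have UB s s' t t' : s1 <= s <= s2 -> s1 <= s' <= s2 -> t1 <= t <= t2 -> t1 <= t' <= t2 ->
    modulus (U s t - U s' t') <= 2 * M.
  move=> a b c d; apply: (le_trans (ler_modulusB _ _)).
  by rewrite mulr_natl mulr2n lerD ?UM.
have M0 : 0 <= M by apply: le_trans (UM s1 t1 _ _); rewrite ?modulus_ge0 ?lexx ?h2 ?h5.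
have K0 : 0 <= K by apply: le_trans (kK 0); exact: modulus_ge0.
apply: (le_trans (ler_modulusD _ _)); rewrite modulusM modulus_ic mul1r.
have -> : 4 * M * (K * (t2 - t1) + sigma^-1 * (s2 - s1)) =
  2 * (2 * M * K) * (t2 - t1) + 2 * (2 * M * sigma^-1) * (s2 - s1) by ring.
apply: lerD; [apply: cint_bound h5 (cont_on_hside okU i1 i2) _|
  apply: cint_bound h2 (cont_on_vside okU h1 h3) _].
  move=> t tt; rewrite modulusM ler_pM ?modulus_ge0 ?kK //.
  by rewrite UB ?lexx ?h2.
move=> s ss; rewrite modulusM ler_pM ?modulus_ge0 //.
  by rewrite UB ?lexx ?h5.
have s0 : 0 < s by case/andP: ss => a _; exact: lt_le_trans sigma0 (le_trans h1 a).
rewrite modulus_rc ger0_norm ?invr_ge0 ?(ltW s0) // lef_pV2 ?posrE //.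
by case/andP: ss => a _; exact: le_trans h1 a.
Qed.

(** By periodicity the sides [t = 0] and [t = tau] cancel, so once the boundary integral over the
    whole rectangle vanishes, the integrals along [s = 1] and [s = sigma] agree. It vanishes by
    bisection. *)
Lemma boundary_int_periodic_eq U (tau : R) : separately_continuous sigma U -> sigma <= 1 ->
  0 <= tau -> (forall s, U s tau = U s 0) ->
  (forall p q e : R, sigma <= p <= 1 -> 0 <= q <= tau -> 0 < e ->
     exists2 d, 0 < d & forall h s t, 0 < h < d -> sigma <= s -> s + (1 - sigma) * h <= 1 ->
      0 <= t -> t + tau * h <= tau -> s <= p <= s + (1 - sigma) * h -> t <= q <= t + tau * h ->
      modulus (boundary_int kappa U s (s + (1 - sigma) * h) t (t + tau * h)) <= e * h ^+ 2) ->
  cint 0 tau (fun t => U 1 t * kappa t) = cint 0 tau (fun t => U sigma t * kappa t).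
Proof.
move=> okU s1 tau0 Uper Hloc.
(* An affine change of variables carries the unit square of [bisection_le0] to the rectangle
   [[sigma, 1] * [0, tau]]. *)
pose E h x y := modulus (boundary_int kappa U (sigma + (1 - sigma) * x)
  (sigma + (1 - sigma) * (x + h)) (tau * y) (tau * (y + h))).
have ds : 0 <= 1 - sigma by lra.
have E1 : E 1 0 0 <= 0.
  apply: bisection_le0.
    move=> h x y h0 x0 xh y0 yh.
    have hh : h = h / 2 + h / 2 by field.
    have h2 : 0 < h / 2 by lra.
    set x' := x + h / 2; set y' := y + h / 2.
    have -> : E h x y = modulus (boundary_int kappa U (sigma + (1 - sigma) * x)
      (sigma + (1 - sigma) * (x' + h / 2)) (tau * y) (tau * (y' + h / 2))).
      by rewrite /E /x' /y' -!addrA -hh.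
    have [a1 a2 a3] : [/\ sigma <= sigma + (1 - sigma) * x,
        sigma + (1 - sigma) * x <= sigma + (1 - sigma) * x' &
        sigma + (1 - sigma) * x' <= sigma + (1 - sigma) * (x' + h / 2)].
      by split; rewrite ?lerDl ?mulr_ge0 // lerD2l ler_wpM2l // /x'; lra.
    have a4 : sigma + (1 - sigma) * (x' + h / 2) <= 1.
      rewrite -lerBrDl -[leRHS]mulr1 ler_wpM2l // /x'; lra.
    have [b1 b2] : tau * y <= tau * y' /\ tau * y' <= tau * (y' + h / 2).
      by split; rewrite ler_wpM2l // /y'; lra.
    rewrite (boundary_int_split_s _ _ okU a1 a2 a3 a4).
    rewrite (boundary_int_split_t okU a1 a2 (le_trans a3 a4) b1 b2).
    rewrite (boundary_int_split_t okU (le_trans a1 a2) a3 a4 b1 b2).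
    apply: (le_trans (ler_modulusD _ _)).
    apply: (le_trans (lerD (ler_modulusD _ _) (ler_modulusD _ _))).
    by rewrite /E -/x' -/y' [leLHS]addrACA.
  move=> p q e /andP[p0 p1] /andP[q0 q1] e0.
  have [||d d0 Hd] := Hloc (sigma + (1 - sigma) * p) (tau * q) e _ _ e0.
  - by rewrite lerDl mulr_ge0 //= -lerBrDl -[leRHS]mulr1 ler_wpM2l.
  - by rewrite mulr_ge0 //= -[leRHS]mulr1 ler_wpM2l.
  exists d => // h x y h0 x0 xh y0 yh /andP[xp px] /andP[yq qy].
  rewrite /E; have -> : sigma + (1 - sigma) * (x + h) = sigma + (1 - sigma) * x + (1 - sigma) * h.
    by ring.
  have -> : tau * (y + h) = tau * y + tau * h by ring.
  apply: Hd => //.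
  - by rewrite lerDl mulr_ge0.
  - by rewrite -addrA -mulrDr -lerBrDl -[leRHS]mulr1 ler_wpM2l.
  - by rewrite mulr_ge0.
  - by rewrite -mulrDr -[leRHS]mulr1 ler_wpM2l.
  - by rewrite -addrA -mulrDr !lerD2l !ler_wpM2l.
  - by rewrite -mulrDr !ler_wpM2l.
have : boundary_int kappa U sigma 1 0 tau = 0.
  apply/eqP; rewrite -modulus_eq0 eq_le modulus_ge0 andbT.
  move: E1; rewrite /E !mulr0 addr0 add0r !mulr1.
  by have -> : sigma + (1 - sigma) = 1 by ring.
rewrite /boundary_int.
rewrite [X in _ + ic * X](_ : _ = cint sigma 1 (fun=> 0)); last first.
  by apply: eq_cint => s _; rewrite Uper subrr mul0r.
rewrite cint_cst // mul0r mulr0 addr0 => H0.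
apply/eqP; rewrite -subr_eq0 -H0 -cintB; last 2 first.
- by apply: cont_onM => t _; [apply: okU.1; rewrite s1 lexx|exact: ckappa].
- by apply: cont_onM => t _; [apply: okU.1; rewrite s1 lexx|exact: ckappa].
by apply/eqP; apply: eq_cint => t _; rewrite mulrBl.
Qed.

End Goursat.

(** * Cauchy's formula on a circle centred at the origin *)

Section CauchyFormula.
Context {R : realType}.
Implicit Types (s t : R) (z w : C R).

Lemma continuous_comp_derivable (T : topologicalType) (f : C R -> C R) (g : T -> C R) (t : T) :
  derivable f (g t) 1 -> {for t, continuous g} -> {for t, continuous (fun u => f (g u))}.
Proof.
move=> /derivable_continuous cf cg; exact: cvg_comp cg cf.
Qed.

Context (rho : R) (rho0 : 0 < rho).

Let onc t : C R := rc rho * circle_point t.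

Lemma modulus_onc t : modulus (onc t) = rho.
Proof. by rewrite modulusM modulus_circle_point mulr1 modulus_rc gtr0_norm. Qed.

Lemma continuous_onc : continuous onc.
Proof. by move=> t; apply: cvgM; [exact: cvg_cst|exact: continuous_circle_point]. Qed.

Context (z : C R) (hz : modulus z < rho).

Let k t : C R := onc t - z.
(** The homotopy that contracts the circle to [z] along segments as [s] goes from 1 to 0. *)
Let gam s t : C R := z + rc s * k t.
Let kap t : C R := onc t / k t.

Let k_lb t : rho - modulus z <= modulus (k t).
Proof. by rewrite -{1}(modulus_onc t) lerB_modulus. Qed.

Let k_ub t : modulus (k t) <= 2 * rho.
Proof.
by rewrite (le_trans (ler_modulusB _ _)) // modulus_onc mulr_natl mulr2n lerD2l ltW.
Qed.

Let k_neq0 t : k t != 0.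
Proof. by rewrite -modulus_gt0 (lt_le_trans _ (k_lb t)) // subr_gt0. Qed.

Let kap_ub t : modulus (kap t) <= rho / (rho - modulus z).
Proof.
rewrite modulusMV modulus_onc ler_wpM2l ?(ltW rho0) //.
by rewrite lef_pV2 ?k_lb // posrE ?subr_gt0 // (lt_le_trans _ (k_lb t)) ?subr_gt0.
Qed.

Let ck : continuous k.
Proof. by move=> t; apply: cvgB; [exact: continuous_onc|exact: cvg_cst]. Qed.

Let ckap : continuous kap.
Proof.
move=> t; apply: cvgM; first exact: continuous_onc.
by apply: cvgV; [exact: k_neq0|exact: ck].
Qed.

Let gam_in s t : 0 <= s <= 1 -> modulus (gam s t) <= rho.
Proof.
move=> /andP[s0 s1].
have -> : gam s t = rc (1 - s) * z + rc s * onc t.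
  by rewrite /gam /k rcD rcN rc1; ring.
apply: (le_trans (ler_modulusD _ _)).
rewrite (modulusM (rc _) z) (modulusM (rc s)) !modulus_rc modulus_onc.
rewrite !ger0_norm ?subr_ge0 //.
have : (1 - s) * modulus z <= (1 - s) * rho by rewrite ler_wpM2l ?subr_ge0 // ltW.
by move=> h; apply: (le_trans (lerD h (lexx _))); rewrite -mulrDl subrK mul1r.
Qed.

Let gamB s s' t t' : 0 <= s' <= 1 ->
  modulus (gam s t - gam s' t') <= 2 * rho * (`|s - s'| + `|t - t'|).
Proof.
move=> /andP[s0 s1].
have -> : gam s t - gam s' t' =
    rc (s - s') * k t + rc s' * (rc rho * (circle_point t - circle_point t')).
  by rewrite /gam /k /onc rcD rcN; ring.
apply: (le_trans (ler_modulusD _ _)); rewrite !modulusM !modulus_rc mulrDr.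
apply: lerD; first by rewrite mulrC ler_wpM2r ?k_ub.
rewrite (ger0_norm s0) (gtr0_norm rho0).
rewrite mulrC -[leRHS]mulr1; apply: ler_pM => //; first by rewrite mulr_ge0 ?modulus_ge0 // ltW.
rewrite -mulrA [leRHS]mulrCA; apply: ler_wpM2l; first exact: ltW.
exact: modulus_circle_pointB.
Qed.

Context (f : C R -> C R) (df : forall w, modulus w <= rho -> derivable f w 1).

Let U s t := f (gam s t).

Let cgams s : continuous (gam s).
Proof.
move=> t; apply: cvgD; first exact: cvg_cst.
by apply: cvgM; [exact: cvg_cst|exact: ck].
Qed.

Let cgamt t : continuous (fun s => gam s t).
Proof.
move=> s; apply: cvgD; first exact: cvg_cst.
by apply: cvgM; [apply: continuous_comp_rc; exact: cvg_id|exact: cvg_cst].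
Qed.

Let sepU sigma : 0 < sigma -> separately_continuous sigma U.
Proof.
move=> sigma0; split.
  move=> s /andP[s0 s1] t; apply: continuous_comp_derivable; last exact: cgams.
  by apply: df; apply: gam_in; rewrite (le_trans (ltW sigma0) s0).
move=> t s /andP[s0 s1]; apply: (@continuous_comp_derivable _ f (fun s => gam s t)); last exact: cgamt.
by apply: df; apply: gam_in; rewrite (le_trans (ltW sigma0) s0).
Qed.

Let sep_affine sigma (A B : C R) : separately_continuous sigma (fun s t => A + B * (gam s t - z)).
Proof.
by split=> [s _ t|t s _]; apply: cvgD; [exact: cvg_cst| |exact: cvg_cst| ];
  apply: cvgM; [exact: cvg_cst| |exact: cvg_cst| ]; apply: cvgB;
  [exact: cgams|exact: cvg_cst|exact: cgamt|exact: cvg_cst].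
Qed.

(* The pulled back form is closed for affine [f], so the Goursat estimate only
   sees the [o(|zeta - zeta0|)] remainder. *)
Let boundary_int_affine sigma (A B : C R) s1 s2 t1 t2 : 0 < sigma ->
  sigma <= s1 -> s1 <= s2 -> s2 <= 1 -> t1 <= t2 ->
  boundary_int kap (fun s t => A + B * (gam s t - z)) s1 s2 t1 t2 = 0.
Proof.
move=> sigma0 h1 h2 h3 h4; rewrite /boundary_int.
rewrite (@eq_cint _ _ _ _ (fun t => B * rc (s2 - s1) * rc rho * circle_point t)); last first.
  move=> t _; rewrite /gam /kap /onc rcD rcN; move: (k_neq0 t) => /=; move: (k t) => kt kt0.
  by field.
rewrite cintZ; last by move=> t _; exact: continuous_circle_point.
rewrite cint_circle_point //.
rewrite [X in _ + ic * X](@eq_cint _ _ _ _ (fun t => B * (k t2 - k t1))); last first.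
  move=> s /andP[ss _]; rewrite /gam.
  have s0 : rc s != 0 by rewrite -modulus_gt0 modulus_rc normr_gt0 gt_eqF // (lt_le_trans sigma0) // (le_trans h1).
  have -> : rc s^-1 = (rc s)^-1.
    by apply: (mulIf s0); rewrite mulVf // -rcM mulVf // -(inj_eq (@rc_inj R)).
  by field.
by rewrite cint_cst // /k /onc; ring.
Qed.

(** Goursat's local estimate. Subtracting from [f] its affine part at [gam p q] does not change the
    boundary integral; the remainder is at most [e / D * (L * h)] on a cell of size [h], and the
    side lengths supply the second factor [h]. *)
Let local_bound sigma : 0 < sigma <= 1 -> forall p q e : R, sigma <= p <= 1 -> 0 < e ->
  exists2 d : R, 0 < d & forall h s t : R, 0 < h < d -> sigma <= s -> s + (1 - sigma) * h <= 1 ->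
    s <= p <= s + (1 - sigma) * h -> t <= q <= t + 2 * pi * h ->
    modulus (boundary_int kap U s (s + (1 - sigma) * h) t (t + 2 * pi * h)) <= e * h ^+ 2.
Proof.
move=> /andP[sigma0 sigma1] p q e /andP[p0 p1] e0.
have pi0 := pi_gt0 R.
pose K := rho / (rho - modulus z).
have K0 : 0 < K by rewrite divr_gt0 ?subr_gt0.
(* [L * h] bounds the distance from [gam p q] to the image of any point of the cell. *)
pose L := 2 * rho * (1 + 2 * pi).
have L0 : 0 < L by rewrite /L !mulr_gt0 // addr_gt0 // mulr_gt0.
(* [D] collects the constants of [boundary_int_bound], so that the final bound is exactly
   [e * h^2]. *)
pose D := 4 * L * (K * (2 * pi) + sigma^-1).
have D0 : 0 < D.
  apply: mulr_gt0; first exact: mulr_gt0.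
  by apply: addr_gt0; [apply: mulr_gt0 => //; exact: mulr_gt0|rewrite invr_gt0].
have pin : 0 <= p <= 1 by rewrite p1 (le_trans (ltW sigma0)).
have [B HB] := (derivable_modulusP f (gam p q)).1 (df (gam_in q pin)).
have [r r0 Hr] := HB (e / D) (divr_gt0 e0 D0).
exists (r / L); first exact: divr_gt0.
move=> h s t /andP[h0 hd] ss sh ps qt.
have h0' := ltW h0.
have sh0 : s <= s + (1 - sigma) * h by rewrite lerDl mulr_ge0 // subr_ge0.
have th0 : t <= t + 2 * pi * h by rewrite lerDl !mulr_ge0 // ltW.
pose A := f (gam p q) + B * (z - gam p q).
pose V s t := U s t - (A + B * (gam s t - z)).
have sepV : separately_continuous sigma V.
  have [c1 c2] := sepU sigma0; have [c3 c4] := sep_affine sigma A B.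
  split=> [s' hs' t'|t' s' hs']; apply: cvgB.
  - exact: (c1 _ hs').
  - exact: (c3 _ hs').
  - exact: (c2 _ _ hs').
  - exact: (c4 _ _ hs').
rewrite [U](_ : _ = fun s t => V s t + (A + B * (gam s t - z))); last first.
  by apply/funext => s'; apply/funext => t'; rewrite /V subrK.
rewrite (boundary_intD sigma0 ckap _ _ sepV (sep_affine _ _ _)) //.
rewrite (boundary_int_affine _ _ sigma0) // addr0.
apply: (le_trans (boundary_int_bound (M := e / D * (L * h)) (K := K) sigma0 ckap sepV _ _ _ _ _ _)) => //.
  move=> s' t' /andP[a1 a2] /andP[b1 b2].
  have -> : V s' t' = f (gam s' t') - f (gam p q) - B * (gam s' t' - gam p q).
    by rewrite /V /U /A; ring.
  have gL : modulus (gam s' t' - gam p q) <= L * h.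
    apply: (le_trans (gamB _ _ _ pin)).
    rewrite /L -[leRHS]mulrA; apply: ler_wpM2l; first by rewrite mulr_ge0 // ltW.
    rewrite mulrDl mul1r; apply: lerD; rewrite ler_norml.
      have : (1 - sigma) * h <= h by rewrite ler_piMl // lerBlDr lerDl ltW.
      move=> hh; case/andP: ps => ps1 ps2; apply/andP; split; lra.
    by case/andP: qt => qt1 qt2; apply/andP; split; lra.
  apply: (le_trans (Hr _ _)).
    by apply: (le_lt_trans gL); rewrite mulrC -ltr_pdivlMr.
  by apply: ler_wpM2l => //; rewrite divr_ge0 // ltW.
have -> : t + 2 * pi * h - t = 2 * pi * h by ring.
have -> : s + (1 - sigma) * h - s = (1 - sigma) * h by ring.
have D1 : D != 0 by rewrite gt_eqF.
have : sigma^-1 * ((1 - sigma) * h) <= sigma^-1 * h.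
  by rewrite ler_wpM2l ?invr_ge0 ?(ltW sigma0) // ler_piMl // lerBlDr lerDl ltW.
move=> hh; have -> : e * h ^+ 2 = 4 * (e / D * (L * h)) * (K * (2 * pi * h) + sigma^-1 * h).
  rewrite [LHS](_ : _ = e / D * h ^+ 2 * D); first by rewrite /D; ring.
  by field.
apply: ler_wpM2l; last by rewrite lerD2l.
by apply: mulr_ge0 => //; apply: mulr_ge0; [apply: divr_ge0|apply: mulr_ge0]; exact: ltW.
Qed.

(** The integral over the circle equals the one over its contraction by [sigma], for every [sigma]
    in []0, 1]]; as [sigma] tends to 0, [f] tends to [f z] along the contracted curve. The integral
    of the kernel alone is evaluated later, from the case [z = 0]. *)
Lemma cauchy_formula_kernel :
  cint 0 (2 * pi) (fun t => f (rc rho * circle_point t) * (rc rho * circle_point t / (rc rho * circle_point t - z)))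
  = f z * cint 0 (2 * pi) (fun t => rc rho * circle_point t / (rc rho * circle_point t - z)).
Proof.
have pi0 := pi_gt0 R.
have pi2 : 0 <= 2 * pi :> R by rewrite mulr_ge0 // ltW.
pose K := rho / (rho - modulus z).
have K0 : 0 < K by rewrite divr_gt0 ?subr_gt0.
have step sigma : 0 < sigma <= 1 ->
    cint 0 (2 * pi) (fun t => U 1 t * kap t) = cint 0 (2 * pi) (fun t => U sigma t * kap t).
  move=> sg; case/andP: (sg) => sigma0 sigma1.
  apply: (boundary_int_periodic_eq sigma0 ckap (sepU sigma0)) => //.
  - by move=> s; rewrite /U /gam /k /onc circle_point2pi circle_point0.
  - move=> p q e hp hq e0; have [d d0 Hd] := local_bound sg q hp e0.
    by exists d => // h s t h1 h2 h3 _ _ h6 h7; exact: Hd.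
have ckp : cont_on 0 (2 * pi) kap by move=> t _; exact: ckap.
have -> : (fun t => f (rc rho * circle_point t) * (rc rho * circle_point t / (rc rho * circle_point t - z)))
  = (fun t => U 1 t * kap t).
  by apply/funext => t; rewrite /U; congr (f _ * _); rewrite /gam /k /onc rc1; ring.
rewrite -/kap -cintZ //; apply/eqP; rewrite -subr_eq0 -modulus_eq0 eq_le modulus_ge0 andbT.
rewrite leNgt; apply/negP => m0; set m := modulus _ in m0.
(* If the values of [f] are within [m / D / 2] of [f z], the integral bound gives [m <= m / 2]. *)
pose D := 2 * K * (2 * pi).
have D0 : 0 < D by apply: mulr_gt0; exact: mulr_gt0.
have cf : {for z, continuous f} by apply: derivable_continuous; apply: df; exact: ltW.
have [d d0 Hd] := (continuous_modulusP _ _).1 cf (m / D / 2) (divr_gt0 (divr_gt0 m0 D0) (ltr0n _ 2)).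
(* The contracted curve stays within [2 * rho * sigma < d] of [z]. *)
pose sigma := Num.min 1 (d / (4 * rho)).
have sg : 0 < sigma <= 1.
  by rewrite /sigma lt_min ltr01 divr_gt0 ?mulr_gt0 //= ge_min lexx.
have sgd : sigma * (4 * rho) <= d.
  by rewrite -ler_pdivlMr ?mulr_gt0 // /sigma ge_min lexx orbT.
case/andP: (sg) => sigma0 sigma1.
have cU1 : cont_on 0 (2 * pi) (fun t => U sigma t * kap t).
  apply: cont_onM ckp => t _; apply: (sepU sigma0).1; rewrite lexx sigma1 //.
have cU2 : cont_on 0 (2 * pi) (fun t => f z * kap t).
  by apply: cont_onM ckp; exact: cont_on_cst.
have mE : m = modulus (cint 0 (2 * pi) (fun t => U sigma t * kap t - f z * kap t)).
  by rewrite /m (step _ sg) -(cintB cU1 cU2).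
have : m <= 2 * (m / D / 2 * K) * (2 * pi - 0).
  rewrite [leLHS]mE; apply: (cint_bound pi2 (cont_onB cU1 cU2)).
  move=> t _; rewrite -mulrBl modulusM ler_pM ?modulus_ge0 ?kap_ub //.
  apply: ltW; apply: (Hd (gam sigma t)); rewrite /gam addrAC subrr add0r modulusM modulus_rc gtr0_norm //.
  apply: le_lt_trans (_ : sigma * (2 * rho) < d); first by rewrite ler_wpM2l // ltW.
  apply: lt_le_trans sgd; rewrite ltr_pM2l // ltr_pM2r // ltr_nat //.
have -> : 2 * (m / D / 2 * K) * (2 * pi - 0) = m / D * D / 2 by rewrite /D; ring.
rewrite mulfVK ?gt_eqF //; lra.
Qed.

End CauchyFormula.

(** * Mean value property and Taylor expansion with remainder *)

Section Taylor.
Context {R : realType}.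
Implicit Types (t rho : R) (z w a : C R) (f : C R -> C R).

(** For [z = 0] the kernel is constantly 1, so its integral is immediate. *)
Lemma cauchy_mean f rho : 0 < rho -> (forall w, modulus w <= rho -> derivable f w 1) ->
  cint 0 (2 * pi) (fun t => f (rc rho * circle_point t)) = f 0 * rc (2 * pi).
Proof.
move=> rho0 df; have z0 : modulus (0 : C R) < rho by rewrite modulus0.
have pi2 : 0 <= 2 * pi :> R by rewrite mulr_ge0 // pi_ge0.
have E t : rc rho * circle_point t / (rc rho * circle_point t - 0) = 1.
  by rewrite subr0 divff // -modulus_gt0 modulus_onc.
have := cauchy_formula_kernel rho0 z0 df.
under eq_cint do rewrite E mulr1.
move=> ->; congr (_ * _); under eq_cint do rewrite E.
by rewrite cint_cst // mul1r subr0.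
Qed.

Lemma conjcB_C z w : conjc (z - w) = conjc z - conjc w :> C R.
Proof. by apply: complexP; case: z w => [? ?] [? ?] //=; rewrite opprD. Qed.

Lemma conjcM_C z w : conjc (z * w) = conjc z * conjc w :> C R.
Proof. by apply: complexP; case: z w => [? ?] [? ?] /=; ring. Qed.

Lemma conjcK_C z : conjc (conjc z) = z :> C R.
Proof. by apply: complexP; case: z => [? ?] //=; rewrite opprK. Qed.

Lemma modulus_conjc z : modulus (conjc z : C R) = modulus z.
Proof. by rewrite !modulusE; case: z => [? ?] /=; rewrite sqrrN. Qed.

Lemma mulC_conjc z : conjc z * z = rc (modulus z ^+ 2) :> C R.
Proof.
rewrite modulusE sqr_sqrtr ?addr_ge0 ?sqr_ge0 //.
by apply: complexP; case: z => [? ?] /=; ring.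
Qed.

Lemma conjc_div z w : conjc (z / w) = conjc z / conjc w :> C R.
Proof.
have [->|w0] := eqVneq w 0.
  by rewrite invr0 mulr0 conjc0 invr0 mulr0.
have cw0 : (conjc w : C R) != 0 by rewrite -modulus_gt0 modulus_conjc modulus_gt0.
by apply: (mulIf cw0); rewrite -conjcM_C !mulfVK.
Qed.

Lemma derivable_modulus_shift f a z : derivable f (a + z) 1 -> derivable (fun w => f (a + w)) z 1.
Proof.
move=> /derivable_modulusP [d Hd]; apply/derivable_modulusP; exists d => e /Hd [r r0 Hr].
have E w : a + w - (a + z) = w - z by rewrite opprD addrACA subrr add0r.
by exists r => // w; rewrite -E; exact: Hr.
Qed.

(* The conjugate of the kernel is the restriction to the circle of a function
   holomorphic on the closed disk with value 1 at the center. *)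
Lemma cauchy_kernel_int rho z : 0 < rho -> modulus z < rho ->
  cint 0 (2 * pi) (fun t => rc rho * circle_point t / (rc rho * circle_point t - z)) = rc (2 * pi).
Proof.
move=> rho0 hz.
pose g w : C R := (rc (rho ^+ 2)) * (rc (rho ^+ 2) - (conjc z : C R) * w)^-1.
have den w : modulus w <= rho -> rc (rho ^+ 2) - (conjc z : C R) * w != 0.
  move=> hw; rewrite -modulus_gt0 (lt_le_trans _ (lerB_modulus _ _)) // subr_gt0.
  rewrite modulusM modulus_conjc modulus_rc ger0_norm ?sqr_ge0 // expr2.
  apply: le_lt_trans (_ : modulus z * rho < _); first by rewrite ler_wpM2l ?modulus_ge0.
  by rewrite ltr_pM2r.
have dg w : modulus w <= rho -> derivable g w 1.
  move=> hw; apply: derivableM; first exact: derivable_cst.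
  apply: derivableV; first exact: den.
  apply: derivableB; first exact: derivable_cst.
  by apply: derivableM; [exact: derivable_cst|exact: derivable_id].
have ck : cont_on 0 (2 * pi) (fun t => rc rho * circle_point t / (rc rho * circle_point t - z)).
  apply: cont_onM; first by move=> t _; exact: continuous_onc.
  move=> t _; apply: cvgV; last by apply: cvgB; [exact: continuous_onc|exact: cvg_cst].
  rewrite -modulus_gt0 (lt_le_trans _ (lerB_modulus _ _)) // subr_gt0 modulus_onc //.
rewrite -[LHS]conjcK_C -(cint_conjc ck).
have E t : conjc (rc rho * circle_point t / (rc rho * circle_point t - z)) = g (rc rho * circle_point t) :> C R.
  set c := rc rho * circle_point t.
  have mc : modulus c = rho by exact: modulus_onc.
  have c0 : c != 0 by rewrite -modulus_gt0 mc.
  have cc : conjc c * c = rc (rho ^+ 2) :> C R by rewrite mulC_conjc mc.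
  rewrite conjc_div conjcB_C /g -cc.
  have h : conjc c * c - conjc z * c != 0 :> C R by rewrite cc den ?mc.
  move: h; rewrite -mulrBl mulf_eq0 (negbTE c0) orbF => h.
  by field; rewrite h c0.
under eq_cint do rewrite E.
rewrite (cauchy_mean rho0 dg) /g mulr0 subr0 divff ?mul1r.
  by apply: complexP => /=; rewrite ?oppr0.
by rewrite -modulus_gt0 modulus_rc normr_gt0 expf_neq0 // gt_eqF.
Qed.

(** The expansion [o / (o - z) = 1 + (z / o) * (o / (o - z))] of the kernel gives
    [I m = c m + z * I m.+1] for the Cauchy integrals [I m] of [f / o^m], and [I 0 = f z]. The
    explicit remainder replaces convergence of a power series; later only the orders [n <= 3]
    occur. *)
Lemma taylor_disk f rho (M : R) : 0 < rho ->
  (forall w, modulus w <= rho -> derivable f w 1) ->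
  (forall t, 0 <= t <= 2 * pi -> modulus (f (rc rho * circle_point t)) <= M) ->
  exists c : nat -> C R, forall n z, modulus z < rho -> exists2 r : C R,
    f z = \sum_(k < n) c k * z ^+ k + z ^+ n * r &
    modulus r <= 2 * M * (rho / (rho - modulus z)) / rho ^+ n.
Proof.
move=> rho0 df fM.
pose o t : C R := rc rho * circle_point t.
have o0 t : o t != 0 by rewrite -modulus_gt0 modulus_onc.
have pi0 := pi_gt0 R.
have pi2 : 0 < 2 * pi :> R by rewrite mulr_gt0.
have p20 : rc (2 * pi) != 0 :> C R by rewrite -modulus_gt0 modulus_rc normr_gt0 gt_eqF.
pose c n : C R := (rc (2 * pi))^-1 * cint 0 (2 * pi) (fun t => f (o t) * (o t)^-1 ^+ n).
exists c => n z hz.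
have oz0 t : o t - z != 0.
  by rewrite -modulus_gt0 (lt_le_trans _ (lerB_modulus _ _)) // subr_gt0 modulus_onc.
pose I n : C R := (rc (2 * pi))^-1 * cint 0 (2 * pi) (fun t => f (o t) * (o t)^-1 ^+ n * (o t / (o t - z))).
have cf : cont_on 0 (2 * pi) (fun t => f (o t)).
  move=> t _; apply: continuous_comp_derivable; last exact: continuous_onc.
  by apply: df; rewrite modulus_onc.
have cfn m : cont_on 0 (2 * pi) (fun t => f (o t) * (o t)^-1 ^+ m).
  apply: cont_onM cf _ => t _; elim: m => [|m IH].
    rewrite (_ : (fun=> _) = fun=> 1); first exact: cvg_cst.
    by apply/funext => u; rewrite expr0.
  rewrite (_ : (fun=> _) = fun u => (o u)^-1 * (o u)^-1 ^+ m); last first.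
    by apply/funext => u; rewrite exprS.
  by apply: cvgM IH; apply: cvgV; [exact: o0|exact: continuous_onc].
have ck : cont_on 0 (2 * pi) (fun t => o t / (o t - z)).
  apply: cont_onM; first by move=> t _; exact: continuous_onc.
  move=> t _; apply: cvgV; first exact: oz0.
  by apply: cvgB; [exact: continuous_onc|exact: cvg_cst].
have fE : f z = I 0%N.
  apply: (mulfI p20); rewrite mulrC /I mulrA divff // mul1r.
  rewrite -(cauchy_kernel_int rho0 hz) -(cauchy_formula_kernel rho0 hz df).
  by apply: eq_cint => t _; rewrite expr0 mulr1.
have IS m : I m = c m + z * I m.+1.
  rewrite /I /c mulrCA -mulrDr; congr (_ * _).
  rewrite -(cintZ _ (cont_onM (cfn m.+1) ck)) -cintD; first last.
  - by apply: cont_onM (cont_onM (cfn m.+1) ck); exact: cont_on_cst.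
  - exact: cfn.
  apply: eq_cint => t _; rewrite exprS; move: (o0 t) (oz0 t) (_ ^+ m) (f _) => ot0 otz y fo.
  by field; rewrite otz ot0.
exists (I n).
  rewrite fE; elim: n => [|n IH]; first by rewrite big_ord0 add0r expr0 mul1r.
  by rewrite big_ord_recr /= IH IS exprSr; ring.
rewrite /I modulusM modulusV modulus_rc gtr0_norm //.
rewrite mulrC ler_pdivrMr //.
have -> : 2 * M * (rho / (rho - modulus z)) / rho ^+ n * (2 * pi) =
  2 * (M / rho ^+ n * (rho / (rho - modulus z))) * (2 * pi - 0) by ring.
apply: (cint_bound (ltW pi2) (cont_onM (cfn n) ck)) => t tt.
rewrite (modulusM (_ * _)) (modulusM (f _)) modulusX modulusV modulusMV modulus_onc // exprVn.
have lb : rho - modulus z <= modulus (o t - z) by rewrite -{1}(modulus_onc rho0 t) lerB_modulus.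
have lb0 : 0 < rho - modulus z by rewrite subr_gt0.
apply: ler_pM.
- by rewrite mulr_ge0 ?modulus_ge0 // invr_ge0 exprn_ge0 // ltW.
- by rewrite divr_ge0 ?modulus_ge0 // ltW.
- by rewrite ler_wpM2r ?fM // invr_ge0 exprn_ge0 // ltW.
rewrite ler_wpM2l ?(ltW rho0) // lef_pV2 // posrE //.
exact: lt_le_trans lb.
Qed.

Lemma bounded_on_circle f rho : 0 < rho -> (forall w, modulus w <= rho -> derivable f w 1) ->
  exists2 M, 0 < M & forall t, 0 <= t <= 2 * pi -> modulus (f (rc rho * circle_point t)) <= M.
Proof.
move=> rho0 df.
have pi2 : 0 <= 2 * pi :> R by rewrite mulr_ge0 // pi_ge0.
have [|x xi Hx] := @EVT_max R (fun t => modulus (f (rc rho * circle_point t))) 0 (2 * pi) pi2.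
  apply: cont_on_within => t _; apply: continuous_comp_modulus.
  apply: continuous_comp_derivable; last exact: continuous_onc.
  by apply: df; rewrite modulus_onc.
exists (modulus (f (rc rho * circle_point x)) + 1); first by rewrite ltr_wpDl ?modulus_ge0.
by move=> t tt; rewrite (le_trans (Hx t _)) ?lerDl // in_itv.
Qed.

Lemma taylor_at f a rho (M : R) : 0 < rho ->
  (forall w, modulus (w - a) <= rho -> derivable f w 1) ->
  (forall t, 0 <= t <= 2 * pi -> modulus (f (a + rc rho * circle_point t)) <= M) ->
  exists c : nat -> C R, forall n w, modulus (w - a) < rho -> exists2 r : C R,
    f w = \sum_(k < n) c k * (w - a) ^+ k + (w - a) ^+ n * r &
    modulus r <= 2 * M * (rho / (rho - modulus (w - a))) / rho ^+ n.
Proof.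
move=> rho0 df fM.
have [|//|c Hc] := @taylor_disk (fun w => f (a + w)) rho M rho0 _ _.
  move=> w hw; apply: derivable_modulus_shift; apply: df.
  by rewrite addrAC subrr add0r.
exists c => n w hw; have [r Hr Mr] := Hc n (w - a) hw.
by exists r => //; rewrite -Hr addrC subrK.
Qed.

End Taylor.

(** * Zeros of holomorphic functions on the disk *)

Section Holomorphic.
Context {R : realType}.
Implicit Types (z w a b : C R) (f g F G : C R -> C R).

Lemma derivable_near_eq f g z : (\forall w \near z, f w = g w) ->
  derivable f z 1 -> derivable g z 1.
Proof.
move=> /nbhs_modulusP [d d0 fg] /derivable_modulusP [D HD]; apply/derivable_modulusP.
exists D => e /HD [r r0 Hr]; exists (Num.min d r); first by rewrite lt_min d0.
move=> w; rewrite lt_min => /andP[wd wr].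
by rewrite -!fg ?subrr ?modulus0 //; exact: Hr.
Qed.

Lemma near_unit_disk a : unit_disk a -> \forall w \near a, unit_disk w.
Proof.
move=> /unit_diskE a1; apply/nbhs_modulusP; exists (1 - modulus a); first by rewrite subr_gt0.
move=> w wa; apply/unit_diskE.
by have := ler_modulusD (w - a) a; rewrite subrK => h; lra.
Qed.

Lemma near_neq a b : a != b -> \forall w \near a, w != b.
Proof.
move=> ab; apply/nbhs_modulusP; exists (modulus (b - a)).
  by rewrite modulus_gt0 subr_eq0 eq_sym.
by move=> w; apply: contraTneq => ->; rewrite ltxx.
Qed.

Lemma continuous_eq_punctured f g a : {for a, continuous f} -> {for a, continuous g} ->
  (\forall w \near a^', f w = g w) -> f a = g a.
Proof.
move=> cf cg fg; apply/eqP; rewrite -subr_eq0 -modulus_eq0 eq_le modulus_ge0 andbT leNgt.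
apply/negP => m0; set m := modulus _ in m0.
have m2 : 0 < m / 2 by rewrite divr_gt0.
have [d1 d10 H1] := (continuous_modulusP _ _).1 cf _ m2.
have [d2 d20 H2] := (continuous_modulusP _ _).1 cg _ m2.
have [d3 d30 H3] := (dnbhs_modulusP _ _).1 fg.
pose d := Num.min d1 (Num.min d2 d3) / 2.
have d0 : 0 < d by rewrite divr_gt0 // !lt_min d10 d20 d30.
have mind : 2 * d <= d1 /\ 2 * d <= d2 /\ 2 * d <= d3.
  have -> : 2 * d = Num.min d1 (Num.min d2 d3) by rewrite /d; field.
  by rewrite !ge_min !lexx !orbT.
have [e1 [e2 e3]] := mind.
have E : modulus (a + rc d - a) = d.
  by rewrite addrAC subrr add0r modulus_rc gtr0_norm.
have ne : a + rc d != a.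
  by rewrite -subr_eq0 -modulus_gt0 E.
have h1 := H1 (a + rc d); have h2 := H2 (a + rc d); have h3 := H3 (a + rc d) ne.
rewrite E in h1 h2 h3.
have k1 : modulus (f (a + rc d) - f a) < m / 2 by apply: h1; lra.
have k2 : modulus (g (a + rc d) - g a) < m / 2 by apply: h2; lra.
have k3 : f (a + rc d) = g (a + rc d) by apply: h3; lra.
have := ler_distD_modulus (f (a + rc d)) (f a) (g a).
rewrite -/m modulus_distC {2}k3; lra.
Qed.

Lemma holomorphic_continuous G a : holomorphic_on_disk G -> unit_disk a -> {for a, continuous G}.
Proof. by move=> hG /hG; exact: derivable_continuous. Qed.

Lemma modulus_ball a w (rho : R) : rho < 1 - modulus a -> modulus (w - a) <= rho -> modulus w < 1.
Proof. by move=> h1 h2; have := ler_modulusD (w - a) a; rewrite subrK; lra. Qed.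

Lemma holomorphic_taylor G a (rho : R) : holomorphic_on_disk G -> 0 < rho -> rho < 1 - modulus a ->
  exists (M : R) (c : nat -> C R), 0 < M /\ forall n w, modulus (w - a) < rho -> exists2 r : C R,
    G w = \sum_(k < n) c k * (w - a) ^+ k + (w - a) ^+ n * r &
    modulus r <= 2 * M * (rho / (rho - modulus (w - a))) / rho ^+ n.
Proof.
move=> hG r0 r1.
have dG w : modulus (w - a) <= rho -> derivable G w 1.
  by move=> h; apply: hG; apply/unit_diskE; apply: modulus_ball r1 h.
have [|M M0 HM] := @bounded_on_circle R (fun w => G (a + w)) rho r0.
  by move=> w hw; apply: derivable_modulus_shift; apply: dG; rewrite addrAC subrr add0r.
by have [c Hc] := taylor_at r0 dG HM; exists M, c.
Qed.

(** The remainder of order 0 is the function itself, which gives a maximum principle up to a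
    constant that degrades at the circle. *)
Lemma disk_bound G a (rho M : R) w : holomorphic_on_disk G -> 0 < rho -> rho < 1 - modulus a ->
  (forall v, modulus (v - a) = rho -> modulus (G v) <= M) -> modulus (w - a) < rho ->
  modulus (G w) <= 2 * M * (rho / (rho - modulus (w - a))).
Proof.
move=> hG r0 r1 GM wa.
have [||c Hc] := @taylor_at R G a rho M r0.
- by move=> v h; apply: hG; apply/unit_diskE; apply: modulus_ball r1 h.
- by move=> t _; apply: GM; rewrite addrAC subrr add0r modulus_onc.
have [r -> Mr] := Hc 0%N w wa.
by rewrite big_ord0 add0r expr0 mul1r; rewrite expr0 divr1 in Mr.
Qed.

Lemma holomorphic_bounded G (r : R) : holomorphic_on_disk G -> r < 1 ->
  exists2 M, 0 < M & forall w, modulus w <= r -> modulus (G w) <= M.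
Proof.
(* A radius strictly between [r] and 1; the maximum with [1 / 2] keeps it positive when [r] is
   negative. *)
move=> hG r1; pose rho := Num.max ((1 + r) / 2) (1 / 2).
have rr : r < rho by rewrite lt_max; apply/orP; left; lra.
have rho0 : 0 < rho by rewrite lt_max; apply/orP; right; lra.
have rho1 : rho < 1 - modulus (0 : C R).
  by rewrite modulus0 subr0 gt_max; apply/andP; split; lra.
have [M [c [M0 Hc]]] := holomorphic_taylor hG rho0 rho1.
exists (2 * M * (rho / (rho - r))).
  by apply: mulr_gt0; [exact: mulr_gt0|rewrite divr_gt0 ?subr_gt0].
move=> w wr; have wrho : modulus (w - 0) < rho by rewrite subr0; lra.
have [q -> Mq] := Hc 0%N w wrho; rewrite big_ord0 add0r expr0 mul1r.
apply: (le_trans Mq); rewrite expr0 divr1 subr0.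
apply: ler_wpM2l; first by rewrite mulr_ge0 // ltW.
apply: ler_wpM2l; first exact: ltW.
by rewrite lef_pV2 ?posrE ?subr_gt0 // ?lerB //; rewrite subr0 in wrho.
Qed.

(** The quotient takes the value [c 1] at [a], and the third order expansion shows that its
    derivative there is [c 2]. *)
Lemma holomorphic_divide G a : holomorphic_on_disk G -> unit_disk a -> G a = 0 ->
  exists2 g, holomorphic_on_disk g & forall w, G w = (w - a) * g w.
Proof.
move=> hG /[dup] aD /unit_diskE a1 Ga.
pose rho := (1 - modulus a) / 2.
have rho0 : 0 < rho by rewrite divr_gt0 // subr_gt0.
have rho1 : rho < 1 - modulus a by rewrite /rho; lra.
have [M [c [M0 Hc]]] := holomorphic_taylor hG rho0 rho1.
have c0 : c 0%N = 0.
  have [|r] := Hc 1%N a; first by rewrite subrr modulus0.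
  by rewrite Ga big_ord1 subrr expr0 mulr1 expr1 mul0r addr0.
pose g w := if w == a then c 1%N else G w / (w - a).
exists g; last first.
  move=> w; rewrite /g; case: eqVneq => [->|wa]; first by rewrite Ga subrr mul0r.
  by rewrite mulrC mulfVK // subr_eq0.
move=> z zD; have [->|za] := eqVneq z a; last first.
  apply: (@derivable_near_eq (fun w => G w / (w - a))).
    by apply: filterS (near_neq za) => w wa; rewrite /g (negbTE wa).
  apply: derivableM; first exact: hG.
  apply: derivableV; first by rewrite subr_eq0.
  by apply: derivableB; [exact: derivable_id|exact: derivable_cst].
apply/derivable_modulusP; exists (c 2%N) => e e0.
pose K := 4 * M / rho ^+ 3.
have K0 : 0 < K by apply: divr_gt0; [exact: mulr_gt0|exact: exprn_gt0].
exists (Num.min (rho / 2) (e / K)); first by rewrite lt_min; apply/andP; split; exact: divr_gt0.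
move=> w; rewrite lt_min => /andP[w1 w2].
rewrite {2}/g eqxx /g; have [->|wa] := eqVneq w a.
  by rewrite !subrr mulr0 subr0 modulus0 mulr0.
have wr : modulus (w - a) < rho by lra.
have [r -> Mr] := Hc 3 w wr.
have wa0 : w - a != 0 by rewrite subr_eq0.
rewrite !big_ord_recr big_ord0 /= c0 mul0r !add0r expr1.
rewrite (_ : _ - _ - _ = (w - a) * ((w - a) * r)); last by field.
rewrite modulusM mulrC ler_wpM2r ?modulus_ge0 // modulusM.
have rK : modulus r <= K.
  apply: (le_trans Mr); rewrite /K ler_pM2r ?invr_gt0 ?exprn_gt0 //.
  have -> : 4 * M = 2 * M * 2 by ring.
  rewrite ler_pM2l ?mulr_gt0 // ler_pdivrMr; lra.
apply: le_trans (_ : e / K * K <= e); last by rewrite mulfVK ?gt_eqF.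
by apply: ler_pM; rewrite ?modulus_ge0 // ltW.
Qed.

(** Applying [disk_bound] to the cofactor of [(w - a)^n] gives [|G w| <= K * q^n] with [q < 1]
    independent of [n]. *)
Lemma zero_of_infinite_order G a : holomorphic_on_disk G -> unit_disk a ->
  (forall n, exists2 g, holomorphic_on_disk g & forall w, unit_disk w -> G w = (w - a) ^+ n * g w) ->
  forall w, modulus (w - a) < 1 - modulus a -> G w = 0.
Proof.
move=> hG aD Hn w wa; move/unit_diskE: (aD) => a1.
pose rho := (modulus (w - a) + (1 - modulus a)) / 2.
have w0 := modulus_ge0 (w - a).
have [rho0 rhow rho1] : [/\ 0 < rho, modulus (w - a) < rho & rho < 1 - modulus a].
  by rewrite /rho; split; lra.
clearbody rho.
have wD : unit_disk w by apply/unit_diskE; exact: modulus_ball rho1 (ltW rhow).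
have rr : rho + modulus a < 1 by lra.
have [M M0 HM] := holomorphic_bounded hG rr.
have GM v : modulus (v - a) = rho -> modulus (G v) <= M.
  by move=> h; apply: HM; rewrite -h -{1}(subrK a v) ler_modulusD.
pose q := modulus (w - a) / rho.
have q0 : 0 <= q by rewrite divr_ge0 // ltW.
have q1 : q < 1 by rewrite ltr_pdivrMr ?mul1r.
pose K := 2 * M * (rho / (rho - modulus (w - a))).
have bd n : modulus (G w) <= K * q ^+ n.
  have [g hg Gg] := Hn n.
  rewrite Gg // modulusM modulusX.
  have := @disk_bound g a rho (M / rho ^+ n) w hg rho0 rho1 _ rhow.
  move=> H; apply: le_trans (ler_wpM2l (exprn_ge0 _ w0) (H _)) _.
    move=> v hv; rewrite ler_pdivlMr ?exprn_gt0 //.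
    have := GM v hv; rewrite Gg ?modulusM ?modulusX ?hv 1?mulrC //.
    by apply/unit_diskE; apply: modulus_ball rho1 _; rewrite hv.
  rewrite /K /q expr_div_n le_eqVlt; apply/orP; left; apply/eqP.
  by move: (rho / (rho - _)) (modulus _ ^+ n) (rho ^+ n)^-1 => u v y; ring.
apply/eqP; rewrite -modulus_eq0 eq_le modulus_ge0 andbT.
have cv : K * q ^+ n @[n --> \oo] --> K * 0.
  by apply: cvgM; [exact: cvg_cst|apply: cvg_expr; rewrite ger0_norm].
rewrite mulr0 in cv.
rewrite -(cvg_lim _ cv) //; apply: limr_ge; first exact: cvgP cv.
by apply: nearW => n; exact: bd.
Qed.

(** A cofactor of [(w - a)^n] still vanishes near [a] off [a], hence at [a] by continuity, so
    another factor splits off and the order is infinite. *)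
Lemma zero_near_zero_ball G a : holomorphic_on_disk G -> unit_disk a ->
  (\forall w \near a, G w = 0) ->
  forall w, modulus (w - a) < 1 - modulus a -> G w = 0.
Proof.
move=> hG aD Gz; apply: zero_of_infinite_order => // n.
suff [g hg Gg] : exists2 g, holomorphic_on_disk g & forall w, G w = (w - a) ^+ n * g w.
  by exists g => // w _.
elim: n => [|n [g hg Gg]]; first by exists G => // w; rewrite expr0 mul1r.
have ga : g a = 0.
  apply: (@continuous_eq_punctured g (fun _ : C R => (0 : C R)) a).
  - exact: holomorphic_continuous.
  - exact: (@cst_continuous (C R) (C R) 0 a).
  - have [d d0 Hd] := (nbhs_modulusP _ _).1 Gz.
    apply/dnbhs_modulusP; exists d => // w wa /Hd; rewrite Gg => /eqP.
    by rewrite mulf_eq0 expf_eq0 subr_eq0 (negbTE wa) andbF => /eqP.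
have [g' hg' gg'] := holomorphic_divide hg aD ga.
by exists g' => // w; rewrite Gg gg' exprSr mulrA.
Qed.

(* The distance to the unit circle grows by a factor 3/2 at each step of a walk
   towards the origin along which [G] stays locally zero. *)
Lemma zero_near_identically_zero G a : holomorphic_on_disk G -> unit_disk a ->
  (\forall w \near a, G w = 0) -> forall w, unit_disk w -> G w = 0.
Proof.
move=> hG.
suff H n b : unit_disk b -> 1 < (3 / 2) ^+ n * (2 * (1 - modulus b)) -> (\forall w \near b, G w = 0) ->
    forall w, unit_disk w -> G w = 0.
  move=> aD; have /unit_diskE a1 := aD.
  have [n Hn] : exists n, 1 < (3 / 2) ^+ n * (2 * (1 - modulus a)).
    pose x := (2 * (1 - modulus a))^-1.
    have x0 : 0 < 2 * (1 - modulus a) by rewrite mulr_gt0 // subr_gt0.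
    have [n _ Hn] : \forall n \near \oo, (2 / 3 : R) ^+ n < 2 * (1 - modulus a).
      have cv : (2 / 3 : R) ^+ n @[n --> \oo] --> 0.
        by apply: cvg_expr; rewrite ger0_norm ?divr_ge0 // ltr_pdivrMr // mul1r ltr_nat.
      move/cvgrPdist_lt : cv => /(_ _ x0); apply: filterS => n.
      by rewrite sub0r normrN ger0_norm // exprn_ge0 // divr_ge0.
    have p32 : 0 < (3 / 2 : R) ^+ n by rewrite exprn_gt0 // divr_gt0.
    have e : (3 / 2 : R) ^+ n * (2 / 3) ^+ n = 1.
      by rewrite -exprMn (_ : 3 / 2 * (2 / 3) = 1) ?expr1n //; field.
    exists n; rewrite -[ltLHS]e ltr_pM2l //.
    exact: (Hn n (leqnn n)).
  exact: H Hn.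
elim: n b => [|n IH] b bD.
  (* Here [|b| < 1 / 2], so the disk around [b] on which [G] vanishes contains the origin. *)
  rewrite expr0 mul1r => hb /(zero_near_zero_ball hG bD) Gb.
  have G0 : \forall w \near 0, G w = 0.
    apply/nbhs_modulusP; exists (1 - 2 * modulus b); first by lra.
    move=> w; rewrite subr0 => hw; apply: Gb.
    by have := ler_modulusB w b; lra.
  have D0 : unit_disk (0 : C R) by apply/unit_diskE; rewrite modulus0.
  move=> w /unit_diskE w1; apply: (zero_near_zero_ball hG D0 G0).
  by rewrite modulus0 !subr0.
move=> hb /(zero_near_zero_ball hG bD) Gb.
have /unit_diskE b1 := bD.
have b0 := modulus_ge0 b.
have [b2|b2] := ltP (modulus b) (1 / 2).
  apply: (IH b) => //; last first.
    apply/nbhs_modulusP; exists (1 - modulus b); first by lra.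
    by move=> w; exact: Gb.
  have : 1 <= (3 / 2 : R) ^+ n by rewrite exprn_ege1 //; lra.
  by move=> h; rewrite (@lt_le_trans _ _ (2 * (1 - modulus b))) ?ler_peMl //; lra.
(* [b'] lies on the segment from [b] to 0, at distance half the gap [1 - |b|], so its own gap is
   [3 / 2] times as large. *)
pose m := modulus b - (1 - modulus b) / 2.
pose b' := rc (m / modulus b) * b.
have m0 : 0 <= m by rewrite /m; lra.
have bn0 : modulus b != 0 by rewrite gt_eqF //; lra.
have mb' : modulus b' = m.
  by rewrite modulusM modulus_rc ger0_norm ?divr_ge0 // mulfVK.
have bb' : modulus (b' - b) = (1 - modulus b) / 2.
  have -> : b' - b = rc (m / modulus b - 1) * b by rewrite /b' rcD rcN rc1; ring.
  have x0 : 0 <= (1 - modulus b) / 2 by lra.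
  have -> : m / modulus b - 1 = - ((1 - modulus b) / 2 / modulus b) by rewrite /m; field.
  rewrite modulusM modulus_rc normrN ger0_norm; last exact: divr_ge0.
  by rewrite mulfVK.
apply: (IH b').
- by apply/unit_diskE; rewrite mb' /m; lra.
- move: hb; rewrite mb' /m exprS.
  have -> : 2 * (1 - (modulus b - (1 - modulus b) / 2)) = 3 / 2 * (2 * (1 - modulus b)) by field.
  by rewrite mulrA [_ ^+ n * _]mulrC.
apply/nbhs_modulusP; exists ((1 - modulus b) / 2); first by lra.
move=> w hw; apply: Gb.
have := ler_distD_modulus b' w b; lra.
Qed.

(** If every cofactor vanished at [a], division could go on forever and [G] would have infinite
    order there. *)
Lemma holomorphic_order G a : holomorphic_on_disk G -> ~ (forall w, unit_disk w -> G w = 0) ->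
  unit_disk a -> exists n g, [/\ holomorphic_on_disk g, g a != 0 & forall w, G w = (w - a) ^+ n * g w].
Proof.
move=> hG G0 aD; apply/not_existsP => H.
have Hdiv n : exists2 g, holomorphic_on_disk g & forall w, G w = (w - a) ^+ n * g w.
  elim: n => [|n [g hg Gg]]; first by exists G => // w; rewrite expr0 mul1r.
  have ga : g a = 0.
    apply/eqP; apply: contrapT => /negP ga.
    by apply: (H n); exists g.
  have [g' hg' gg'] := holomorphic_divide hg aD ga.
  by exists g' => // w; rewrite Gg gg' exprSr mulrA.
apply: G0; apply: (zero_near_identically_zero hG aD).
have /unit_diskE a1 := aD.
apply/nbhs_modulusP; exists (1 - modulus a); first by lra.
apply: zero_of_infinite_order => // n; have [g hg Gg] := Hdiv n.
by exists g => // w _.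
Qed.

Lemma holomorphic_zero_order G a : holomorphic_on_disk G -> ~ (forall w, unit_disk w -> G w = 0) ->
  unit_disk a -> exists n, zero_order G a n.
Proof.
move=> hG G0 aD; have [n [g [hg ga Gg]]] := holomorphic_order hG G0 aD.
exists n, g; split; [ |exact: ga|by apply: filterS (near_unit_disk aD) => w _; exact: Gg].
by apply: filterS (near_unit_disk aD) => w; exact: hg.
Qed.

Lemma near_neq0 G a : {for a, continuous G} -> G a != 0 -> \forall w \near a, G w != 0.
Proof.
move=> /continuous_modulusP cG Ga.
have := cG (modulus (G a)); rewrite modulus_gt0 => /(_ Ga) [d d0 Hd].
apply/nbhs_modulusP; exists d => // w /Hd; apply: contraTneq => ->.
by rewrite sub0r modulusN ltxx.
Qed.

Lemma zero_order_isolated G a n : zero_order G a n -> \forall w \near a^', G w != 0.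
Proof.
move=> [h [dh ha Gh]].
have ch : {for a, continuous h} by apply: derivable_continuous; exact: nbhs_singleton dh.
have [d d0 Hd] := (nbhs_modulusP _ _).1 (filterI (near_neq0 ch ha) Gh).
apply/dnbhs_modulusP; exists d => // w wa /Hd [hw ->].
by rewrite mulf_eq0 negb_or hw expf_eq0 subr_eq0 (negbTE wa) andbF.
Qed.

End Holomorphic.

(** * Listing the zeros and dividing them out *)

Section Zeros.
Context {R : realType}.
Implicit Types (z w a b : C R) (f g F G : C R -> C R) (zs : nat -> option (C R)).

Lemma card_II_setD1 (A : set nat) k m : A k -> (A #= `I_m)%card ->
  exists2 n, m = n.+1 & (A `\ k #= `I_n)%card.
Proof.
move=> Ak Am; have fA : finite_set A by exists m.
have /card_fset_set cA := Am.
have := cardfsD1 k (fset_set A); rewrite cA in_fset_set // mem_set //= add1n.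
set n := #|` _| => mn; exists n => //.
have fD : finite_set (A `\ k) by exact: finite_setD.
apply/(fcard_eq fD (finite_II n)).
rewrite fset_setD1 // -/n (card_fset_set (card_eqxx _)) //.
Qed.

Lemma card_succ (A : set nat) (B : set nat) : (forall k, A k.+1 <-> B k) -> ~ A 0%N -> (B #= A)%card.
Proof.
move=> AB A0; have -> : A = succn @` B.
  apply/seteqP; split=> [[|k] Ak|_ [k Bk <-]].
  - by case: A0.
  - by exists k => //; apply/AB.
  - by apply/AB.
by apply/card_esym/inj_card_eq => i j _ _ [].
Qed.

Lemma zero_order_eq0 G a n : zero_order G a n -> (0 < n)%N -> G a = 0.
Proof.
move=> [h [_ _ Gh]] n0; rewrite (nbhs_singleton Gh) subrr expr0n.
by rewrite eqn0Ngt n0 mul0r.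
Qed.

Lemma zero_order_unit F (U : C R -> C R) g b m : derivable U b 1 -> (\forall w \near b, derivable U w 1) -> U b != 0 ->
  (\forall w \near b, F w = U w * g w) -> zero_order F b m -> zero_order g b m.
Proof.
move=> dUb dU Ub FUg [h [dh hb Fh]]; exists (fun w => h w * (U w)^-1).
have cU : {for b, continuous U} by exact: derivable_continuous.
have nU := near_neq0 cU Ub.
split.
- apply: filterS (filterI dh (filterI dU nU)) => w [dhw [dUw Uw]].
  by apply: derivableM; [exact: dhw|exact: derivableV].
- by rewrite mulf_eq0 negb_or hb invr_eq0.
apply: filterS (filterI FUg (filterI Fh nU)) => w [FUw [Fw Uw]].
by rewrite mulrA -Fw FUw mulrAC divff // mul1r.
Qed.

(** Off [a] a factor cancels; at [a] both sides agree by continuity. *)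
Lemma zero_order_pred F g a m : {for a, continuous g} -> (forall w, F w = (w - a) * g w) ->
  zero_order F a m.+1 -> zero_order g a m.
Proof.
move=> cg Fg [h [dh ha Fh]]; exists h; split; [exact: dh|exact: ha| ].
have ch : {for a, continuous h} by apply: derivable_continuous; exact: nbhs_singleton dh.
have [d d0 Hd] := (nbhs_modulusP _ _).1 Fh.
have E w : w != a -> modulus (w - a) < d -> g w = (w - a) ^+ m * h w.
  move=> wa /Hd; rewrite Fg exprS -mulrA => /mulfI; apply.
  by rewrite subr_eq0.
apply/nbhs_modulusP; exists d => // w wd; have [->|wa] := eqVneq w a; last exact: E.
apply: (@continuous_eq_punctured R g (fun w => (w - a) ^+ m * h w) a cg).
  apply: cvgM ch; elim: m {Fh Hd E} => [|m IH].
    by rewrite (_ : (fun=> _) = fun=> 1) ?expr0; [exact: cvg_cst|apply/funext => u; rewrite expr0].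
  rewrite exprS (_ : (fun=> _) = fun u => (u - a) * (u - a) ^+ m); last first.
    by apply/funext => u; rewrite exprS.
  by apply: cvgM IH; apply: cvgB; [exact: cvg_id|exact: cvg_cst].
by apply/dnbhs_modulusP; exists d.
Qed.

Lemma blaschke_den_neq0 a w : unit_disk a -> unit_disk w -> 1 - (conjc a : C R) * w != 0.
Proof.
move=> /unit_diskE a1 /unit_diskE w1; rewrite -modulus_gt0.
apply: lt_le_trans (lerB_modulus _ _); rewrite subr_gt0 modulus1 modulusM modulus_conjc.
by rewrite mulr_ilt1 ?modulus_ge0.
Qed.

(** The zero-free [V] isolates the simple zero of the factor, so that dividing by the factor changes
    the order at [a] only. *)
Lemma blaschke_factorE a : unit_disk a -> exists V : C R -> C R,
  [/\ holomorphic_on_disk V, forall w, unit_disk w -> V w != 0 &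
      forall w, unit_disk w -> blaschke_factor a w = (w - a) * V w].
Proof.
move=> aD; rewrite /blaschke_factor; case: eqVneq => [->|a0].
  exists (fun=> 1); split => [w _|w _|w _]; first exact: derivable_cst.
    exact: oner_neq0.
  by rewrite subr0 mulr1.
have c0 : `|a| / a != 0 by rewrite mulf_neq0 ?invr_eq0 ?normr_eq0.
exists (fun w => - (`|a| / a) * (1 - (conjc a : C R) * w)^-1); split.
- move=> w wD; apply: derivableM; first exact: derivable_cst.
  apply: derivableV; first exact: blaschke_den_neq0.
  apply: derivableB; first exact: derivable_cst.
  by apply: derivableM; [exact: derivable_cst|exact: derivable_id].
- move=> w wD; rewrite mulf_neq0 ?oppr_eq0 // invr_eq0; exact: blaschke_den_neq0.
- by move=> w wD; ring.
Qed.

Definition zero_factor zs k z : C R := if zs k is Some a then blaschke_factor a z else 1.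

(** With [q = F / (w - a)] and [g = q / V], the order drops by one at [a], matching the lost
    position 0; near any other point [w - a] and [V] are units. *)
Lemma divide_blaschke_step F zs : holomorphic_on_disk F -> lists_zeros F zs ->
  exists g, [/\ holomorphic_on_disk g, lists_zeros g (fun k => zs k.+1) &
    forall w, unit_disk w -> F w = zero_factor zs 0 w * g w].
Proof.
move=> hF [zsD zsO]; rewrite /zero_factor; case E : (zs 0%N) => [a|]; last first.
  exists F; split => //; last by move=> w _; rewrite mul1r.
  split=> [k a|a aD]; first exact: zsD.
  have [n On cn] := zsO a aD; exists n => //.
  by apply: card_eq_trans cn; apply: card_succ => //=; rewrite E.
have aD := zsD _ _ E.
have [m Om cm] := zsO a aD.
have [n mn cn] := @card_II_setD1 [set k | zs k = Some a] 0%N m E cm.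
have Fa : F a = 0 by apply: zero_order_eq0 Om _; rewrite mn.
have [q hq Fq] := holomorphic_divide hF aD Fa.
have [V [hV V0 bV]] := blaschke_factorE aD.
have hg : holomorphic_on_disk (fun w => q w * (V w)^-1).
  move=> w wD; apply: derivableM; first exact: hq.
  by apply: derivableV; [exact: V0|exact: hV].
have dV b : unit_disk b -> \forall w \near b, derivable V w 1.
  by move=> bD; apply: filterS (near_unit_disk bD) => w; exact: hV.
have qVg b : unit_disk b -> \forall w \near b, q w = V w * (q w * (V w)^-1).
  move=> bD; apply: filterS (near_unit_disk bD) => w wD.
  by rewrite mulrC mulfVK // V0.
have qO b k : unit_disk b -> zero_order q b k -> zero_order (fun w => q w * (V w)^-1) b k.
  move=> bD; apply: (@zero_order_unit q V); [exact: hV|exact: dV|exact: V0|exact: qVg].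
exists (fun w => q w * (V w)^-1); split; [exact: hg| | ]; last first.
  move=> w wD; rewrite bV // Fq -mulrA; congr (_ * _).
  by rewrite mulrC mulfVK // V0.
split=> [k b|b bD]; first exact: zsD.
have [ba|ba] := eqVneq b a.
  rewrite ba; exists n.
    apply: (qO a n aD); apply: (@zero_order_pred F q a n _ Fq); last by rewrite -mn.
    exact: holomorphic_continuous.
  apply: card_eq_trans cn; apply: card_succ; last by move=> [_]; apply.
  by move=> k; split => [[]|].
have [k Ok ck] := zsO b bD; exists k.
  apply: (qO b k bD); apply: (@zero_order_unit F (fun w => w - a) q b k _ _ _ _ Ok).
  - by apply: derivableB; [exact: derivable_id|exact: derivable_cst].
  - apply: filterS (near_unit_disk bD) => w _.
    by apply: derivableB; [exact: derivable_id|exact: derivable_cst].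
  - by rewrite subr_eq0.
  - by apply: filterS (near_unit_disk bD) => w _; exact: Fq.
apply: card_eq_trans ck; apply: card_succ => //=.
by rewrite E => -[ab]; rewrite ab eqxx in ba.
Qed.

Lemma blaschke_quotients G zs : holomorphic_on_disk G -> lists_zeros G zs ->
  exists F : nat -> C R -> C R, [/\ F 0%N = G, forall n, holomorphic_on_disk (F n),
    forall n w, unit_disk w -> F n w = zero_factor zs n w * F n.+1 w &
    forall n a, unit_disk a -> exists m, zero_order (F n) a m /\ ([set k | zs (n + k)%N = Some a] #= `I_m)%card].
Proof.
move=> hG lz.
(* The state pairs a function with the listing of its remaining zeros. *)
have step (p : (C R -> C R) * (nat -> option (C R))) : exists g,
    holomorphic_on_disk p.1 /\ lists_zeros p.1 p.2 ->
    [/\ holomorphic_on_disk g, lists_zeros g (fun k => p.2 k.+1) &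
    forall w, unit_disk w -> p.1 w = zero_factor p.2 0 w * g w].
  have [[h1 h2]|] := pselect (holomorphic_on_disk p.1 /\ lists_zeros p.1 p.2); last by exists p.1.
  by have [g Hg] := divide_blaschke_step h1 h2; exists g.
have [S HS] := choice step.
pose F := fix F n := if n is m.+1 then S (F m, fun k => zs (m + k)%N) else G.
have inv n : holomorphic_on_disk (F n) /\ lists_zeros (F n) (fun k => zs (n + k)%N).
  elim: n => [//|n IH].
  have [h1 h2 _] := HS (F n, fun k => zs (n + k)%N) IH; split => //=.
  by rewrite (_ : (fun k => zs (n.+1 + k)%N) = fun k => zs (n + k.+1)%N) //; apply/funext => k; rewrite addnS.
exists F; split.
- by [].
- by move=> n; have [] := inv n.
- move=> n w wD; have [_ _ /(_ w wD) /= ->] := HS (F n, fun k => zs (n + k)%N) (inv n).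
  by rewrite /zero_factor /= addn0.
- by move=> n a aD; have [_ [_ /(_ a aD) [m]]] := inv n; exists m.
Qed.

(* An isolated point is determined by a rational approximation finer than its
   distance to the others. *)
Lemma isolated_countable (Z : set (C R)) :
  (forall a, Z a -> exists2 d, 0 < d & forall b, Z b -> b != a -> d <= modulus (b - a)) ->
  exists f : C R -> nat, {in Z &, injective f}.
Proof.
move=> iso.
(* The index of [a] records a precision [1 / (n + 1)] below a quarter of the isolation distance, and
   rational approximations of both coordinates. *)
have H a : exists c : rat * rat * nat, Z a ->
    (forall b, Z b -> b != a -> 4 * c.2.+1%:R^-1 <= modulus (b - a)) /\
    `|cre a - ratr c.1.1| < c.2.+1%:R^-1 /\ `|cim a - ratr c.1.2| < c.2.+1%:R^-1.
  have [Za|] := pselect (Z a); last by exists (0, 0, 0%N).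
  have [d d0 Hd] := iso a Za.
  have d4 : 0 < d / 4 by rewrite divr_gt0.
  have [n Hn] : exists n, n.+1%:R^-1 < d / 4.
    have /cvgrPdist_lt /(_ _ d4) [n _ Hn] := @cvg_harmonic R.
    by exists n; have := Hn n (leqnn n); rewrite /= sub0r normrN ger0_norm.
  have rat_approx (x : R) : exists q : rat, `|x - ratr q| < n.+1%:R^-1.
    have [|q] := @rat_in_itvoo R x (x + n.+1%:R^-1); first by rewrite ltrDl.
    by rewrite in_itv /= => /andP[h1 h2]; exists q; rewrite ltr0_norm ?subr_lt0 // opprB ltrBlDl.
  have [q1 H1] := rat_approx (cre a); have [q2 H2] := rat_approx (cim a).
  exists (q1, q2, n) => _; split => //= b Zb ba.
  by apply: le_trans (Hd _ Zb ba); rewrite mulrC -ler_pdivlMr // ltW.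
have [c Hc] := choice H.
exists (choice.pickle \o c) => a b; rewrite !inE => Za Zb /= /(pcan_inj choice.pickleK) cab.
apply/eqP; apply: contrapT => /negP ab.
have [Ha [a1 a2]] := Hc a Za; have [_ [b1 b2]] := Hc b Zb.
have ba : b != a by rewrite eq_sym.
have := Ha b Zb ba; rewrite -cab in b1 b2.
have := modulus_le_ReIm (b - a); rewrite creD creN cimD cimN.
have t1 : `|cre b - cre a| <= `|cre b - ratr (c a).1.1| + `|cre a - ratr (c a).1.1|.
  by rewrite [X in _ <= _ + X]distrC ler_distD.
have t2 : `|cim b - cim a| <= `|cim b - ratr (c a).1.2| + `|cim a - ratr (c a).1.2|.
  by rewrite [X in _ <= _ + X]distrC ler_distD.
(* Equal indices put the two points closer than [4 * e], against the separation. *)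
set e := _^-1 in a1 a2 b1 b2 *; lra.
Qed.

(** Zeros are isolated, hence injectively coded by integers; a zero [a] of order [n] occupies the
    positions encoding [(code a, j)] with [j < n], and all other positions hold [None]. *)
Lemma lists_zeros_exists G : holomorphic_on_disk G -> ~ (forall z, unit_disk z -> G z = 0) ->
  exists zs, lists_zeros G zs.
Proof.
move=> hG G0.
have H a : exists n, unit_disk a -> zero_order G a n.
  have [aD|] := pselect (unit_disk a); last by exists 0%N.
  by have [n Hn] := holomorphic_zero_order hG G0 aD; exists n.
have [ord Hord] := choice H.
pose Z : set (C R) := [set a | unit_disk a /\ (0 < ord a)%N].
have [code code_inj] : exists f : C R -> nat, {in Z &, injective f}.
  apply: isolated_countable => a [aD oa].
  have [d d0 Hd] := (dnbhs_modulusP _ _).1 (zero_order_isolated (Hord a aD)).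
  exists d => // b [bD ob] ba; rewrite leNgt; apply/negP => /(Hd _ ba).
  by rewrite (zero_order_eq0 (Hord b bD) ob) eqxx.
pose P k a := exists j, [/\ Z a, (j < ord a)%N & k = choice.pickle (code a, j)].
have Puniq k a b : P k a -> P k b -> a = b.
  move=> [i [Za _ ->]] [j [Zb _ /(pcan_inj choice.pickleK) [cab _]]].
  by apply: code_inj; rewrite ?inE.
have Hzs k : exists o : option (C R), forall a, o = Some a <-> P k a.
  have [[a Pa]|nP] := pselect (exists a, P k a).
    by exists (Some a) => b; split => [[<-]|/(Puniq _ _ _ Pa) ->].
  by exists None => a; split => // Pa; case: nP; exists a.
have [zs HZ] := choice Hzs.
exists zs; split=> [k a /HZ [j [[]]] //|a aD].
exists (ord a); first exact: Hord.
have -> : [set k | zs k = Some a] = (fun j => choice.pickle (code a, j)) @` `I_(ord a).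
  apply/seteqP; split=> [k /= /HZ [j [_ ja ->]]|_ [j /= ja <-]]; first by exists j.
  apply/HZ; exists j; split => //; split => //.
  exact: leq_ltn_trans ja.
by apply: inj_card_eq => i j _ _ /(pcan_inj choice.pickleK) [].
Qed.

End Zeros.

(** * A log-convex function equivalent to a growth function *)

Section LogConvexMinorant.
Context {R : realType} (Phi : R -> R) (K p : R).
Hypothesis Phi_mono : {in `[0, +oo[ &, {homo Phi : s t / s <= t}}.
Hypothesis Phi0 : Phi 0 = 0.
Hypothesis Phi_cvg0 : Phi t @[t --> 0^'+] --> 0.
Hypothesis Phi_gt0 : forall t : R, 0 < t -> 0 < Phi t.
Hypothesis p0 : 0 < p.
Hypothesis K1 : 1 < K.
Hypothesis Phi_lower : forall t s : R, 0 <= t <= 1 -> 0 <= s -> Phi (s * t) <= K * t `^ p * Phi s.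
Implicit Types (s t u x y e : R).

Lemma Phi_le s t : 0 <= s -> s <= t -> Phi s <= Phi t.
Proof. by move=> s0 st; apply: Phi_mono => //; rewrite in_itv /= andbT // (le_trans s0). Qed.

Lemma Phi_ge0 s : 0 <= s -> 0 <= Phi s.
Proof. by move=> s0; rewrite -Phi0; exact: Phi_le. Qed.

(* [ln] vanishes on nonpositive reals, so [logpart s u = 0] for [s <= 0]. *)
Definition logpart (s u : R) : R := Phi u * Num.max 0 (ln (s / u)).

(* [x |-> Psi (expR x)] is convex, being a supremum of functions
   [Phi u * max 0 (x - ln u)], and [Phi (s / e) <= Psi s <= K / p * Phi s]. *)
Definition Psi (s : R) : R := sup [set logpart s u | u in [set u | 0 < u]].

Lemma logpart_ge0 s u : 0 < u -> 0 <= logpart s u.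
Proof. by move=> u0; rewrite mulr_ge0 ?Phi_ge0 ?(ltW u0) // le_max lexx. Qed.

(** Lower type bounds [Phi u] by [K * (u / s)^p * Phi s]; with [x = (u / s)^p] the remaining factor
    is [x * ln (1 / x) <= 1 - x <= 1], divided by [p]. *)
Lemma logpart_le s u : 0 <= s -> 0 < u -> logpart s u <= K / p * Phi s.
Proof.
move=> s0 u0; have K0 : 0 < K by rewrite (lt_trans _ K1).
have Kp : 0 < K / p by rewrite divr_gt0.
have [su|us] := leP s u.
  rewrite /logpart (_ : Num.max 0 _ = 0) ?mulr0; first by rewrite mulr_ge0 ?Phi_ge0 // ltW.
  by apply/max_idPl; rewrite ln_le0 // ler_pdivrMr // mul1r.
have sp : 0 < s by exact: lt_trans us.
have t01 : 0 <= u / s <= 1 by rewrite divr_ge0 ?(ltW u0) //= ler_pdivrMr // mul1r ltW.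
have tp : 0 < u / s by rewrite divr_gt0.
have lnp : 0 <= ln (s / u) by rewrite ln_ge0 // ler_pdivlMr // mul1r ltW.
rewrite /logpart (max_idPr lnp).
have := Phi_lower t01 s0; rewrite mulrCA divff ?gt_eqF // mulr1 => H.
apply: (le_trans (ler_wpM2r lnp H)).
have -> : K * (u / s) `^ p * Phi s * ln (s / u) = K * Phi s * ((u / s) `^ p * ln (s / u)) by ring.
have -> : K / p * Phi s = K * Phi s * p^-1 by ring.
apply: ler_wpM2l; first by rewrite mulr_ge0 ?Phi_ge0 // ltW.
rewrite -(ler_pM2r p0) mulVf ?gt_eqF //.
have xp : 0 < (u / s) `^ p by exact: powR_gt0.
have -> : (u / s) `^ p * ln (s / u) * p = (u / s) `^ p * ln (((u / s) `^ p)^-1).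
  by rewrite lnV ?posrE // ln_powR -(invf_div s u) lnV ?posrE ?divr_gt0 //; ring.
move: ((u / s) `^ p) xp => x x0.
have hx : ln x^-1 <= x^-1 - 1.
  have xi : 0 < x^-1 by rewrite invr_gt0.
  have -> : ln x^-1 = ln (1 + (x^-1 - 1)) by congr ln; ring.
  by apply: le_ln1Dx; lra.
apply: (le_trans (ler_wpM2l (ltW x0) hx)).
by rewrite mulrBr mulfV ?gt_eqF // mulr1 lerBlDr lerDl ltW.
Qed.

Lemma logpart_sup s : 0 <= s -> has_sup [set logpart s u | u in [set u | 0 < u]].
Proof.
move=> s0; split; first by exists (logpart s 1); exists 1 => //=.
by exists (K / p * Phi s) => _ [u u0 <-]; exact: logpart_le.
Qed.

Lemma Psi_ge_logpart s u : 0 <= s -> 0 < u -> logpart s u <= Psi s.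
Proof. by move=> s0 u0; apply: ub_le_sup; [case: (logpart_sup s0)|exists u]. Qed.

Lemma Psi_le_ub s (M : R) : (forall u, 0 < u -> logpart s u <= M) -> Psi s <= M.
Proof.
move=> H; apply: sup_le_ub; first by exists (logpart s 1); exists 1 => //=.
by move=> _ [u u0 <-]; exact: H.
Qed.

Lemma Psi_le s : 0 <= s -> Psi s <= K / p * Phi s.
Proof. by move=> s0; apply: Psi_le_ub => u; exact: logpart_le. Qed.

Lemma Psi_le0 s : s <= 0 -> Psi s = 0.
Proof.
move=> s0; have E u : 0 < u -> logpart s u = 0.
  by move=> u0; rewrite /logpart ln0 ?maxxx ?mulr0 // mulr_le0_ge0 // invr_ge0 ltW.
apply/eqP; rewrite eq_le; apply/andP; split; first by apply: Psi_le_ub => u u0; rewrite E.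
rewrite -(E 1 ltr01); apply: ub_le_sup; last by exists 1 => //=.
by exists 0 => _ [u u0 <-]; rewrite E.
Qed.

Lemma Psi_ge0 s : 0 <= Psi s.
Proof.
have [s0|s0] := leP s 0; first by rewrite Psi_le0.
by apply: le_trans (Psi_ge_logpart (ltW s0) ltr01); exact: logpart_ge0.
Qed.

(** The choice [u = s / e] makes the logarithm equal to 1. *)
Lemma Phi_le_Psi s : 0 <= s -> Phi (s / expR 1) <= Psi s.
Proof.
rewrite le_eqVlt => /predU1P[<-|s0]; first by rewrite mul0r Phi0 Psi_ge0.
have e0 := expR_gt0 (1 : R); have u0 : 0 < s / expR 1 by rewrite divr_gt0.
apply: le_trans (Psi_ge_logpart (ltW s0) u0); rewrite /logpart.
have -> : s / (s / expR 1) = expR 1 by field; rewrite !gt_eqF.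
by rewrite expRK (max_idPr ler01) mulr1.
Qed.

Lemma Psi_mono s t : 0 <= s -> s <= t -> Psi s <= Psi t.
Proof.
move=> s0 st; have [ss|sp] := leP s 0; first by rewrite Psi_le0 // Psi_ge0.
apply: Psi_le_ub => u u0; apply: le_trans (Psi_ge_logpart (le_trans s0 st) u0).
rewrite /logpart ler_wpM2l ?Phi_ge0 ?(ltW u0) // ge_max le_max lexx /= le_max.
have tp := lt_le_trans sp st.
apply/orP; right; rewrite ler_ln ?posrE ?divr_gt0 // ler_pM2r // invr_gt0 //.
Qed.

(** The pieces that are nonzero at [t] have [u < t], hence slope [Phi u <= Phi t] in [log s]. This
    makes [Psi] continuous away from 0 even where [Phi] jumps. *)
Lemma Psi_lip s t : 0 < s -> s <= t -> Psi t <= Psi s + Phi t * (ln t - ln s).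
Proof.
move=> s0 st; have t0 : 0 < t by exact: lt_le_trans st.
have lst : 0 <= ln t - ln s by rewrite subr_ge0 ler_ln.
apply: Psi_le_ub => u u0; have [tu|ut] := leP t u.
  rewrite /logpart (_ : Num.max 0 _ = 0) ?mulr0.
    by rewrite addr_ge0 ?Psi_ge0 // mulr_ge0 ?Phi_ge0 // ltW.
  by apply/max_idPl; rewrite ln_le0 // ler_pdivrMr // mul1r.
apply: le_trans (lerD (Psi_ge_logpart (ltW s0) u0) (ler_wpM2r lst (Phi_le (ltW u0) (ltW ut)))).
rewrite /logpart -mulrDr ler_wpM2l ?Phi_ge0 ?(ltW u0) //.
rewrite !ln_div // ge_max; apply/andP; split.
  by rewrite addr_ge0 // le_max lexx.
have : ln s - ln u <= Num.max 0 (ln s - ln u) by rewrite le_max lexx orbT.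
lra.
Qed.

(** The supremum need not be attained, so the support line comes from an [e]-maximizer [u], with
    slope [Phi u], or 0 when [u >= s0]. The bound [Phi s0] on the slope does not depend on [e],
    which later allows [e] to tend to 0. *)
Lemma Psi_support s0 e : 0 < s0 -> 0 < e ->
  exists2 k, 0 <= k <= Phi s0 & forall s, 0 < s -> Psi s0 - e + k * (ln s - ln s0) <= Psi s.
Proof.
move=> sp e0; have [_ [u u0 <-] Hu] := sup_adherent e0 (logpart_sup (ltW sp)).
rewrite -/(Psi s0) /logpart in Hu.
have [us|su] := ltP u s0; last first.
  exists 0; first by rewrite lexx Phi_ge0 // ltW.
  move=> s _; rewrite mul0r addr0 (le_trans _ (Psi_ge0 s)) //.
  rewrite (_ : Num.max 0 _ = 0) ?mulr0 in Hu; first exact: ltW.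
  by apply/max_idPl; rewrite ln_le0 // ler_pdivrMr // mul1r.
exists (Phi u); first by rewrite Phi_ge0 ?Phi_le // ltW.
move=> s ss; apply: le_trans (Psi_ge_logpart (ltW ss) u0).
have l0 : 0 <= ln (s0 / u) by rewrite ln_ge0 // ler_pdivlMr // mul1r ltW.
rewrite (max_idPr l0) in Hu.
apply: (le_trans (lerD (ltW Hu) (lexx _))); rewrite -mulrDr.
rewrite /logpart ler_wpM2l ?Phi_ge0 ?(ltW u0) // le_max; apply/orP; right.
by rewrite !ln_div //; lra.
Qed.

Lemma Psi_continuous : continuous Psi.
Proof.
move=> x; have [x0|x0|->] := ltgtP x 0.
- apply/cvgrPdist_lt => e e0.
  have : \forall y \near x, y < 0 by apply: (@open_lt R 0).
  by apply: filterS => y y0; rewrite !Psi_le0 ?ltW // subrr normr0.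
- apply/cvgrPdist_lt => e e0.
  have M0 : 0 < Phi (2 * x) by rewrite Phi_gt0 // mulr_gt0.
  have e1 : 0 < e / Phi (2 * x) by rewrite divr_gt0.
  have h1 : \forall y \near x, 0 < y by apply: (@open_gt R 0).
  have h2 : \forall y \near x, y < 2 * x.
    by apply: (@open_lt R (2 * x)); rewrite /=; lra.
  have h3 : \forall y \near x, `|ln x - ln y| < e / Phi (2 * x).
    by move/cvgrPdist_lt : (continuous_ln x0) => /(_ _ e1).
  apply: filterS (filterI h1 (filterI h2 h3)) => y [y0 [y2 ylog]].
  have [xy|/ltW yx] := leP x y.
    have P1 := Psi_mono (ltW x0) xy; have P2 := Psi_lip x0 xy.
    rewrite distrC ger0_norm ?subr_ge0 //.
    have l0 : 0 <= ln y - ln x by rewrite subr_ge0 ler_ln.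
    rewrite distrC ger0_norm // in ylog.
    apply: le_lt_trans (_ : Phi (2 * x) * (ln y - ln x) < e); last by rewrite mulrC -ltr_pdivlMr.
    have := ler_wpM2r l0 (Phi_le (ltW y0) (ltW y2)); lra.
  have P1 := Psi_mono (ltW y0) yx; have P2 := Psi_lip y0 yx.
  rewrite ger0_norm ?subr_ge0 //.
  have l0 : 0 <= ln x - ln y by rewrite subr_ge0 ler_ln.
  rewrite ger0_norm // in ylog.
  apply: le_lt_trans (_ : Phi (2 * x) * (ln x - ln y) < e); last by rewrite mulrC -ltr_pdivlMr.
  have x2 : x <= 2 * x by lra.
  have := ler_wpM2r l0 (Phi_le (ltW x0) x2); lra.
(* At 0, continuity comes from [Psi <= K / p * Phi] and the limit of [Phi]. *)
apply/cvgrPdist_lt => e e0; rewrite Psi_le0 //.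
have Kp : 0 < K / p by rewrite divr_gt0 // (lt_trans _ K1).
have e1 : 0 < e / (K / p) by rewrite divr_gt0.
have /cvgrPdist_lt /(_ _ e1) := Phi_cvg0.
rewrite near_withinE => /nbhs_ballP [d /= d0 Hd].
apply/nbhs_ballP; exists d => //= y xy.
rewrite sub0r normrN ger0_norm ?Psi_ge0 //.
have [y0|y0] := leP y 0; first by rewrite Psi_le0.
apply: (le_lt_trans (Psi_le (ltW y0))).
have := Hd y xy y0; rewrite sub0r normrN ger0_norm ?Phi_ge0 ?(ltW y0) // ltr_pdivlMr //.
by rewrite mulrC.
Qed.

(** Lower type with [t = 1 / m] gives the factor [K * m^(-p)], and [m^p >= A * K]. This trades a
    constant in front of [Phi] for a dilation of its argument. *)
Lemma Phi_lower_div (A : R) : 0 < A -> exists2 m, 1 <= m &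
  forall s, 0 <= s -> A * Phi (s / m) <= Phi s.
Proof.
move=> A0; have K0 : 0 < K by rewrite (lt_trans _ K1).
pose m := Num.max 1 ((A * K) `^ p^-1).
have m1 : 1 <= m by rewrite le_max lexx.
have m0 : 0 < m by exact: lt_le_trans m1.
exists m => // s s0.
have t01 : 0 <= m^-1 <= 1 by rewrite invr_ge0 (ltW m0) /= invf_le1.
apply: (le_trans (ler_wpM2l (ltW A0) (Phi_lower t01 s0))).
rewrite mulrA ler_piMl ?Phi_ge0 // mulrA.
have mp : A * K <= m `^ p.
  have AK : 0 <= A * K by rewrite mulr_ge0 // ltW.
  have -> : A * K = ((A * K) `^ p^-1) `^ p by rewrite -powRrM mulVf ?gt_eqF // powRr1.
  by apply: ge0_ler_powR; rewrite ?nnegrE ?powR_ge0 ?(ltW p0) ?(ltW m0) // le_max lexx orbT.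
have -> : m^-1 `^ p = (m `^ p)^-1.
  by rewrite -(powR_inv1 (ltW m0)) -powRrM mulN1r powRN.
by rewrite ler_pdivrMr ?mul1r // powR_gt0.
Qed.

End LogConvexMinorant.

(** * Subharmonicity through four-point inequalities *)

Section Submean.
Context {R : realType}.
Implicit Types (u v : C R -> R) (z w h : C R) (F G : C R -> C R).

(* Harmonic functions satisfy this with equality up to [O(|h|^4)]; the cubic
   error leaves room for a second order Taylor expansion and is still
   negligible against the gain [4 * e * |h|^2] from adding [e * |z|^2]. *)
Definition four_point_sub u z := exists A r : R, [/\ 0 <= A, 0 < r &
  forall h, modulus h < r -> 4 * u z - A * modulus h ^+ 3 <=
    u (z + h) + u (z + ic * h) + (u (z - h) + u (z - ic * h))].

Lemma four_point_sub_sum (N : nat) (U : nat -> C R -> R) z :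
  (forall j, four_point_sub (U j) z) -> four_point_sub (fun w => \sum_(j < N) U j w) z.
Proof.
move=> HU; elim: N => [|N [A [r [A0 r0 HA]]]].
  exists 0, 1; split => // h _.
  by rewrite !big_ord0 mulr0 mul0r subrr !addr0.
have [B [s [B0 s0 HB]]] := HU N.
exists (A + B), (Num.min r s); split; [exact: addr_ge0|by rewrite lt_min r0|].
move=> h; rewrite lt_min => /andP[hr hs].
by have := HA h hr; have := HB h hs; rewrite !big_ord_recr /=; lra.
Qed.

Lemma four_point_sub_rot u z c : modulus c = 1 -> four_point_sub u (z * c) ->
  four_point_sub (fun w => u (w * c)) z.
Proof.
move=> c1 [A [r [A0 r0 HA]]]; exists A, r; split => // h hr.
have := HA (h * c); rewrite modulusM c1 mulr1 => /(_ hr).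
by rewrite !mulrDl !mulNr -!mulrA.
Qed.

Lemma polar_decomposition z : exists2 t : R, 0 <= t <= 2 * pi & z = rc (modulus z) * circle_point t.
Proof.
have pi0 := pi_gt0 R.
have [->|z0] := eqVneq z 0.
  by exists 0; rewrite ?lexx ?mulr_ge0 ?(ltW pi0) // modulus0 rc0 mul0r.
pose w := z / rc (modulus z).
have m0 : rc (modulus z) != 0 by rewrite -modulus_gt0 modulus_rc normr_gt0 modulus_eq0.
have w1 : modulus w = 1.
  by rewrite modulusMV modulus_rc ger0_norm ?modulus_ge0 // divff // modulus_eq0.
suff [t tt Ew] : exists2 t : R, 0 <= t <= 2 * pi & w = circle_point t.
  by exists t => //; rewrite -Ew /w mulrC mulfVK.
move: (w) w1 => [x y]; rewrite modulusE /= => xy1.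
have xy : x ^+ 2 + y ^+ 2 = 1.
  by rewrite -[LHS]sqr_sqrtr ?addr_ge0 ?sqr_ge0 // xy1 expr1n.
have y2 : 1 - x ^+ 2 = y ^+ 2 by rewrite -xy; ring.
have x11 : -1 <= x <= 1.
  rewrite -ler_norml -(ler_pXn2r (n := 2)) ?nnegrE // real_normK ?num_real // expr1n.
  by have := sqr_ge0 y; lra.
have [c0 c1] := (acos_ge0 x11, acos_lepi x11).
have [y0|y0] := leP 0 y.
  exists (acos x); first by apply/andP; split; lra.
  by rewrite /circle_point acosK ?in_itv //= sin_acos // y2 sqrtr_sqr ger0_norm.
exists (2 * pi - acos x); first by apply/andP; split; lra.
have -> : 2 * pi - acos x = - acos x + 2 * pi by ring.
rewrite circle_pointD circle_point2pi mulr1 /circle_point cosN sinN acosK ?in_itv //=.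
by rewrite sin_acos // y2 sqrtr_sqr ltr0_norm // opprK.
Qed.

Lemma modulus2_four_points z h :
  modulus (z + h) ^+ 2 + modulus (z + ic * h) ^+ 2 + (modulus (z - h) ^+ 2 + modulus (z - ic * h) ^+ 2)
  = 4 * modulus z ^+ 2 + 4 * modulus h ^+ 2.
Proof.
by rewrite !modulusE !sqr_sqrtr ?addr_ge0 ?sqr_ge0 //; case: z h => [a b] [x y] /=; ring.
Qed.

Lemma continuous_add_sqr (T : topologicalType) (f g : T -> R) (e : R) (t : T) :
  {for t, continuous f} -> {for t, continuous g} ->
  {for t, continuous (fun x => f x + e * g x ^+ 2)}.
Proof.
move=> cf cg; apply: cvgD; first exact: cf.
apply: cvgM; first exact: cvg_cst.
by apply: cvgM; exact: cg.
Qed.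

Lemma continuous_mul_fun (T : topologicalType) (f g : T -> C R) (t : T) :
  {for t, continuous f} -> {for t, continuous g} ->
  {for t, continuous (fun x => f x * g x)}.
Proof. by move=> cf cg; apply: cvgM; [exact: cf|exact: cg]. Qed.

Lemma continuous_comp_circle (T : topologicalType) (f : T -> R) (t : T) :
  {for t, continuous f} -> {for t, continuous (fun x => circle_point (f x))}.
Proof. by move=> cf; exact: cvg_comp cf (@continuous_circle_point R (f t)). Qed.

(** At an interior maximum of [v = u + e * |w|^2] the four-point inequality would force
    [4 * e * d^2 <= A * d^3], which fails for small [d]. *)
Lemma max_principle u (rho : R) z : 0 < rho < 1 ->
  (forall w, modulus w < 1 -> {for w, continuous u}) ->
  (forall w, modulus w < 1 -> four_point_sub u w) -> modulus z <= rho ->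
  exists2 t : R, 0 <= t <= 2 * pi & u z <= u (rc rho * circle_point t).
Proof.
move=> /andP[rho0 rho1] cu qu zr; have pi0 := pi_gt0 R.
have pi2 : 0 <= 2 * pi :> R by lra.
pose o s t : C R := rc s * circle_point t.
have mo s t : 0 <= s -> modulus (o s t) = s.
  by move=> s0; rewrite modulusM modulus_circle_point mulr1 modulus_rc ger0_norm.
have [t0 t0i Ht0] : exists2 c, c \in `[0, 2 * pi]%R & forall t, t \in `[0, 2 * pi]%R -> u (o rho t) <= u (o rho c).
  apply: (@EVT_max R (fun t => u (o rho t))) => //.
  apply: cont_on_within => t _.
  have co : {for t, continuous (fun t => o rho t)} by exact: continuous_onc.
  have cut : {for o rho t, continuous u} by apply: cu; rewrite mo // ltW.
  exact: cvg_comp co cut.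
exists t0; first by rewrite in_itv in t0i.
rewrite leNgt; apply/negP => uz.
set m := u (rc rho * circle_point t0) in uz.
(* Since [rho < 1], the perturbation adds at most [e] on the circle, less than the gap
   [u z - m = 2 * e], so [v] does not attain its maximum there. *)
pose e := (u z - m) / 2.
have e0 : 0 < e by rewrite /e; lra.
pose v w := u w + e * modulus w ^+ 2.
have cv w : modulus w < 1 -> {for w, continuous v}.
  move=> w1; apply: continuous_add_sqr; first exact: cu.
  by apply: continuous_comp_modulus; exact: cvg_id.
have [st [[s0 s1] [t1 t2]] Hst] : exists2 st : R * R, (0 <= st.1 /\ st.1 <= rho) /\ (0 <= st.2 /\ st.2 <= 2 * pi) &
    forall s t, 0 <= s <= rho -> 0 <= t <= 2 * pi -> v (o s t) <= v (o st.1 st.2).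
  pose KK := (`[0, rho]%classic `*` `[0, 2 * pi]%classic : set (R * R)).
  have [| | |c cK Hc] := @compact_EVT_max (R * R)%type R (fun st => v (o st.1 st.2)) KK.
  - by exists (0, 0); split => /=; rewrite in_itv /= lexx ?(ltW rho0).
  - by apply: compact_setX; exact: segment_compact.
  - apply: continuous_in_subspaceT => -[s t]; rewrite inE => -[/=].
    rewrite !in_itv /= => /andP[s0 s1] _.
    have co : {for (s, t), continuous (fun st : R * R => o st.1 st.2)}.
      apply: continuous_mul_fun.
        by apply: continuous_comp_rc; exact: cvg_fst.
      by apply: continuous_comp_circle; exact: cvg_snd.
    have cvst : {for o s t, continuous v} by apply: cv; rewrite mo // (le_lt_trans s1).
    exact: cvg_comp co cvst.
  exists c.
    by move: cK; rewrite inE => -[/=]; rewrite !in_itv /= => /andP[? ?] /andP[? ?].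
  move=> s t ss tt; apply: (Hc (s, t)); rewrite inE; split => /=; by rewrite in_itv.
set zs := o st.1 st.2 in Hst.
have mzs : modulus zs = st.1 by rewrite mo.
have vmax w : modulus w <= rho -> v w <= v zs.
  move=> wr; have [t tt ->] := polar_decomposition w.
  by apply: Hst => //; rewrite modulus_ge0.
have zsr : modulus zs < rho.
  rewrite lt_neqAle mzs s1 andbT; apply/eqP => srho.
  have := vmax z zr; rewrite /v mzs srho.
  have : u zs <= m.
    by rewrite /zs srho; apply: Ht0; rewrite in_itv /= t1.
  have : e * rho ^+ 2 <= e * 1 by rewrite ler_pM2l // expr_le1 // ltW.
  have : 0 <= e * modulus z ^+ 2 by rewrite mulr_ge0 ?sqr_ge0 // ltW.
  by rewrite /e; lra.
have [A [r [A0 r0 HA]]] := qu zs (lt_trans zsr rho1).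
(* [d * (A + 1) <= e] excludes [4 * e <= A * d]; the other two bounds keep the four points in
   range. *)
pose d := Num.min (r / 2) (Num.min ((rho - modulus zs) / 2) (e / (A + 1))).
have d0 : 0 < d by rewrite !lt_min; apply/and3P; split; [lra|lra|rewrite divr_gt0 //; lra].
have dr : d < r by rewrite (@le_lt_trans _ _ (r / 2)) //; [rewrite ge_min lexx|lra].
have drho : d <= rho - modulus zs.
  by rewrite (@le_trans _ _ ((rho - modulus zs) / 2)) //; [rewrite !ge_min lexx orbT|lra].
have dA : d * (A + 1) <= e.
  by rewrite -ler_pdivlMr; [rewrite !ge_min lexx !orbT|lra].
have md : modulus (rc d) = d by rewrite modulus_rc gtr0_norm.
have mid : modulus (ic * rc d) = d by rewrite modulusM modulus_ic mul1r.
have B (x : C R) : modulus x = d -> v (zs + x) <= v zs.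
  by move=> xd; apply: vmax; apply: (le_trans (ler_modulusD _ _)); rewrite xd; lra.
have b1 := B _ md; have b2 := B _ mid.
have b3 : v (zs - rc d) <= v zs by apply: B; rewrite modulusN.
have b4 : v (zs - ic * rc d) <= v zs by apply: B; rewrite modulusN.
have := HA (rc d); rewrite md => /(_ dr).
have := modulus2_four_points zs (rc d); rewrite md.
move: b1 b2 b3 b4; rewrite /v.
move: (modulus (zs + rc d)) (modulus (zs + ic * rc d)) (modulus (zs - rc d)) (modulus (zs - ic * rc d)).
move=> m1 m2 m3 m4 b1 b2 b3 b4 Em Hu.
have : 4 * (e * d ^+ 2) <= A * d ^+ 3.
  have : e * (m1 ^+ 2 + m2 ^+ 2 + (m3 ^+ 2 + m4 ^+ 2)) = e * (4 * modulus zs ^+ 2 + 4 * d ^+ 2) by rewrite Em.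
  lra.
have -> : A * d ^+ 3 = (A * d) * d ^+ 2 by ring.
rewrite mulrA ler_pM2r ?exprn_gt0 //.
by move=> h4; have : d * (A + 1) = A * d + d by [ring]; lra.
Qed.

(** The factors are exchanged one at a time. *)
Lemma prod4_dist (a1 a2 a3 a4 b1 b2 b3 b4 : C R) (S e : R) :
  modulus a1 <= S -> modulus a2 <= S -> modulus a3 <= S -> modulus a4 <= S ->
  modulus b1 <= S -> modulus b2 <= S -> modulus b3 <= S -> modulus b4 <= S ->
  modulus (a1 - b1) <= e -> modulus (a2 - b2) <= e -> modulus (a3 - b3) <= e -> modulus (a4 - b4) <= e ->
  modulus (a1 * a2 * a3 * a4 - b1 * b2 * b3 * b4) <= 4 * (S ^+ 3 * e).
Proof.
move=> A1 A2 A3 A4 B1 B2 B3 B4 E1 E2 E3 E4.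
have S0 : 0 <= S by apply: le_trans A1; exact: modulus_ge0.
have e0 : 0 <= e by apply: le_trans E1; exact: modulus_ge0.
have T (x1 x2 x3 y : C R) : modulus x1 <= S -> modulus x2 <= S -> modulus x3 <= S -> modulus y <= e ->
    modulus (x1 * x2 * x3 * y) <= S ^+ 3 * e.
  move=> h1 h2 h3 h4; rewrite !modulusM (_ : S ^+ 3 = S * S * S); last by ring.
  by rewrite !ler_pM ?mulr_ge0 ?modulus_ge0.
have -> : a1 * a2 * a3 * a4 - b1 * b2 * b3 * b4 =
  a2 * a3 * a4 * (a1 - b1) + b1 * a3 * a4 * (a2 - b2) + (b1 * b2 * a4 * (a3 - b3) + b1 * b2 * b3 * (a4 - b4)).
  by ring.
apply: (le_trans (ler_modulusD _ _)).
apply: (le_trans (lerD (ler_modulusD _ _) (ler_modulusD _ _))).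
have := T _ _ _ _ A2 A3 A4 E1; have := T _ _ _ _ B1 A3 A4 E2.
have := T _ _ _ _ B1 B2 A4 E3; have := T _ _ _ _ B1 B2 B3 E4.
lra.
Qed.

Lemma ln_ge_of_prod4 (x1 x2 x3 x4 x y : R) : 0 < x1 -> 0 < x2 -> 0 < x3 -> 0 < x4 -> 0 < x ->
  0 <= y <= 1 / 2 -> x ^+ 4 * (1 - y) <= x1 * x2 * x3 * x4 ->
  4 * ln x - 2 * y <= ln x1 + ln x2 + (ln x3 + ln x4).
Proof.
move=> p1 p2 p3 p4 xp /andP[y0 y1] H.
have y1' : 0 < 1 - y by lra.
have : ln (x ^+ 4 * (1 - y)) <= ln (x1 * x2 * x3 * x4).
  by rewrite ler_ln ?posrE // !mulr_gt0 // exprn_gt0.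
have -> : ln (x ^+ 4 * (1 - y)) = ln x *+ 4 + ln (1 - y).
  by rewrite lnM ?posrE ?exprn_gt0 // lnXn.
have -> : ln (x1 * x2 * x3 * x4) = ln x1 + ln x2 + ln x3 + ln x4.
  by rewrite !lnM ?posrE ?mulr_gt0.
have : - (2 * y) <= ln (1 - y).
  have -> : 1 - y = ((1 - y)^-1)^-1 by rewrite invrK.
  rewrite lnV ?posrE ?invr_gt0 // lerN2.
  have -> : (1 - y)^-1 = 1 + y / (1 - y) by field; rewrite gt_eqF.
  have yy : 0 <= y / (1 - y) by rewrite divr_ge0 // ltW.
  apply: (le_trans (le_ln1Dx _)); first by lra.
  rewrite ler_pdivrMr //; nra.
by rewrite -mulr_natl; lra.
Qed.

(* If [q h = c0 + c1 * h + c2 * h^2], the product of [q] over [h, ih, -h, -ih]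
   is [c0^4 + O(h^4)]. *)
Lemma ln_modulus_four_points F z : holomorphic_on_disk F -> unit_disk z -> F z != 0 ->
  exists A r : R, [/\ 0 <= A, 0 < r & forall h, modulus h < r ->
    [/\ F (z + h) != 0, F (z + ic * h) != 0, F (z - h) != 0, F (z - ic * h) != 0 &
    4 * ln (modulus (F z)) - A * modulus h ^+ 3 <=
    ln (modulus (F (z + h))) + ln (modulus (F (z + ic * h))) +
    (ln (modulus (F (z - h))) + ln (modulus (F (z - ic * h))))]].
Proof.
move=> hF zD Fz; have /unit_diskE z1 := zD.
pose rho := (1 - modulus z) / 2.
have [rho0 rho1] : 0 < rho /\ rho < 1 - modulus z by rewrite /rho; split; lra.
have rho2 : rho < 1 by have := modulus_ge0 z; rewrite /rho; lra.
have [M [c [M0 Hc]]] := holomorphic_taylor hF rho0 rho1.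
clearbody rho.
pose B := 4 * M / rho ^+ 3.
have B0 : 0 <= B by rewrite divr_ge0 ?exprn_ge0 ?mulr_ge0 // ltW.
pose q h := c 0%N + c 1%N * h + c 2%N * h ^+ 2.
have Fq h : modulus h < rho / 2 -> modulus (F (z + h) - q h) <= B * modulus h ^+ 3.
  move=> hr; have E : z + h - z = h by ring.
  have [|r -> Mr] := Hc 3 (z + h); first by rewrite E; lra.
  rewrite !big_ord_recr big_ord0 /= E in Mr *.
  rewrite (_ : _ - _ = h ^+ 3 * r); last by rewrite /q; ring.
  rewrite modulusM modulusX mulrC ler_wpM2r ?exprn_ge0 ?modulus_ge0 //.
  apply: (le_trans Mr); rewrite /B ler_pM2r ?invr_gt0 ?exprn_gt0 //.
  have -> : 4 * M = 2 * M * 2 by ring.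
  by rewrite ler_pM2l ?mulr_gt0 // ler_pdivrMr; lra.
have Fc : F z = c 0%N.
  have [|r] := Hc 1%N z; first by rewrite subrr modulus0.
  by rewrite big_ord1 subrr expr0 mulr1 expr1 mul0r addr0.
pose Q := modulus (c 0%N) + modulus (c 1%N) + modulus (c 2%N).
have Q0 : 0 <= Q by rewrite !addr_ge0 ?modulus_ge0.
have qQ h : modulus h < rho / 2 -> modulus (q h) <= Q.
  move=> hr; have h1 : modulus h <= 1 by lra.
  apply: (le_trans (ler_modulusD _ _)); apply: lerD.
    apply: (le_trans (ler_modulusD _ _)); rewrite lerD2l modulusM.
    by rewrite ler_piMr ?modulus_ge0.
  by rewrite modulusM modulusX ler_piMr ?modulus_ge0 // expr_le1 ?modulus_ge0.
pose S := Q + B.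
have FS h : modulus h < rho / 2 -> modulus (F (z + h)) <= S.
  move=> hr; have h1 : modulus h <= 1 by lra.
  rewrite -(subrK (q h) (F _)) (le_trans (ler_modulusD _ _)) // addrC lerD ?qQ //.
  apply: (le_trans (Fq h hr)); rewrite ler_piMr // expr_le1 ?modulus_ge0 //.
(* Pairing opposite arguments, the product of the four values of [q] is
   [(al + X * h^2) * (al - X * h^2)] with [al = c0^2 + c2^2 * h^4], so the quadratic terms
   cancel. *)
pose X := 2 * c 0%N * c 2%N - c 1%N ^+ 2.
pose P := 2 * modulus (c 0%N) ^+ 2 * modulus (c 2%N) ^+ 2 + modulus (c 2%N) ^+ 4 + modulus X ^+ 2.
have P0 : 0 <= P by rewrite !addr_ge0 ?mulr_ge0 ?exprn_ge0 ?modulus_ge0.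
pose A1 := 4 * (S ^+ 3 * B) + P.
have S0 : 0 <= S by rewrite addr_ge0.
have A10 : 0 <= A1 by rewrite /A1 addr_ge0 // mulr_ge0 // mulr_ge0 // exprn_ge0.
have prodE h : modulus h < rho / 2 ->
    modulus (F (z + h) * F (z + ic * h) * F (z - h) * F (z - ic * h) - F z ^+ 4) <= A1 * modulus h ^+ 3.
  move=> hr; have h1 : modulus h <= 1 by lra.
  have [r1 r2 r3] : [/\ modulus (ic * h) < rho / 2, modulus (- h) < rho / 2 & modulus (- (ic * h)) < rho / 2].
    by rewrite !modulusN modulusM modulus_ic mul1r.
  have qprod : q h * q (ic * h) * q (- h) * q (- (ic * h)) - F z ^+ 4 =
      h ^+ 4 * (2 * c 0%N ^+ 2 * c 2%N ^+ 2 + c 2%N ^+ 4 * h ^+ 4 - X ^+ 2).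
    have i2 : ic * ic = -1 :> C R by exact: ic2.
    have -> : q h * q (ic * h) * q (- h) * q (- (ic * h)) =
      ((c 0%N + c 2%N * h ^+ 2) ^+ 2 - c 1%N ^+ 2 * h ^+ 2) *
      ((c 0%N + c 2%N * (ic * ic * h ^+ 2)) ^+ 2 - c 1%N ^+ 2 * (ic * ic * h ^+ 2)) by rewrite /q; ring.
    by rewrite i2 Fc /X; ring.
  apply: (le_trans (ler_distD_modulus (q h * q (ic * h) * q (- h) * q (- (ic * h))) _ _)).
  rewrite /A1 [leRHS]mulrDl; apply: lerD.
    have mh : modulus (ic * h) = modulus h by rewrite modulusM modulus_ic mul1r.
    rewrite (_ : 4 * _ * _ = 4 * (S ^+ 3 * (B * modulus h ^+ 3))); last by ring.
    have QS x : modulus x < rho / 2 -> modulus (q x) <= S.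
      by move=> /qQ /le_trans; apply; rewrite /S lerDl.
    apply: prod4_dist; do ?[exact: FS|exact: QS].
    - exact: Fq.
    - by rewrite -mh; exact: Fq.
    - by rewrite -(modulusN h); exact: Fq.
    - by rewrite -mh -(modulusN (ic * h)); exact: Fq.
  rewrite qprod modulusM modulusX exprSr -mulrA mulrC ler_wpM2r ?exprn_ge0 ?modulus_ge0 //.
  apply: le_trans (_ : 1 * P <= P); last by rewrite mul1r.
  apply: ler_pM; rewrite ?modulus_ge0 //.
  rewrite /P; apply: (le_trans (ler_modulusB _ _)); rewrite !modulusX lerD2r.
  apply: (le_trans (ler_modulusD _ _)); apply: lerD.
    rewrite (modulusM _ (c 2%N ^+ 2)) (modulusM 2) !modulusX.
    have -> : modulus (2 : C R) = 2.
      by have -> : (2 : C R) = rc 2; [apply: complexP => /=; rewrite ?addr0|rewrite modulus_rc ger0_norm].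
    by [].
  by rewrite modulusM !modulusX ler_piMr ?exprn_ge0 ?modulus_ge0 // exprn_ile1 ?modulus_ge0.
have F0 : 0 < modulus (F z) by rewrite modulus_gt0.
have F4 : 0 < modulus (F z) ^+ 4 by rewrite exprn_gt0.
have cF : {for z, continuous F} by exact: holomorphic_continuous.
have [d d0 Hd] := (nbhs_modulusP _ _).1 (near_neq0 cF Fz).
pose A2 := A1 / modulus (F z) ^+ 4.
have A20 : 0 <= A2 by rewrite divr_ge0 // ltW.
(* The last bound makes the relative error [A2 * |h|^3] at most [1 / 2], as [ln_ge_of_prod4]
   requires. *)
pose r := Num.min (Num.min (rho / 2) d) (2 * (A2 + 1))^-1.
exists (2 * A2), r; split; first by rewrite mulr_ge0.
  by rewrite !lt_min d0 andbT; apply/andP; split; [lra|rewrite invr_gt0; lra].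
move=> h; rewrite !lt_min => /andP[/andP[hrho hd] hA].
have h0 := modulus_ge0 h.
have mh : modulus (ic * h) = modulus h by rewrite modulusM modulus_ic mul1r.
have Ez x : z + x - z = x by ring.
have n1 : F (z + h) != 0 by apply: Hd; rewrite Ez.
have n2 : F (z + ic * h) != 0 by apply: Hd; rewrite Ez mh.
have n3 : F (z - h) != 0 by apply: Hd; rewrite Ez modulusN.
have n4 : F (z - ic * h) != 0 by apply: Hd; rewrite Ez modulusN mh.
split => //.
have h1 : modulus h <= 1 by lra.
have h3 : modulus h ^+ 3 <= modulus h by rewrite exprS ler_piMr // expr_le1.
have y12 : A2 * modulus h ^+ 3 <= 1 / 2.
  apply: le_trans (_ : (A2 + 1) * modulus h <= _).
    by apply: ler_pM => //; [exact: exprn_ge0|lra].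
  by move: (ltW hA); rewrite -[leRHS]mul1r ler_pdivlMr; lra.
rewrite -mulrA; apply: ln_ge_of_prod4; rewrite ?modulus_gt0 //.
  by rewrite y12 mulr_ge0 ?exprn_ge0.
rewrite -!modulusM.
have := prodE h hrho; rewrite modulus_distC => pE.
have := lerB_modulus (F z ^+ 4) (F z ^+ 4 - F (z + h) * F (z + ic * h) * F (z - h) * F (z - ic * h)).
rewrite subKr modulusX.
have -> : modulus (F z) ^+ 4 * (1 - A2 * modulus h ^+ 3) = modulus (F z) ^+ 4 - A1 * modulus h ^+ 3.
  by rewrite /A2; field; rewrite modulus_eq0.
by move=> hh; lra.
Qed.

End Submean.

(** * Monotonicity of circle means *)

Section CircleMeans.
Context {R : realType}.
Implicit Types (u v : C R -> R) (z w h : C R) (F G : C R -> C R).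

(** Heine-Cantor through the near-covering form of compactness, with the modulus of continuity as
    the parameter tending to [0^'+]. *)
Lemma unif_cont_on (g : R -> R) (a b e : R) : cont_on a b g -> 0 < e ->
  exists2 d, 0 < d & forall x y, a <= x <= b -> a <= y <= b -> `|x - y| < d -> `|g x - g y| < e.
Proof.
move=> cg e0.
have /compact_near_coveringP cK := @segment_compact R a b.
have := cK R 0^'+ (fun d x => forall y, a <= y <= b -> `|x - y| < d -> `|g x - g y| < e) _.
case.
  move=> x /=; rewrite in_itv /= => xab.
  have e2 : 0 < e / 2 by rewrite divr_gt0.
  have /cvgrPdist_lt /(_ _ e2) /nbhs_ballP [d /= d0 Hd] := cg x xab.
  have d2 : 0 < d / 2 by rewrite divr_gt0.
  exists (ball x (d / 2), [set s | s < d / 2]).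
    split; first exact: nbhsx_ballx.
    exact: nbhs_right_lt.
  move=> [x' s] [/= xx' sd] y yab x'y.
  have h1 : `|g x - g x'| < e / 2 by apply: Hd; rewrite /ball /= in xx' *; lra.
  have h2 : `|g x - g y| < e / 2.
    apply: Hd; rewrite /ball /= in xx' *.
    by have := ler_distD x' x y; lra.
  by have := ler_distD (g x) (g x') (g y); rewrite (distrC (g x') (g x)); lra.
move=> d /= d0 Hd; exists (d / 2); first by rewrite divr_gt0.
move=> x y xab yab xy.
have d2 : 0 < d / 2 by rewrite divr_gt0.
have Hd2 := Hd (d / 2) _ d2; apply: Hd2 => //=.
  by rewrite /ball /= sub0r normrN gtr0_norm //; lra.
Qed.

(** The common offset [tau] of the sample points is free because the maximum principle returns a
    point of the circle at an unknown angle. *)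
Lemma riemann_sum (g : R -> R) (b d e tau : R) (n : nat) : cont_on 0 b g ->
  0 < d -> 0 <= tau <= d -> d * n%:R <= b ->
  (forall x y, 0 <= x <= b -> 0 <= y <= b -> `|x - y| <= d -> `|g x - g y| <= e) ->
  `|d * \sum_(j < n) g (tau + d * j%:R) - rint 0 (d * n%:R) g| <= e * (d * n%:R).
Proof.
move=> cg d0 /andP[tau0 taud] + ge.
elim: n => [|n IH] dn.
  by rewrite big_ord0 !mulr0 /rint set_itv1 Rintegral_set1 subrr normr0.
have dn0 : 0 <= d * n%:R by rewrite mulr_ge0 // ltW.
have dnS : d * n.+1%:R = d * n%:R + d by rewrite -natr1 mulrDr mulr1.
have dnle : d * n%:R <= d * n.+1%:R by rewrite dnS lerDl ltW.
have dnb : d * n%:R <= b by exact: le_trans dnle dn.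
have c1 : cont_on 0 (d * n.+1%:R) g by apply: cont_on_sub cg _ _.
rewrite big_ord_recr /= (rint_split dn0 dnle c1).
have c2 : cont_on (d * n%:R) (d * n.+1%:R) g by apply: cont_on_sub cg _ _.
set x := tau + d * n%:R.
have xb : 0 <= x <= b by rewrite dnS in dn; apply/andP; split; rewrite /x; lra.
have H (s : R) : (forall t, d * n%:R <= t <= d * n.+1%:R -> s - e <= g t <= s + e) ->
    `|d * s - rint (d * n%:R) (d * n.+1%:R) g| <= e * d.
  move=> hs; have E : d * n.+1%:R - d * n%:R = d by rewrite dnS addrAC subrr add0r.
  have cc (k : R) : cont_on (d * n%:R) (d * n.+1%:R) (fun=> k) by move=> t _; exact: cvg_cst.
  have l1 : rint (d * n%:R) (d * n.+1%:R) (fun=> s - e) <= rint (d * n%:R) (d * n.+1%:R) g.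
    by apply: rint_le => // t /hs /andP[].
  have l2 : rint (d * n%:R) (d * n.+1%:R) g <= rint (d * n%:R) (d * n.+1%:R) (fun=> s + e).
    by apply: rint_le => // t /hs /andP[].
  by rewrite !rint_cst // E in l1 l2; rewrite ler_norml; apply/andP; split; lra.
have Hx : `|d * g x - rint (d * n%:R) (d * n.+1%:R) g| <= e * d.
  apply: H => t /andP[t0 t1].
  have := ge t x; rewrite xb => /(_ _ isT).
  have tb : 0 <= t <= b by apply/andP; split; lra.
  rewrite tb => /(_ isT).
  have tx : `|t - x| <= d by rewrite ler_norml /x; apply/andP; split; lra.
  by move=> /(_ tx); rewrite ler_norml => /andP[? ?]; apply/andP; split; lra.
have := IH dnb; rewrite dnS in Hx *.
set S := \sum_(j < n) _; set I1 := rint _ _ _; set I2 := rint _ _ _ in Hx *.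
move=> H1; have -> : d * (S + g x) - (I1 + I2) = (d * S - I1) + (d * g x - I2) by ring.
apply: (le_trans (ler_normD _ _)); rewrite mulrDr; exact: lerD.
Qed.

Definition circle_mean u (r : R) : R := rint 0 (2 * pi) (fun t => u (rc r * circle_point t)).

Lemma cont_on_circle u (r : R) : 0 <= r < 1 ->
  (forall w, modulus w < 1 -> {for w, continuous u}) ->
  cont_on 0 (2 * pi) (fun t => u (rc r * circle_point t)).
Proof.
move=> /andP[r0 r1] cu t _.
have m : modulus (rc r * circle_point t) < 1.
  by rewrite modulusM modulus_circle_point mulr1 modulus_rc ger0_norm.
have co : {for t, continuous (fun t => rc r * circle_point t)} by exact: continuous_onc.
exact: cvg_comp co (cu _ m).
Qed.

(** Rotation by one root of unity permutes the roots cyclically; the last term wraps around to the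
    first. *)
Lemma root_sum_shift u (N : nat) z : let om := circle_point (2 * pi / N.+1%:R) in
  \sum_(j < N.+1) u (z * om * circle_point (2 * pi / N.+1%:R * j%:R)) =
  \sum_(j < N.+1) u (z * circle_point (2 * pi / N.+1%:R * j%:R)).
Proof.
move=> om; have E (j : nat) : om * circle_point (2 * pi / N.+1%:R * j%:R) = circle_point (2 * pi / N.+1%:R * j.+1%:R).
  by rewrite -circle_pointD; congr circle_point; rewrite -[in RHS]natr1; ring.
rewrite big_ord_recr [RHS]big_ord_recl /= addrC; congr (_ + _).
  rewrite -mulrA E mulr0 circle_point0; congr (u (z * _)).
  by rewrite mulfVK ?pnatr_eq0 // circle_point2pi.
by apply: eq_bigr => j _; rewrite -mulrA E.
Qed.

Lemma root_sum_shiftn u (N k : nat) z :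
  \sum_(j < N.+1) u (z * circle_point (2 * pi / N.+1%:R * k%:R) * circle_point (2 * pi / N.+1%:R * j%:R)) =
  \sum_(j < N.+1) u (z * circle_point (2 * pi / N.+1%:R * j%:R)).
Proof.
elim: k => [|k IH]; first by under eq_bigr do rewrite mulr0 circle_point0 mulr1.
rewrite -IH -[RHS](root_sum_shift u N (z * circle_point (2 * pi / N.+1%:R * k%:R))).
have -> : circle_point (2 * pi / N.+1%:R * k.+1%:R : R) =
    circle_point (2 * pi / N.+1%:R * k%:R) * circle_point (2 * pi / N.+1%:R).
  by rewrite -circle_pointD; congr circle_point; rewrite -[k.+1%:R]natr1; ring.
by rewrite mulrA.
Qed.

Lemma continuous_sum_ord (T : topologicalType) (f : nat -> T -> R) (N : nat) (t : T) :
  (forall j, {for t, continuous (f j)}) -> {for t, continuous (fun x => \sum_(j < N) f j x)}.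
Proof.
move=> cf; elim: N => [|N IH].
  rewrite (_ : (fun _ => _) = fun=> 0); first exact: cst_continuous.
  by apply/funext => x; rewrite big_ord0.
rewrite (_ : (fun _ => _) = fun x => \sum_(j < N) f j x + f N x); last first.
  by apply/funext => x; rewrite big_ord_recr.
by apply: cvgD; [exact: IH|exact: cf].
Qed.

(** The maximum principle, applied to the sum [V] of [u] over the rotations by the roots of unity of
    order [N + 1], compares [V] at [r] with [V] at some point of the circle of radius [r'].
    Multiplied by [d], both values are Riemann sums of the two circle means. *)
Lemma circle_mean_mono u (r r' : R) : 0 <= r -> r <= r' -> r' < 1 ->
  (forall w, modulus w < 1 -> {for w, continuous u}) ->
  (forall w, modulus w < 1 -> four_point_sub u w) ->
  circle_mean u r <= circle_mean u r'.
Proof.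
move=> r0 rr r1 cu qu; have pi0 := pi_gt0 R.
have [r'0|r'0] := leP r' 0.
  by have -> : r = r' by apply/eqP; rewrite eq_le rr (le_trans r'0 r0).
have hr : 0 <= r < 1 by rewrite r0 (le_lt_trans rr).
have hr' : 0 <= r' < 1 by rewrite r1 ltW.
rewrite leNgt; apply/negP => lt.
(* The two Riemann sums together err by at most [4 * pi * e], half of the assumed gap. *)
pose e := (circle_mean u r - circle_mean u r') / (8 * pi).
have e0 : 0 < e by rewrite divr_gt0 ?mulr_gt0 // subr_gt0.
have c1 := cont_on_circle hr cu; have c2 := cont_on_circle hr' cu.
have [d1 d10 H1] := unif_cont_on c1 e0; have [d2 d20 H2] := unif_cont_on c2 e0.
pose dd := Num.min d1 d2.
have dd0 : 0 < dd by rewrite lt_min d10.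
have [N HN] : exists N : nat, 2 * pi / N.+1%:R < dd.
  have e1 : 0 < dd / (2 * pi) by rewrite divr_gt0 // mulr_gt0.
  have /cvgrPdist_lt /(_ _ e1) [n _ Hn] := @cvg_harmonic R.
  exists n; have := Hn n (leqnn n); rewrite /= sub0r normrN ger0_norm //.
  by rewrite ltr_pdivlMr ?mulr_gt0 // mulrC.
pose d : R := 2 * pi / N.+1%:R.
have d0 : 0 < d by rewrite divr_gt0 // mulr_gt0.
have dN : d * N.+1%:R = 2 * pi by rewrite mulfVK ?pnatr_eq0.
have [ddd1 ddd2] : d < d1 /\ d < d2.
  by move: HN; rewrite -/d lt_min => /andP[].
have hN : d * N.+1%:R <= 2 * pi by rewrite dN.
have R1 : `|d * \sum_(j < N.+1) u (rc r * circle_point (0 + d * j%:R)) - circle_mean u r| <= e * (2 * pi).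
  have h0 : (0 : R) <= 0 <= d by apply/andP; split; [exact: lexx|exact: ltW].
  have := riemann_sum c1 d0 h0 hN; rewrite dN; apply.
  by move=> x y hx hy xy; apply: ltW; apply: H1 => //; exact: le_lt_trans xy ddd1.
have R2 tau : 0 <= tau <= d -> `|d * \sum_(j < N.+1) u (rc r' * circle_point (tau + d * j%:R)) - circle_mean u r'| <= e * (2 * pi).
  move=> ht; have := riemann_sum c2 d0 ht hN; rewrite dN; apply.
  by move=> x y hx hy xy; apply: ltW; apply: H2 => //; exact: le_lt_trans xy ddd2.
pose V w := \sum_(j < N.+1) u (w * circle_point (d * j%:R)).
have mc w t : modulus (w * circle_point t) = modulus w by rewrite modulusM modulus_circle_point mulr1.
have cV w : modulus w < 1 -> {for w, continuous V}.
  move=> w1; apply: (@continuous_sum_ord (C R) (fun j w => u (w * circle_point (d * j%:R)))) => j.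
  have co : {for w, continuous (fun w : C R => w * circle_point (d * j%:R))}.
    by apply: continuous_mul_fun; [exact: cvg_id|exact: (@cst_continuous (C R) (C R) _ w)].
  by apply: cvg_comp co (cu _ _); rewrite mc.
have qV w : modulus w < 1 -> four_point_sub V w.
  move=> w1; apply: (@four_point_sub_sum R N.+1 (fun j w => u (w * circle_point (d * j%:R)))) => j.
  by apply: four_point_sub_rot; [exact: modulus_circle_point|apply: qu; rewrite mc].
have hr01 : 0 < r' < 1 by rewrite r'0.
have rr' : modulus (rc r) <= r' by rewrite modulus_rc ger0_norm.
have [tau /andP[tau0 tau1] Vt] := max_principle hr01 cV qV rr'.
(* [V] is invariant under rotation by [d], so the angle reduces to an offset in [[0, d]], as
   [riemann_sum] requires. *)
pose k := Num.truncn (tau / d).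
have td : 0 <= tau / d by rewrite divr_ge0 // ltW.
have /andP[k1 k2] := truncn_itv td.
rewrite -/k ler_pdivlMr // in k1; rewrite -/k ltr_pdivrMr // -natr1 mulrDl mul1r in k2.
have ht : 0 <= tau - d * k%:R <= d by apply/andP; split; lra.
have Et : V (rc r' * circle_point tau) = \sum_(j < N.+1) u (rc r' * circle_point (tau - d * k%:R + d * j%:R)).
  have -> : rc r' * circle_point tau = rc r' * circle_point (tau - d * k%:R) * circle_point (d * k%:R).
    by rewrite -mulrA -circle_pointD subrK.
  rewrite /V /d root_sum_shiftn; apply: eq_bigr => j _.
  by rewrite (circle_pointD (tau - _)) mulrA.
have := R2 _ ht; rewrite -Et ler_norml => /andP[_ a2].
move: R1; under eq_bigr do rewrite add0r.
rewrite -/(V (rc r)) ler_norml => /andP[a1 _].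
have a3 : d * V (rc r) <= d * V (rc r' * circle_point tau) by rewrite ler_pM2l.
have : e * (8 * pi) = circle_mean u r - circle_mean u r'.
  by rewrite /e mulfVK // gt_eqF // mulr_gt0.
lra.
Qed.

End CircleMeans.

(** * Blaschke products *)

Section BlaschkeBounds.
Context {R : realType}.
Implicit Types (z w a : C R) (zs : nat -> option (C R)).

Lemma modulus_conjc_identity a w :
  modulus (1 - (conjc a : C R) * w) ^+ 2 - modulus (a - w) ^+ 2
  = (1 - modulus a ^+ 2) * (1 - modulus w ^+ 2).
Proof.
by rewrite !modulusE !sqr_sqrtr ?addr_ge0 ?sqr_ge0 //; case: a w => [a b] [x y] /=; ring.
Qed.

Lemma modulus_blaschke_factor a w : a != 0 ->
  modulus (blaschke_factor a w) = modulus (a - w) / modulus (1 - (conjc a : C R) * w).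
Proof.
move=> a0; rewrite /blaschke_factor (negbTE a0) modulusM !modulusMV normC_modulus modulus_rc.
by rewrite ger0_norm ?modulus_ge0 // divff ?mul1r // modulus_eq0.
Qed.

Lemma blaschke_factor_le1 a w : unit_disk a -> unit_disk w -> modulus (blaschke_factor a w) <= 1.
Proof.
move=> aD wD; have [/unit_diskE a1 /unit_diskE w1] := (aD, wD).
have [->|a0] := eqVneq a 0; first by rewrite /blaschke_factor eqxx ltW.
have d0 : 0 < modulus (1 - (conjc a : C R) * w) by rewrite modulus_gt0 blaschke_den_neq0.
rewrite modulus_blaschke_factor // ler_pdivrMr // mul1r.
rewrite -(ler_pXn2r (n := 2)) ?nnegrE ?modulus_ge0 // -subr_ge0 modulus_conjc_identity.
by rewrite mulr_ge0 // subr_ge0 expr_le1 ?modulus_ge0 // ltW.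
Qed.

(** For [a != 0], [modulus_conjc_identity] gives [1 - b^2 = (1 - |a|^2) (1 - |w|^2) / d^2] with
    [d >= 1 - |a|], and [b^2 <= b]. Hence a factor tends to 1 in modulus at the unit circle. *)
Lemma blaschke_factor_ge a w : unit_disk a -> unit_disk w ->
  1 - 4 * (1 - modulus w) / (1 - modulus a) <= modulus (blaschke_factor a w).
Proof.
move=> aD wD; have [/unit_diskE a1 /unit_diskE w1] := (aD, wD).
have [a0' w0] := (modulus_ge0 a, modulus_ge0 w).
have [->|a0] := eqVneq a 0.
  rewrite /blaschke_factor eqxx modulus0 subr0 divr1; lra.
have d0 : 0 < modulus (1 - (conjc a : C R) * w) by rewrite modulus_gt0 blaschke_den_neq0.
set b := modulus (blaschke_factor a w).
have b1 : b <= 1 by exact: blaschke_factor_le1.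
have b0 : 0 <= b by exact: modulus_ge0.
have bb : b ^+ 2 <= b by rewrite expr2 ler_piMl.
apply: le_trans bb.
set d := modulus (1 - _) in d0.
have E : b ^+ 2 = 1 - (1 - modulus a ^+ 2) * (1 - modulus w ^+ 2) / d ^+ 2.
  rewrite /b modulus_blaschke_factor // -modulus_conjc_identity -/d expr_div_n.
  by field; rewrite gt_eqF.
rewrite E lerD2l lerN2.
have dlb : 1 - modulus a <= d.
  apply: le_trans (lerB_modulus _ _); rewrite modulus1 lerD2l lerN2 modulusM modulus_conjc.
  by rewrite ler_piMr // ltW.
have a10 : 0 < 1 - modulus a by rewrite subr_gt0.
rewrite ler_pdivrMr ?exprn_gt0 // mulrAC ler_pdivlMr //.
have d2 : (1 - modulus a) ^+ 2 <= d ^+ 2 by rewrite ler_pXn2r // nnegrE ltW.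
have h1 : (1 - modulus a ^+ 2) * (1 - modulus a) <= 2 * d ^+ 2.
  apply: le_trans (_ : 2 * (1 - modulus a) ^+ 2 <= _); last by rewrite ler_pM2l.
  have -> : 1 - modulus a ^+ 2 = (1 + modulus a) * (1 - modulus a) by ring.
  rewrite -mulrA -expr2 ler_wpM2r ?sqr_ge0 //; lra.
have h2 : 0 <= 1 - modulus w ^+ 2 by rewrite subr_ge0 expr_le1 // ltW.
have h3 : 1 - modulus w ^+ 2 <= 2 * (1 - modulus w).
  have -> : 1 - modulus w ^+ 2 = (1 + modulus w) * (1 - modulus w) by ring.
  by rewrite ler_wpM2r; lra.
have -> : (1 - modulus a ^+ 2) * (1 - modulus w ^+ 2) * (1 - modulus a) =
  ((1 - modulus a ^+ 2) * (1 - modulus a)) * (1 - modulus w ^+ 2) by ring.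
have -> : 4 * (1 - modulus w) * d ^+ 2 = (2 * d ^+ 2) * (2 * (1 - modulus w)) by ring.
apply: ler_pM => //; rewrite mulr_ge0 ?subr_ge0 ?expr_le1 // ltW //.
Qed.

(** Up to sign, for [a != 0], the difference is [(1 - |a|) (a + |a| w)] over [a (1 - conj(a) w)];
    the factor [1 - |a|] makes the product converge under the Blaschke condition. *)
Lemma blaschke_factor_near1 a w : unit_disk a -> unit_disk w ->
  modulus (blaschke_factor a w - 1) <= 2 * (1 - modulus a) / (1 - modulus w).
Proof.
move=> aD wD; have [/unit_diskE a1 /unit_diskE w1] := (aD, wD).
have [a0' w0] := (modulus_ge0 a, modulus_ge0 w).
have w10 : 0 < 1 - modulus w by rewrite subr_gt0.
have [->|a0] := eqVneq a 0.
  rewrite /blaschke_factor eqxx modulus0 subr0 mulr1 ler_pdivlMr //.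
  apply: (le_trans (ler_wpM2r (ltW w10) (ler_modulusB _ _))); rewrite modulus1.
  have : (modulus w + 1) * (1 - modulus w) = 1 - modulus w ^+ 2 by ring.
  by move=> ->; have := sqr_ge0 (modulus w); lra.
have dn0 := blaschke_den_neq0 aD wD.
have E : blaschke_factor a w - 1 =
    - (rc (1 - modulus a) * (a + rc (modulus a) * w)) / (a * (1 - (conjc a : C R) * w)).
  rewrite /blaschke_factor (negbTE a0) normC_modulus rcD rcN rc1.
  have aa : (conjc a : C R) * a = rc (modulus a) * rc (modulus a).
    by rewrite mulC_conjc expr2 rcM.
  have -> : rc (modulus a) / a * ((a - w) / (1 - (conjc a : C R) * w)) - 1 =
    (rc (modulus a) * (a - w) - a + (conjc a * a) * w) / (a * (1 - (conjc a : C R) * w)).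
    by field; rewrite dn0 a0.
  by rewrite aa; congr (_ / _); ring.
have m0 : 0 < modulus a by rewrite modulus_gt0.
rewrite E modulusMV modulusN !modulusM modulus_rc ger0_norm ?subr_ge0 ?(ltW a1) //.
have N : modulus (a + rc (modulus a) * w) <= 2 * modulus a.
  apply: (le_trans (ler_modulusD _ _)); rewrite modulusM modulus_rc ger0_norm //.
  by have : modulus a * modulus w <= modulus a * 1 by [rewrite ler_wpM2l // ltW]; lra.
have D : 1 - modulus w <= modulus (1 - (conjc a : C R) * w).
  apply: le_trans (lerB_modulus _ _); rewrite modulus1 lerD2l lerN2 modulusM modulus_conjc.
  by rewrite ler_piMl // ltW.
have D0 : 0 < modulus (1 - (conjc a : C R) * w) by exact: lt_le_trans D.
rewrite ler_pdivrMr ?mulr_gt0 //.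
have -> : 2 * (1 - modulus a) / (1 - modulus w) * (modulus a * modulus (1 - (conjc a : C R) * w)) =
  (1 - modulus a) * (2 * modulus a * (modulus (1 - (conjc a : C R) * w) / (1 - modulus w))).
  by field; rewrite gt_eqF.
apply: ler_wpM2l; first by rewrite subr_ge0 ltW.
apply: (le_trans N); rewrite ler_peMr ?mulr_ge0 //.
by rewrite ler_pdivlMr // mul1r.
Qed.

Lemma blaschke_factor_at0 a : a != 0 -> modulus (blaschke_factor a 0) = modulus a.
Proof. by move=> a0; rewrite modulus_blaschke_factor // mulr0 !subr0 modulus1 divr1. Qed.

Definition deficit zs k : R := if zs k is Some a then 1 - modulus a else 0.

Section ListedZeros.
Context (zs : nat -> option (C R)) (zsD : forall k a, zs k = Some a -> unit_disk a).

Lemma deficit_ge0 k : 0 <= deficit zs k.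
Proof.
rewrite /deficit; case E : (zs k) => [a|//].
by have /unit_diskE := zsD E; rewrite subr_ge0 => /ltW.
Qed.

Lemma deficit_le1 k : deficit zs k <= 1.
Proof. by rewrite /deficit; case: (zs k) => [a|//]; rewrite lerBlDr lerDl modulus_ge0. Qed.

Lemma zero_factor_le1 k w : unit_disk w -> modulus (zero_factor zs k w) <= 1.
Proof.
move=> wD; rewrite /zero_factor; case E : (zs k) => [a|]; last by rewrite modulus1.
exact: blaschke_factor_le1 (zsD E) wD.
Qed.

Lemma zero_factor_near1 k w : unit_disk w ->
  modulus (zero_factor zs k w - 1) <= 2 * deficit zs k / (1 - modulus w).
Proof.
move=> wD; rewrite /zero_factor /deficit; case E : (zs k) => [a|].
  exact: blaschke_factor_near1 (zsD E) wD.
by rewrite subrr modulus0 mulr0 mul0r.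
Qed.

Definition zero_prod n m w : C R := \prod_(n <= k < m) zero_factor zs k w.

Lemma zero_prod_le1 n m w : unit_disk w -> modulus (zero_prod n m w) <= 1.
Proof.
move=> wD; rewrite /zero_prod modulus_prod; apply: prodr_ile1 => k _.
by rewrite modulus_ge0 zero_factor_le1.
Qed.

(** Partial products have modulus at most 1, so the errors of the factors add up by telescoping. *)
Lemma zero_prod_near1 n m w : (n <= m)%N -> unit_disk w ->
  modulus (zero_prod n m w - 1) <= 2 * (\sum_(n <= k < m) deficit zs k) / (1 - modulus w).
Proof.
move=> nm wD; rewrite -(subnKC nm); elim: (m - n)%N => [|j IH].
  by rewrite addn0 /zero_prod !big_geq // subrr modulus0 mulr0 mul0r.
rewrite addnS /zero_prod !big_nat_recr ?leq_addr //= -/(zero_prod n (n + j) w).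
set P := zero_prod _ _ _ in IH *; set f := zero_factor _ _ _.
have -> : P * f - 1 = P * (f - 1) + (P - 1) by ring.
apply: (le_trans (ler_modulusD _ _)); rewrite [leLHS]addrC.
have -> (x y t : R) : 2 * (x + y) / t = 2 * x / t + 2 * y / t by ring.
apply: lerD; first exact: IH.
rewrite modulusM; apply: le_trans (zero_factor_near1 _ wD).
by rewrite ler_piMl ?modulus_ge0 // zero_prod_le1.
Qed.

Lemma zero_prod_boundary n (e : R) : 0 < e -> exists2 r, 0 <= r < 1 &
  forall w, r <= modulus w < 1 -> 1 - e <= modulus (zero_prod 0 n w).
Proof.
elim: n e => [|n IH] e e0.
  exists 0; first by rewrite lexx ltr01.
  by move=> w _; rewrite /zero_prod big_geq // modulus1; lra.
(* With [e' <= e / 2], two bounds [1 - e'] multiply to at least [1 - e]; [e' <= 1] keeps them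
   nonnegative. *)
have e2 : 0 < Num.min (e / 2) 1 by rewrite lt_min ltr01 divr_gt0.
have [r /andP[r0 r1] Hr] := IH _ e2.
have e2' : Num.min (e / 2) 1 <= e / 2 by rewrite ge_min lexx.
have e21 : Num.min (e / 2) 1 <= 1 by rewrite ge_min lexx orbT.
set e' := Num.min _ _ in Hr e2 e2' e21.
have mulE (x y : R) : 1 - e' <= x -> 1 - e' <= y -> 1 - e <= x * y.
  move=> hx hy; have : (1 - e') * (1 - e') <= x * y by apply: ler_pM; lra.
  have -> : (1 - e') * (1 - e') = 1 - 2 * e' + e' ^+ 2 by ring.
  have := sqr_ge0 e'; lra.
case E : (zs n) => [a|]; last first.
  exists r; first by rewrite r0.
  move=> w wr; rewrite /zero_prod big_nat_recr //= -/(zero_prod 0 n w) /zero_factor E mulr1.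
  by apply: le_trans (Hr w wr); lra.
have aD := zsD E; have /unit_diskE a1 := aD.
(* Beyond this radius [blaschke_factor_ge] bounds the new factor below by [1 - e']. *)
pose s := Num.max r (1 - e' * (1 - modulus a) / 4).
have ea0 : 0 < e' * (1 - modulus a) / 4 by rewrite divr_gt0 // mulr_gt0 // subr_gt0.
exists s.
  by rewrite le_max r0 /= gt_max r1 /=; lra.
move=> w /andP[sw w1]; have [rw ew] : r <= modulus w /\ 1 - e' * (1 - modulus a) / 4 <= modulus w.
  by move: sw; rewrite /s ge_max => /andP[].
rewrite /zero_prod big_nat_recr //= -/(zero_prod 0 n w) modulusM; apply: mulE.
  by apply: Hr; rewrite rw.
rewrite /zero_factor E; apply: le_trans (blaschke_factor_ge aD _); last exact/unit_diskE.
rewrite lerD2l lerN2 ler_pdivrMr ?subr_gt0 //; lra.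
Qed.

End ListedZeros.

Lemma complex_cauchy_cvg (x : nat -> C R) :
  (forall e, 0 < e -> exists N, forall n m, (N <= n)%N -> (N <= m)%N -> modulus (x n - x m) < e) ->
  exists l, forall e, 0 < e -> exists N, forall n, (N <= n)%N -> modulus (x n - l) < e.
Proof.
move=> cx.
have realc (y : nat -> R) : (forall e, 0 < e -> exists N, forall n m, (N <= n)%N -> (N <= m)%N -> `|y n - y m| < e) ->
    exists l : R, forall e, 0 < e -> exists N, forall n, (N <= n)%N -> `|y n - l| < e.
  move=> cy; have : cvgn y.
    apply/cauchy_cvgP/cauchy_exP => e e0; have [N HN] := cy e e0.
    by exists (y N); exists N => // n /= Nn; rewrite /ball /=; apply: HN.
  move=> /cvgrPdist_lt cvy; exists (limn y) => e e0; have [N _ HN] := cvy e e0.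
  by exists N => n Nn; rewrite distrC; exact: HN.
have [|a Ha] := realc (fun n => cre (x n)).
  move=> e /cx [N HN]; exists N => n m Nn Nm.
  by apply: le_lt_trans (HN n m Nn Nm); rewrite -creN -creD ler_Re_modulus.
have [|b Hb] := realc (fun n => cim (x n)).
  move=> e /cx [N HN]; exists N => n m Nn Nm.
  by apply: le_lt_trans (HN n m Nn Nm); rewrite -cimN -cimD ler_Im_modulus.
exists ((a +i* b)%C : C R) => e e0; have e2 : 0 < e / 2 by rewrite divr_gt0.
have [N1 H1] := Ha _ e2; have [N2 H2] := Hb _ e2.
exists (maxn N1 N2) => n; rewrite geq_max => /andP[n1 n2].
apply: (le_lt_trans (modulus_le_ReIm _)); rewrite creD creN cimD cimN /=.
by have := H1 n n1; have := H2 n n2; lra.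
Qed.

(* Uniform second order Taylor bounds make pointwise convergence enough. *)
Lemma holomorphic_limit (F : nat -> C R -> C R) (H : C R -> C R) :
  (forall n, holomorphic_on_disk (F n)) ->
  (forall r : R, r < 1 -> exists (N : nat) (M : R), 0 < M /\ forall n w, (N <= n)%N -> modulus w <= r -> modulus (F n w) <= M) ->
  (forall w, unit_disk w -> forall e : R, 0 < e -> exists N, forall n, (N <= n)%N -> modulus (F n w - H w) < e) ->
  holomorphic_on_disk H.
Proof.
move=> hF bF FH z zD; have /unit_diskE z1 := zD; have z0 := modulus_ge0 z.
pose rho := (1 - modulus z) / 2.
have [rho0 rho1] : 0 < rho /\ rho < 1 - modulus z by rewrite /rho; split; lra.
clearbody rho.
have zr1 : modulus z + rho < 1 by lra.
have [N0 [M [M0 HM]]] := bF _ zr1.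
pose Q := 4 * M / rho ^+ 2.
have Q0 : 0 < Q by rewrite /Q divr_gt0 ?exprn_gt0 // mulr_gt0.
have second n : exists d : C R, (N0 <= n)%N -> forall w, modulus (w - z) < rho / 2 ->
    modulus (F n w - F n z - d * (w - z)) <= Q * modulus (w - z) ^+ 2.
  have [Nn|] := boolP (N0 <= n)%N; last by exists 0.
  have [||c Hc] := @taylor_at R (F n) z rho M rho0.
  - by move=> w h; apply: (hF n); apply/unit_diskE; apply: modulus_ball rho1 h.
  - move=> t _; apply: HM => //; apply: (le_trans (ler_modulusD _ _)).
    by rewrite lerD2l modulus_onc.
  exists (c 1%N) => _ w wr; have wr' : modulus (w - z) < rho by lra.
  have c0 : F n z = c 0%N.
    have [|r ->] := Hc 1%N z; first by rewrite subrr modulus0.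
    by rewrite big_ord1 subrr expr0 mulr1 expr1 mul0r addr0.
  have [r Er Mr] := Hc 2 w wr'.
  rewrite !big_ord_recr big_ord0 /= add0r expr0 mulr1 expr1 in Er.
  rewrite Er c0 (_ : _ - _ - _ = (w - z) ^+ 2 * r); last by ring.
  rewrite modulusM modulusX mulrC ler_wpM2r ?exprn_ge0 ?modulus_ge0 //.
  apply: (le_trans Mr); rewrite /Q ler_pM2r ?invr_gt0 ?exprn_gt0 //.
  have -> : 4 * M = 2 * M * 2 by ring.
  by rewrite ler_pM2l ?mulr_gt0 // ler_pdivrMr; lra.
have [d Hd] := choice second.
have ball_in w : modulus (w - z) < rho / 2 -> unit_disk w.
  by move=> h; apply/unit_diskE; apply: modulus_ball rho1 _; lra.
have [|l Hl] := complex_cauchy_cvg (x := d).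
  (* The coefficients [d n] are compared at the single point [z + t]: the second order errors cost
     at most [e * t / 4] in total, the four values of [F] at most [e * t / 2]. *)
  move=> e e0; pose t := Num.min (rho / 4) (e / (8 * Q)).
  have t0 : 0 < t by rewrite lt_min; apply/andP; split; apply: divr_gt0 => //; exact: mulr_gt0.
  have tr : t < rho / 2 by apply: (@le_lt_trans _ _ (rho / 4)); [rewrite ge_min lexx|lra].
  have tQ : t * (8 * Q) <= e by rewrite -ler_pdivlMr; [rewrite /t ge_min lexx orbT|exact: mulr_gt0].
  pose w := z + rc t.
  have wz : w - z = rc t by rewrite /w; ring.
  have mwz : modulus (w - z) = t by rewrite wz modulus_rc gtr0_norm.
  have wr : modulus (w - z) < rho / 2 by rewrite mwz.
  have et : 0 < e * t / 8 by rewrite divr_gt0 // mulr_gt0.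
  have [N1 H1] := FH w (ball_in w wr) _ et; have [N2 H2] := FH z zD _ et.
  exists (maxn N0 (maxn N1 N2)) => n m; rewrite !geq_max => /and3P[n0 n1 n2] /and3P[m0 m1 m2].
  have A1 := Hd n n0 w wr; have A2 := Hd m m0 w wr.
  rewrite mwz in A1 A2.
  have B1 := H1 n n1; have B2 := H1 m m1; have B3 := H2 n n2; have B4 := H2 m m2.
  have key : modulus ((d n - d m) * (w - z)) <= modulus (F n w - F n z - d n * (w - z)) +
     modulus (F m w - F m z - d m * (w - z)) + (modulus (F n w - H w) + modulus (F m w - H w)) +
     (modulus (F n z - H z) + modulus (F m z - H z)).
    have -> : (d n - d m) * (w - z) = - (F n w - F n z - d n * (w - z)) + (F m w - F m z - d m * (w - z))
      + ((F n w - H w) - (F m w - H w)) + (- (F n z - H z) + (F m z - H z)) by ring.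
    apply: (le_trans (ler_modulusD _ _)); apply: lerD.
      apply: (le_trans (ler_modulusD _ _)); apply: lerD; last exact: ler_modulusB.
      by apply: (le_trans (ler_modulusD _ _)); rewrite modulusN.
    by apply: (le_trans (ler_modulusD _ _)); rewrite modulusN.
  rewrite modulusM mwz in key.
  rewrite -(ltr_pM2r t0).
  have Qt : Q * t ^+ 2 <= e * t / 8.
    by have := ler_wpM2r (ltW t0) tQ; rewrite expr2; lra.
  lra.
apply/derivable_modulusP; exists l => e e0.
exists (Num.min (rho / 2) (e / Q)).
  by rewrite lt_min; apply/andP; split; apply: divr_gt0.
move=> w; rewrite lt_min => /andP[wr we].
have wD := ball_in w wr.
(* [H] inherits the second order bound with constant [Q]; the radius [e / Q] turns it into a first
   order one. *)
apply: le_trans (_ : Q * modulus (w - z) ^+ 2 <= _); last first.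
  rewrite expr2 mulrA ler_wpM2r ?modulus_ge0 // mulrC -ler_pdivlMr //; exact: ltW.
apply/ler_addgt0Pr => e1 e10.
have e4 : 0 < e1 / 4 by rewrite divr_gt0.
have [N1 H1] := FH w wD _ e4; have [N2 H2] := FH z zD _ e4; have [N3 H3] := Hl _ e4.
pose n := maxn (maxn N0 N1) (maxn N2 N3).
have [n0 n1 n2 n3] : [/\ (N0 <= n)%N, (N1 <= n)%N, (N2 <= n)%N & (N3 <= n)%N].
  by rewrite /n; split; rewrite !leq_max leqnn ?orbT.
have A := Hd n n0 w wr; have B1 := H1 n n1; have B2 := H2 n n2; have B3 := H3 n n3.
have wle1 : modulus (w - z) <= 1 by lra.
have -> : H w - H z - l * (w - z) = (F n w - F n z - d n * (w - z)) - (F n w - H w) + (F n z - H z) + (d n - l) * (w - z).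
  by ring.
apply: (le_trans (ler_modulusD _ _)).
have : modulus ((d n - l) * (w - z)) <= e1 / 4.
  by rewrite modulusM -[leRHS]mulr1 ler_pM ?modulus_ge0 // ltW.
have := ler_modulusD (F n w - F n z - d n * (w - z) - (F n w - H w)) (F n z - H z).
have := ler_modulusB (F n w - F n z - d n * (w - z)) (F n w - H w).
lra.
Qed.

End BlaschkeBounds.

(** * Means of the quotients by finite Blaschke products, and their limit *)

Section Factorization.
Context {R : realType} (psi : R -> R).
Hypothesis psi_cont : continuous psi.
Hypothesis psi_mono : forall s t : R, 0 <= s -> s <= t -> psi s <= psi t.
Hypothesis psi_ge0 : forall s : R, 0 <= psi s.
Hypothesis psi_at0 : psi 0 = 0.
Hypothesis psi_support : forall s0 : R, 0 < s0 -> exists2 L : R, 0 <= L &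
  forall e : R, 0 < e -> exists2 k : R, 0 <= k <= L &
    forall s : R, 0 < s -> psi s0 - e + k * (ln s - ln s0) <= psi s.
Hypothesis psi_unbounded : forall A : R, exists X : R, forall s : R, X < s -> A < psi s.
Implicit Types (z w a : C R) (F G H : C R -> C R) (zs : nat -> option (C R)) (lam r : R).

Definition gauge lam F w : R := psi (modulus (F w) / lam).

Lemma gauge_continuous lam F w : holomorphic_on_disk F -> unit_disk w ->
  {for w, continuous (gauge lam F)}.
Proof.
move=> hF wD.
have cF : {for w, continuous (fun w => modulus (F w))}.
  by apply: continuous_comp_modulus; exact: holomorphic_continuous.
have cl : {for modulus (F w), continuous (fun x : R => psi (x / lam))}.
  have cd : {for modulus (F w), continuous (fun x : R => x / lam)}.
    by apply: cvgM; [exact: cvg_id|exact: cvg_cst].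
  exact: cvg_comp cd (psi_cont (x := _)).
exact: cvg_comp cF cl.
Qed.

(** At a zero of [F] the left side vanishes as [psi 0 = 0]. Elsewhere a single support line of slope
    [k] in [log s] serves all four points, so that [ln_modulus_four_points] can be multiplied by
    [k]; since [k <= L] uniformly in the tolerance [e], the latter can be removed. *)
Lemma gauge_four_point lam F w : 0 < lam -> holomorphic_on_disk F -> unit_disk w ->
  four_point_sub (gauge lam F) w.
Proof.
move=> lam0 hF wD; have [Fw|Fw] := eqVneq (F w) 0.
  exists 0, 1; split => // h _.
  by rewrite {1}/gauge Fw modulus0 mul0r psi_at0 !mulr0 mul0r subrr !addr_ge0 // psi_ge0.
have s0 : 0 < modulus (F w) / lam by rewrite divr_gt0 // modulus_gt0.
have [L L0 HL] := psi_support s0.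
have [A [r [A0 r0 HA]]] := ln_modulus_four_points hF wD Fw.
exists (L * A), r; split => //; first exact: mulr_ge0.
move=> h hr; have [n1 n2 n3 n4 Hln] := HA h hr.
apply/ler_addgt0Pr => e e0.
have e4 : 0 < e / 4 by rewrite divr_gt0.
have [k /andP[k0 kL] Hk] := HL _ e4.
have lnE x : x != 0 -> ln (modulus x / lam) = ln (modulus x) - ln lam.
  by move=> x0; rewrite ln_div ?posrE ?modulus_gt0.
have Hx x : x != 0 -> psi (modulus (F w) / lam) - e / 4 + k * (ln (modulus x) - ln (modulus (F w))) <= psi (modulus x / lam).
  move=> x0; have := Hk (modulus x / lam); rewrite divr_gt0 ?modulus_gt0 // => /(_ isT).
  rewrite !lnE //; apply: le_trans; rewrite lerD2l ler_wpM2l //; lra.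
have P1 := Hx _ n1; have P2 := Hx _ n2; have P3 := Hx _ n3; have P4 := Hx _ n4.
rewrite -/(gauge lam F w) -/(gauge lam F (w + h)) in P1.
rewrite -/(gauge lam F w) -/(gauge lam F (w + ic * h)) in P2.
rewrite -/(gauge lam F w) -/(gauge lam F (w - h)) in P3.
rewrite -/(gauge lam F w) -/(gauge lam F (w - ic * h)) in P4.
set l0 := ln (modulus (F w)) in Hln P1 P2 P3 P4.
set l1 := ln (modulus (F (w + h))) in Hln P1.
set l2 := ln (modulus (F (w + ic * h))) in Hln P2.
set l3 := ln (modulus (F (w - h))) in Hln P3.
set l4 := ln (modulus (F (w - ic * h))) in Hln P4.
have B : - (A * modulus h ^+ 3) <= (l1 + l2 + (l3 + l4)) - 4 * l0 by lra.
have D : - (L * A * modulus h ^+ 3) <= k * ((l1 + l2 + (l3 + l4)) - 4 * l0).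
  apply: le_trans (ler_wpM2l k0 B); rewrite mulrN lerN2 -mulrA ler_wpM2r //.
  by rewrite mulr_ge0 // exprn_ge0 // modulus_ge0.
lra.
Qed.

Lemma circle_mean_le (u v : C R -> R) r : 0 <= r < 1 ->
  (forall w, modulus w < 1 -> {for w, continuous u}) ->
  (forall w, modulus w < 1 -> {for w, continuous v}) ->
  (forall w, modulus w = r -> u w <= v w) -> circle_mean u r <= circle_mean v r.
Proof.
move=> hr cu cv uv; apply: rint_le; [exact: cont_on_circle|exact: cont_on_circle|].
move=> t _; apply: uv; case/andP: hr => r0 _.
by rewrite modulusM modulus_circle_point mulr1 modulus_rc ger0_norm.
Qed.

Lemma gauge_continuous_disk lam F : holomorphic_on_disk F ->
  forall w, modulus w < 1 -> {for w, continuous (gauge lam F)}.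
Proof. by move=> hF w w1; apply: gauge_continuous => //; apply/unit_diskE. Qed.

Lemma gauge_mean_mono lam F r r' : 0 < lam -> holomorphic_on_disk F ->
  0 <= r -> r <= r' -> r' < 1 -> circle_mean (gauge lam F) r <= circle_mean (gauge lam F) r'.
Proof.
move=> lam0 hF r0 rr r1; apply: circle_mean_mono => //; first exact: gauge_continuous_disk.
by move=> w w1; apply: gauge_four_point => //; apply/unit_diskE.
Qed.

Definition means_bounded lam F (A : R) := forall r, 0 <= r < 1 -> circle_mean (gauge lam F) r <= A.

(** Pushing the circle out to [r'] is harmless since the means of [F] increase, and on that circle
    the pointwise comparison applies. *)
Lemma means_bounded_le lam mu F G (A : R) : 0 < lam -> 0 < mu ->
  holomorphic_on_disk F -> holomorphic_on_disk G ->
  (forall r, 0 <= r < 1 -> exists2 r', r <= r' < 1 & forall w, r <= modulus w -> r' <= modulus w < 1 -> modulus (F w) / lam <= modulus (G w) / mu) ->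
  means_bounded mu G A -> means_bounded lam F A.
Proof.
move=> lam0 mu0 hF hG HFG bG r hr; have [r' /andP[rr' r'1] H'] := HFG r hr.
case/andP: (hr) => r0 r1; have hr' : 0 <= r' < 1 by rewrite r'1 (le_trans r0 rr').
apply: le_trans (gauge_mean_mono lam0 hF r0 rr' r'1) _.
apply: le_trans (bG _ hr'); apply: circle_mean_le => //; try exact: gauge_continuous_disk.
move=> w wr'; apply: psi_mono; first by rewrite divr_ge0 ?modulus_ge0 // ltW.
by apply: H'; rewrite wr' // lexx.
Qed.

Section Quotients.
Context (G : C R -> C R) (zs : nat -> option (C R)) (F : nat -> C R -> C R).
Hypothesis zsD : forall k a, zs k = Some a -> unit_disk a.
Hypothesis F0 : F 0%N = G.
Hypothesis hF : forall n, holomorphic_on_disk (F n).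
Hypothesis FS : forall n w, unit_disk w -> F n w = zero_factor zs n w * F n.+1 w.
Hypothesis FO : forall n a, unit_disk a -> exists m, zero_order (F n) a m /\ ([set k | zs (n + k)%N = Some a] #= `I_m)%card.

Lemma quotient_prod n m w : unit_disk w -> (n <= m)%N -> F n w = zero_prod zs n m w * F m w.
Proof.
move=> wD nm; rewrite -(subnKC nm); elim: (m - n)%N => [|j IH].
  by rewrite addn0 /zero_prod big_geq // mul1r.
rewrite addnS /zero_prod big_nat_recr ?leq_addr //= -/(zero_prod zs n (n + j) w).
by rewrite IH FS // mulrA.
Qed.

Lemma modulus_quotient_le n m w : unit_disk w -> (n <= m)%N -> modulus (F n w) <= modulus (F m w).
Proof.
move=> wD nm; rewrite (quotient_prod wD nm) modulusM ler_piMl ?modulus_ge0 //.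
exact: zero_prod_le1.
Qed.

(* The finite product is at least 1/2 in modulus near the unit circle, and the
   circle means increase with the radius. *)
Lemma quotient_means_bounded lam (A : R) n : 0 < lam -> means_bounded lam G A ->
  means_bounded (2 * lam) (F n) A.
Proof.
move=> lam0; have lam2 : 0 < 2 * lam by rewrite mulr_gt0.
have hG : holomorphic_on_disk G by rewrite -F0; exact: hF.
move=> bG; apply: (means_bounded_le lam2 lam0 (@hF n) hG _ bG) => r /andP[r0 r1].
have e2 : 0 < 1 / 2 :> R by rewrite divr_gt0.
have [s /andP[s0 s1] Hs] := zero_prod_boundary (@zsD) n e2.
exists (Num.max r s); first by rewrite le_max lexx /= gt_max r1.
move=> w _; rewrite ge_max -andbA => /and3P[rw sw w1].
have wD : unit_disk w by apply/unit_diskE.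
have := Hs w; rewrite sw w1 => /(_ isT) hP.
rewrite -F0 (quotient_prod wD (leq0n n)) modulusM.
have -> : modulus (F n w) / (2 * lam) = (1 / 2 * modulus (F n w)) / lam by field; rewrite gt_eqF.
rewrite ler_pM2r ?invr_gt0 // ler_wpM2r ?modulus_ge0 //; lra.
Qed.

(** At radius 0 the circle mean is [2 * pi] times the value of the gauge at the origin, and [psi]
    tends to infinity. *)
Lemma quotient_at0_bounded lam (A : R) : 0 < lam -> means_bounded lam G A ->
  exists2 M, 0 < M & forall n, modulus (F n 0) <= M.
Proof.
move=> lam0 bG; have pi0 := pi_gt0 R.
have [X HX] := psi_unbounded (A / (2 * pi)).
have lam2 : 0 < 2 * lam by rewrite mulr_gt0.
exists (Num.max 1 (X * (2 * lam))); first by rewrite lt_max ltr01.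
move=> n; rewrite le_max; apply/orP; right; rewrite -ler_pdivrMr // leNgt; apply/negP => /HX.
apply/negP; rewrite -leNgt ler_pdivlMr ?mulr_gt0 //.
have r00 : 0 <= (0 : R) < 1 by rewrite lexx ltr01.
have := @quotient_means_bounded lam A n lam0 bG 0 r00.
rewrite /circle_mean (@eq_rint _ _ _ _ (fun=> gauge (2 * lam) (F n) 0)); last first.
  by move=> t _; rewrite rc0 mul0r.
by rewrite rint_cst ?mulr_ge0 ?(ltW pi0) // subr0.
Qed.

(* Once the zeros at the origin are used up, [F n 0] is [F n0 0] divided by the
   product of the moduli of the next zeros, and it stays bounded. *)
Lemma deficit_sums_bounded lam (A : R) : 0 < lam -> means_bounded lam G A ->
  exists S : R, forall n, \sum_(0 <= k < n) deficit zs k <= S.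
Proof.
move=> lam0 bG; have [M M0 HM] := quotient_at0_bounded lam0 bG.
have D0 : unit_disk (0 : C R) by apply/unit_diskE; rewrite modulus0.
have [m [_ cm]] := @FO 0%N 0 D0.
(* The origin is a zero of finite order, possibly 0, so it occupies finitely many positions. *)
have [n0 Hn0] : exists n0, forall k, (n0 <= k)%N -> zs k <> Some 0.
  have fin : finite_set [set k | zs (0 + k)%N = Some 0] by exists m.
  have /finite_seqP [sq Esq] := fin.
  exists (\max_(k <- sq) k).+1 => k nk zk.
  have ksq : k \in sq by have : [set` sq] k by [rewrite -Esq]; rewrite /= .
  by have := @leq_bigmax_seq _ sq xpredT id k ksq isT; rewrite leqNgt nk.
have FN0 : F n0 0 != 0.
  have [j [[h [_ h0 Fh]] cj]] := @FO n0 0 D0.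
  have j0 : j = 0%N.
    have E0 : [set k | zs (n0 + k)%N = Some 0] = set0.
      by apply/seteqP; split => // k /=; apply: Hn0; exact: leq_addr.
    by move: cj; rewrite E0 card_eq_sym card_eq0 => /eqP /IIn_eq0.
  by rewrite (nbhs_singleton Fh) j0 expr0 mul1r.
pose d := modulus (F n0 0) / M.
have d0 : 0 < d by rewrite divr_gt0 // modulus_gt0.
(* The first [n0] terms are at most 1 each; for the others [1 - x <= exp (- x)] turns the lower
   bound [d] on the product into an upper bound on the sum. *)
exists (n0%:R - ln d) => n.
have base n' : (n0 <= n')%N -> \sum_(n0 <= k < n') deficit zs k <= - ln d.
  move=> nn; have P : d <= modulus (zero_prod zs n0 n' 0).
    rewrite /d ler_pdivrMr // (quotient_prod D0 nn) modulusM.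
    by rewrite ler_wpM2l ?modulus_ge0.
  have E : modulus (zero_prod zs n0 n' 0) <= expR (- \sum_(n0 <= k < n') deficit zs k).
    rewrite -(subnKC nn); elim: (n' - n0)%N => [|j IH].
      by rewrite addn0 /zero_prod !big_geq // modulus1 oppr0 expR0.
    rewrite addnS /zero_prod !big_nat_recr ?leq_addr //= -/(zero_prod zs n0 (n0 + j) 0).
    rewrite modulusM opprD expRD ler_pM ?modulus_ge0 //.
    have -> : modulus (zero_factor zs (n0 + j) 0) = 1 - deficit zs (n0 + j).
      rewrite /zero_factor /deficit; case Ez : (zs _) => [a|]; last by rewrite modulus1 subr0.
      rewrite blaschke_factor_at0; first by ring.
      by apply/eqP => a0; apply: (Hn0 (n0 + j)%N); rewrite ?leq_addr // Ez a0.
    exact: expR_ge1Dx.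
  have := le_trans P E; rewrite -{1}(lnK d0) ler_expR; lra.
have nn0 : (0 : R) <= n0%:R by exact: ler0n.
have head n' : (n' <= n0)%N -> \sum_(0 <= k < n') deficit zs k <= n0%:R.
  move=> h; apply: (le_trans (ler_sum_nat (fun i _ => deficit_le1 zs i))).
  by rewrite sumr_const_nat subn0 -[leRHS]mulr_natl mulr1 -mulr_natl mulr1 ler_nat.
have [h|/ltnW h] := leqP n n0.
  apply: (le_trans (head n h)); rewrite lerDl.
  by have := base n0 (leqnn _); rewrite big_geq.
rewrite (big_cat_nat (leq0n n0) h) //=.
by apply: lerD; [exact: head|exact: base].
Qed.

Lemma deficit_tail (S : R) : (forall n, \sum_(0 <= k < n) deficit zs k <= S) ->
  forall e : R, 0 < e -> exists N, forall n m, (N <= n)%N -> (n <= m)%N -> \sum_(n <= k < m) deficit zs k < e.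
Proof.
move=> HS e e0; pose s n := \sum_(0 <= k < n) deficit zs k.
have s_nd : nondecreasing_seq s.
  apply/nondecreasing_seqP => n; rewrite /s big_nat_recr //= lerDl; exact: deficit_ge0.
have cs : s @ \oo --> sup (range s).
  by apply: nondecreasing_cvgn => //; exists S => _ [n _ <-]; exact: HS.
have /cvgrPdist_lt /(_ _ e0) [N _ HN] := cs.
exists N => n m Nn nm.
have := HN n Nn; have ub k : s k <= sup (range s).
  by apply: ub_le_sup; [exists S => _ [j _ <-]; exact: HS|exists k].
rewrite /= ger0_norm ?subr_ge0 // => h.
have : s m = s n + \sum_(n <= k < m) deficit zs k by rewrite /s (big_cat_nat (leq0n n) nm).
have := ub m; lra.
Qed.

(** Small tails of the Blaschke sum force [|F m| <= 2 |F n|] on [|w| <= r] for large [n <= m], which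
    gives local bounds and the last claim; with the local bounds they also make [F n w] a Cauchy
    sequence. The moduli [|F n|] increase with [n], hence stay below [|H|]. *)
Lemma quotient_limit (S : R) : (forall n, \sum_(0 <= k < n) deficit zs k <= S) ->
  exists H, [/\ holomorphic_on_disk H,
    forall w, unit_disk w -> forall e, 0 < e -> exists N, forall n, (N <= n)%N -> modulus (F n w - H w) < e,
    forall n w, unit_disk w -> modulus (F n w) <= modulus (H w) &
    forall r, r < 1 -> exists N, forall w, modulus w <= r -> modulus (H w) <= 2 * modulus (F N w)].
Proof.
move=> HS; have tail := deficit_tail HS.
have half (r : R) : r < 1 -> exists N, forall n m w, (N <= n)%N -> (n <= m)%N -> modulus w <= r -> unit_disk w ->
    modulus (F m w) <= 2 * modulus (F n w).
  (* With this tail, [zero_prod_near1] puts the product within [1 / 2] of 1. *)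
  move=> r1; have e0 : 0 < (1 - r) / 4 by rewrite divr_gt0 // subr_gt0.
  have [N HN] := tail _ e0; exists N => n m w Nn nm wr wD.
  have h1 := HN n m Nn nm.
  have wr1 : 0 < 1 - modulus w by lra.
  have near := zero_prod_near1 (@zsD) nm wD.
  have P : 1 / 2 <= modulus (zero_prod zs n m w).
    have b : modulus (zero_prod zs n m w - 1) <= 1 / 2.
      apply: (le_trans near); rewrite ler_pdivrMr //; lra.
    have := lerB_modulus (1 : C R) (1 - zero_prod zs n m w).
    by rewrite subKr modulus1 modulus_distC; lra.
  rewrite (quotient_prod wD nm) modulusM mulrA ler_peMl ?modulus_ge0 //; lra.
have bdd (r : R) : r < 1 -> exists (N : nat) (M : R), 0 < M /\ forall n w, (N <= n)%N -> modulus w <= r -> modulus (F n w) <= M.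
  move=> r1; have [N HN] := half r r1; have [M M0 HM] := holomorphic_bounded (@hF N) r1.
  exists N, (2 * M); split; first by rewrite mulr_gt0.
  move=> n w Nn wr; have wD : unit_disk w by apply/unit_diskE; exact: le_lt_trans wr r1.
  by apply: (le_trans (HN N n w (leqnn _) Nn wr wD)); rewrite ler_pM2l // HM.
have cau w : unit_disk w -> exists l, forall e, 0 < e -> exists N, forall n, (N <= n)%N -> modulus (F n w - l) < e.
  move=> wD; apply: complex_cauchy_cvg => e e0; have /unit_diskE w1 := wD.
  have [N0 [M [M0 HM]]] := bdd _ w1.
  have e1 : 0 < e * (1 - modulus w) / (4 * M).
    by apply: divr_gt0; apply: mulr_gt0 => //; rewrite subr_gt0.
  have [N1 HN1] := tail _ e1.
  have key n m : (maxn N0 N1 <= n)%N -> (n <= m)%N -> modulus (F n w - F m w) < e.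
    rewrite geq_max => /andP[n0 n1] nm; rewrite (quotient_prod wD nm).
    have -> : zero_prod zs n m w * F m w - F m w = (zero_prod zs n m w - 1) * F m w by ring.
    rewrite modulusM; have h1 := HN1 n m n1 nm.
    have h2 := zero_prod_near1 (@zsD) nm wD; have h3 := HM m w (leq_trans n0 nm) (lexx _).
    have w10 : 0 < 1 - modulus w by rewrite subr_gt0.
    have h4 : 2 * (\sum_(n <= k < m) deficit zs k) / (1 - modulus w) < e / (2 * M).
      rewrite ltr_pdivrMr // (_ : e / (2 * M) * _ = 2 * (e * (1 - modulus w) / (4 * M))).
        by rewrite ltr_pM2l.
      by field; rewrite gt_eqF.
    apply: (@le_lt_trans _ _ (e / (2 * M) * M)).
      by apply: ler_pM; rewrite ?modulus_ge0 //; apply: (le_trans h2); exact: ltW.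
    have -> : e / (2 * M) * M = e / 2 by field; rewrite gt_eqF.
    lra.
  exists (maxn N0 N1) => n m hn hm; have [nm|/ltnW mn] := leqP n m; first exact: key.
  by rewrite modulus_distC; exact: key.
have cau' w : exists l, unit_disk w -> forall e, 0 < e -> exists N, forall n, (N <= n)%N -> modulus (F n w - l) < e.
  by have [wD|] := pselect (unit_disk w); [have [l Hl] := cau w wD; exists l|exists 0].
have [H HH] := choice cau'.
have FleH n w : unit_disk w -> modulus (F n w) <= modulus (H w).
  move=> wD; apply/ler_addgt0Pr => e e0; have [N HN] := HH w wD e e0.
  have h1 := HN (maxn n N) (leq_maxr _ _).
  have h2 := modulus_quotient_le wD (leq_maxl n N).
  by have := lerB_modulus (F (maxn n N) w) (H w); lra.
exists H; split => //; first exact: holomorphic_limit hF bdd HH.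
move=> r r1; have [N HN] := half r r1; exists N => w wr.
have wD : unit_disk w by apply/unit_diskE; exact: le_lt_trans wr r1.
apply/ler_addgt0Pr => e e0; have [N' HN'] := HH w wD e e0.
have h1 := HN' (maxn N N') (leq_maxr _ _).
have h2 := HN N (maxn N N') w (leqnn _) (leq_maxl _ _) wr wD.
have := lerB_modulus (H w) (F (maxn N N') w); rewrite modulus_distC; lra.
Qed.

End Quotients.

End Factorization.

(** * Luxemburg norms *)

Section Luxemburg.
Context {R : realType} (Phi : R -> R) (K p : R).
Hypothesis Phi_mono : {in `[0, +oo[ &, {homo Phi : s t / s <= t}}.
Hypothesis Phi0 : Phi 0 = 0.
Hypothesis Phi_cvg0 : Phi t @[t --> 0^'+] --> 0.
Hypothesis Phi_gt0 : forall t : R, 0 < t -> 0 < Phi t.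
Hypothesis p0 : 0 < p.
Hypothesis K1 : 1 < K.
Hypothesis Phi_lower : forall t s : R, 0 <= t <= 1 -> 0 <= s -> Phi (s * t) <= K * t `^ p * Phi s.
Implicit Types (F G H : C R -> C R) (lam r l : R).

Let mu : {measure set (measurableTypeR R) -> \bar R} := @lebesgue_measure R.
Let I : set R := `[0%R, (2 * pi)%R].

Let mI : measurable (I : set (measurableTypeR R)).
Proof. exact: measurable_itv. Qed.

(** [Phi] is monotone on [[0, +oo[] only; precomposing with [max 0] gives a function monotone on the
    whole line, hence measurable, that agrees with [Phi] on the values of [g]. *)
Lemma measurable_Phi_comp (g : R -> R) : cont_on 0 (2 * pi) g -> (forall t, 0 <= g t) ->
  measurable_fun I (fun t => Phi (g t)).
Proof.
move=> cg g0.
have mg : measurable_fun I g.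
  apply: subspace_continuous_measurable_fun; first exact: measurable_itv.
  exact: cont_on_within.
have mP : measurable_fun setT (fun x : R => Phi (Num.max 0 x)).
  apply: nondecreasing_measurable => // x y xy; apply: (Phi_le Phi_mono).
    by rewrite le_max lexx.
  by rewrite ge_max !le_max lexx xy orbT.
apply: (@eq_measurable_fun _ _ _ _ I ((fun x : R => Phi (Num.max 0 x)) \o g)).
  by move=> t _ /=; rewrite (max_idPr (g0 t)).
exact: measurableT_comp.
Qed.

Lemma cont_on_dilate F r l : holomorphic_on_disk F -> 0 <= r < 1 ->
  cont_on 0 (2 * pi) (fun t => modulus (dilate F r (circle_point t)) / l).
Proof.
move=> hF hr t tt; apply: cvgM; last exact: cvg_cst.
have := @cont_on_circle R (fun w => modulus (F w)) r hr _ t tt; apply.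
move=> w w1; apply: continuous_comp_modulus; apply: holomorphic_continuous => //.
exact/unit_diskE.
Qed.

Lemma measurable_lux F r l (c : R) : holomorphic_on_disk F -> 0 <= r < 1 -> 0 < l ->
  measurable_fun I (EFin \o (fun t => Phi (modulus (dilate F r (circle_point t)) / l) * c)).
Proof.
move=> hF hr l0; apply/measurable_EFinP; apply: measurable_funM; last exact: measurable_cst.
apply: measurable_Phi_comp; first exact: cont_on_dilate.
by move=> t; rewrite divr_ge0 ?modulus_ge0 // ltW.
Qed.

Lemma rint_EFin (f : R -> R) : cont_on 0 (2 * pi) f -> (rint 0 (2 * pi) f)%:E = (\int[mu]_(t in I) (f t)%:E)%E.
Proof.
move=> cf; rewrite /rint /Rintegral fineK //.
by apply: integrable_fin_num => //; exact: integrable_cont_on.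
Qed.

Lemma cont_on_gauge F r l : holomorphic_on_disk F -> 0 <= r < 1 ->
  cont_on 0 (2 * pi) (fun t => gauge (Psi Phi) l F (rc r * circle_point t)).
Proof.
move=> hF hr; apply: cont_on_circle => // w w1.
have cP := Psi_continuous Phi_mono Phi0 Phi_cvg0 Phi_gt0 p0 K1 Phi_lower.
by apply: (gauge_continuous cP) => //; exact/unit_diskE.
Qed.

Lemma Kp_gt0 : 0 < K / p.
Proof. by rewrite divr_gt0 // (lt_trans _ K1). Qed.

(** The strict inequality supplies an admissible [l < lam], and then
    [Psi (x / lam) <= K / p * Phi (x / l)]. The factor [2 * pi] undoes the normalization of the
    measure. *)
Lemma lux_lt_mean F r lam : holomorphic_on_disk F -> 0 <= r < 1 ->
  (lux_norm Phi (dilate F r) < lam%:E)%E ->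
  0 < lam /\ circle_mean (gauge (Psi Phi) lam F) r <= K / p * (2 * pi).
Proof.
move=> hF hr /ereal_inf_lt [_ [l [l0 Hl] <-]]; rewrite lte_fin => ll.
have lam0 : 0 < lam by exact: lt_trans ll.
have pi0 := pi_gt0 R; have pi2 : 0 < 2 * pi :> R by rewrite mulr_gt0.
split => //; rewrite -lee_fin /circle_mean rint_EFin; last exact: cont_on_gauge.
have P0 t : 0 <= Phi (modulus (dilate F r (circle_point t)) / l).
  by apply: (Phi_ge0 Phi_mono Phi0); rewrite divr_ge0 ?modulus_ge0 // ltW.
apply: (@le_trans _ _ (\int[mu]_(t in I) ((K / p * (2 * pi))%:E * (Phi (modulus (dilate F r (circle_point t)) / l) / (2 * pi))%:E))%E).
  apply: (ge0_le_integral _ mI).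
  - by move=> t _; rewrite lee_fin; exact: (Psi_ge0 Phi_mono Phi0 p0 K1 Phi_lower).
  - apply/measurable_EFinP; apply: subspace_continuous_measurable_fun; first exact: measurable_itv.
    by apply: cont_on_within; exact: cont_on_gauge.
  - apply: measurable_funeM; exact: measurable_lux.
  move=> t _; rewrite -EFinM lee_fin.
  have -> : K / p * (2 * pi) * (Phi (modulus (dilate F r (circle_point t)) / l) / (2 * pi)) =
    K / p * Phi (modulus (dilate F r (circle_point t)) / l).
    by rewrite -[LHS]mulrA [2 * pi * _]mulrC mulfVK ?gt_eqF.
  have m0 : 0 <= modulus (dilate F r (circle_point t)) by exact: modulus_ge0.
  rewrite /gauge -/(dilate F r (circle_point t)).
  have h1 : 0 <= modulus (dilate F r (circle_point t)) / lam by rewrite divr_ge0 // ltW.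
  apply: (le_trans (Psi_le Phi_mono Phi0 p0 K1 Phi_lower h1)).
  apply: ler_wpM2l; first by rewrite ltW // Kp_gt0.
  apply: (Phi_le Phi_mono) => //; apply: ler_wpM2l => //.
  by rewrite lef_pV2 // ltW.
rewrite ge0_integralZl_EFin //.
- rewrite -[leRHS]mule1; apply: lee_wpmul2l; last exact: Hl.
  by rewrite lee_fin mulr_ge0 ?ltW // Kp_gt0.
- by move=> t _; rewrite lee_fin divr_ge0 // ltW.
- exact: measurable_lux.
- by rewrite mulr_ge0 ?ltW // Kp_gt0.
Qed.

(** Conversely [K / p * Phi (x / lam') <= Psi (x / lam)]: the factor [e] comes from [Phi_le_Psi],
    and [m] absorbs [K / p]. *)
Lemma mean_le_lux F r lam lam' (m : R) : holomorphic_on_disk F -> 0 <= r < 1 -> 0 < lam -> 0 < m ->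
  (forall s, 0 <= s -> K / p * Phi (s / m) <= Phi s) -> lam' = lam * expR 1 * m ->
  circle_mean (gauge (Psi Phi) lam F) r <= K / p * (2 * pi) ->
  (lux_norm Phi (dilate F r) <= lam'%:E)%E.
Proof.
move=> hF hr lam0 m0 Hm lam'E; rewrite -lee_fin /circle_mean rint_EFin; last exact: cont_on_gauge.
move=> Hmean; have pi0 := pi_gt0 R; have pi2 : 0 < 2 * pi :> R by rewrite mulr_gt0.
have e0 := expR_gt0 (1 : R).
have lam'0 : 0 < lam' by rewrite lam'E; apply: mulr_gt0 => //; exact: mulr_gt0.
apply: ereal_inf_lbound; exists lam' => //; split => //.
have c0 : 0 <= (K / p * (2 * pi))^-1 by rewrite invr_ge0 mulr_ge0 ?ltW // Kp_gt0.
apply: (@le_trans _ _ (\int[mu]_(t in I) (((K / p * (2 * pi))^-1)%:E * (gauge (Psi Phi) lam F (rc r * circle_point t))%:E))%E).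
  apply: (ge0_le_integral _ mI).
  - move=> t _; rewrite lee_fin divr_ge0 ?(ltW pi2) //.
    by apply: (Phi_ge0 Phi_mono Phi0); rewrite divr_ge0 ?modulus_ge0 // ltW.
  - exact: measurable_lux.
  - apply: measurable_funeM; apply/measurable_EFinP.
    apply: subspace_continuous_measurable_fun; first exact: measurable_itv.
    by apply: cont_on_within; exact: cont_on_gauge.
  move=> t _; rewrite -EFinM lee_fin /gauge -/(dilate F r (circle_point t)).
  have h1 : 0 <= modulus (dilate F r (circle_point t)) / lam by rewrite divr_ge0 ?modulus_ge0 // ltW.
  have a1 := Phi_le_Psi Phi_mono Phi0 p0 K1 Phi_lower h1.
  have h2 : 0 <= modulus (dilate F r (circle_point t)) / lam / expR 1 by rewrite divr_ge0 // ltW.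
  have a2 := le_trans (Hm _ h2) a1.
  have E : modulus (dilate F r (circle_point t)) / lam' = modulus (dilate F r (circle_point t)) / lam / expR 1 / m.
    by rewrite lam'E; field; rewrite !gt_eqF.
  have -> (y : R) : (K / p * (2 * pi))^-1 * y = y / (K / p) / (2 * pi).
    by rewrite (invfM (K / p)) mulrC mulrA.
  rewrite E; apply: ler_wpM2r; first by rewrite invr_ge0 ltW.
  by rewrite ler_pdivlMr ?Kp_gt0 // mulrC.
rewrite ge0_integralZl_EFin //.
- apply: (@le_trans _ _ (((K / p * (2 * pi))^-1)%:E * (K / p * (2 * pi))%:E)%E).
    by apply: lee_wpmul2l; [rewrite lee_fin|exact: Hmean].
  by rewrite -EFinM mulVf // gt_eqF // mulr_gt0 // Kp_gt0.
- by move=> t _; rewrite lee_fin; exact: (Psi_ge0 Phi_mono Phi0 p0 K1 Phi_lower).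
- apply/measurable_EFinP; apply: subspace_continuous_measurable_fun; first exact: measurable_itv.
  by apply: cont_on_within; exact: cont_on_gauge.
Qed.

Lemma lux_norm_le F G r : holomorphic_on_disk F -> holomorphic_on_disk G -> 0 <= r < 1 ->
  (forall w, unit_disk w -> modulus (F w) <= modulus (G w)) ->
  (lux_norm Phi (dilate F r) <= lux_norm Phi (dilate G r))%E.
Proof.
move=> hF hG hr FG; apply: le_ereal_inf_tmp => _ [l [l0 Hl] <-].
have pi0 := pi_gt0 R; have pi2 : 0 < 2 * pi :> R by rewrite mulr_gt0.
apply: ereal_inf_lbound; exists l => //; split => //; apply: le_trans Hl.
have P0 H t : 0 <= Phi (modulus (dilate H r (circle_point t)) / l).
  by apply: (Phi_ge0 Phi_mono Phi0); rewrite divr_ge0 ?modulus_ge0 // ltW.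
apply: (ge0_le_integral _ mI).
- by move=> t _; rewrite lee_fin divr_ge0 // ltW.
- exact: measurable_lux.
- exact: measurable_lux.
move=> t _; rewrite lee_fin ler_pM2r ?invr_gt0 //.
apply: (Phi_le Phi_mono); first by rewrite divr_ge0 ?modulus_ge0 // ltW.
rewrite ler_pM2r ?invr_gt0 //; apply: FG; apply/unit_diskE.
by rewrite modulusM modulus_circle_point mulr1 modulus_rc; case/andP: hr => r0 r1; rewrite ger0_norm.
Qed.

Lemma lux_norm_ge0 (g : C R -> C R) : (0 <= lux_norm Phi g)%E.
Proof. by apply: le_ereal_inf_tmp => _ [l [l0 _] <-]; rewrite lee_fin ltW. Qed.

Lemma hardy_norm_ge0 F : (0 <= hardy_norm Phi F)%E.
Proof.
apply: le_trans (lux_norm_ge0 (dilate F 0)) _; apply: ereal_sup_ubound.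
by exists 0 => //; rewrite /= in_itv /= lexx ltr01.
Qed.

Lemma eq_hardy_norm F G : (forall w, unit_disk w -> F w = G w) -> hardy_norm Phi F = hardy_norm Phi G.
Proof.
move=> FG.
have lle A B r : (forall w, unit_disk w -> A w = B w) -> 0 <= r < 1 ->
    (lux_norm Phi (dilate A r) <= lux_norm Phi (dilate B r))%E.
  move=> AB /andP[r0 r1]; apply: le_ereal_inf_tmp => _ [l [l0 Hl] <-].
  apply: ereal_inf_lbound; exists l => //; split => //; apply: le_trans Hl.
  rewrite le_eqVlt; apply/orP; left; apply/eqP; apply: eq_integral => t _.
  rewrite /dilate AB //; apply/unit_diskE.
  by rewrite modulusM modulus_circle_point mulr1 modulus_rc ger0_norm.
have hle A B : (forall w, unit_disk w -> A w = B w) -> (hardy_norm Phi A <= hardy_norm Phi B)%E.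
  move=> AB; apply: ge_ereal_sup => _ [r hr <-].
  have hr' : 0 <= r < 1 by move: hr; rewrite /= in_itv.
  by apply: le_trans (lle _ _ _ AB hr') _; apply: ereal_sup_ubound; exists r.
by apply: le_anti; apply/andP; split; apply: hle => w wD; rewrite FG.
Qed.

End Luxemburg.

(** * Identification of the limit with the quotient by the Blaschke product *)

Section Quotient.
Context {R : realType}.
Implicit Types (z w a : C R) (G H : C R -> C R) (zs : nat -> option (C R)).

(** Away from the zeros of [G] the partial products are [G / F n], and they converge to [G / H],
    where [H w] is nonzero because it dominates [G w]. *)
Lemma blaschke_quotient_eq G H zs (F : nat -> C R -> C R) w : unit_disk w ->
  (forall n, G w = zero_prod zs 0 n w * F n w) ->
  (forall e, 0 < e -> exists N, forall n, (N <= n)%N -> modulus (F n w - H w) < e) ->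
  (forall n, modulus (G w) <= modulus (F n w)) -> modulus (G w) <= modulus (H w) ->
  G w != 0 -> G w / blaschke zs w = H w.
Proof.
move=> wD GF FH GleF GleH Gw.
have gw : 0 < modulus (G w) by rewrite modulus_gt0.
have hw : 0 < modulus (H w) by exact: lt_le_trans GleH.
have Hw : H w != 0 by rewrite -modulus_gt0.
suff -> : blaschke zs w = G w / H w by field; rewrite Hw Gw.
rewrite /blaschke; apply: cvg_lim; first exact: norm_hausdorff.
apply/cvg_modulusP => e e0.
have [N HN] := FH _ (mulr_gt0 e0 hw).
exists N => // n /= Nn.
have fn : 0 < modulus (F n w) by exact: lt_le_trans gw (GleF n).
have Fn : F n w != 0 by rewrite -modulus_gt0.
rewrite -[X in modulus (X - _)]/(zero_prod zs 0 n w).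
have -> : zero_prod zs 0 n w - G w / H w = (H w - F n w) * (G w / F n w) / H w.
  have -> : zero_prod zs 0 n w = G w / F n w by rewrite {1}(GF n) mulfK.
  by field; rewrite Hw Fn.
rewrite modulusMV ltr_pdivrMr // modulusM.
apply: (@le_lt_trans _ _ (modulus (H w - F n w) * 1)).
  by rewrite ler_wpM2l ?modulus_ge0 // modulusMV ler_pdivrMr // mul1r.
by rewrite mulr1 modulus_distC HN.
Qed.

Lemma quotient_removed_eq G H (B : C R -> C R) z : {for z, continuous H} ->
  (\forall w \near z^', G w / B w = H w) -> quotient_removed G B z = H z.
Proof.
move=> cH /dnbhs_modulusP [d d0 Hd]; rewrite /quotient_removed.
apply: cvg_lim; first exact: norm_hausdorff.
apply/cvg_modulusP => e e0; apply/dnbhs_modulusP.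
have [d' d'0 Hd'] := (continuous_modulusP _ _).1 cH e e0.
exists (Num.min d d'); first by rewrite lt_min d0.
move=> w wz; rewrite lt_min => /andP[w1 w2].
by rewrite Hd //; exact: Hd'.
Qed.

End Quotient.

Theorem theorem1p1 (R : realType) (Phi : R -> R) :
  growth_function Phi -> of_lower_type Phi ->
  exists2 c : R, 0 < c &
    forall G : C R -> C R, hardy_orlicz Phi G ->
      ~ (forall z : C R, unit_disk z -> G z = 0) ->
      (exists zs : nat -> option (C R), lists_zeros G zs) /\
      (forall zs : nat -> option (C R), lists_zeros G zs ->
         let H := quotient_removed G (blaschke zs) in
         [/\ blaschke_summable zs,
             hardy_orlicz Phi H,
             (c^-1%:E * hardy_norm Phi H <= hardy_norm Phi G)%E &
             (hardy_norm Phi G <= c%:E * hardy_norm Phi H)%E]).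
Proof.
move=> [Phi_mono [Phi0 Phi_cvg0] Phi_gt0 Phi_cvgy] [p p0 [K K1 Phi_lower]].
have psi_cont := Psi_continuous Phi_mono Phi0 Phi_cvg0 Phi_gt0 p0 K1 Phi_lower.
have psi_mono s t := @Psi_mono R Phi K p Phi_mono Phi0 p0 K1 Phi_lower s t.
have psi_ge0 := Psi_ge0 Phi_mono Phi0 p0 K1 Phi_lower.
have psi_at0 : Psi Phi 0 = 0 by exact: Psi_le0.
have psi_supp (s0 : R) : 0 < s0 -> exists2 L : R, 0 <= L &
    forall e : R, 0 < e -> exists2 k : R, 0 <= k <= L &
    forall s : R, 0 < s -> Psi Phi s0 - e + k * (ln s - ln s0) <= Psi Phi s.
  move=> s00; exists (Phi s0); first exact: ltW (Phi_gt0 _ s00).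
  by move=> e e0; exact: (Psi_support Phi_mono Phi0 p0 K1 Phi_lower).
have e1 : 1 <= expR 1 :> R by rewrite -expR0 ler_expR.
have e0 : 0 < expR 1 :> R by exact: expR_gt0.
have psi_unb (A : R) : exists X : R, forall s : R, X < s -> A < Psi Phi s.
  have /cvgryPgt /(_ A) [M [_ HM]] := Phi_cvgy.
  exists (Num.max 0 (M * expR 1)) => s; rewrite gt_max => /andP[s0 sM].
  apply: lt_le_trans (Phi_le_Psi Phi_mono Phi0 p0 K1 Phi_lower (ltW s0)).
  by apply: HM; rewrite ltr_pdivlMr.
have Kp := Kp_gt0 p0 K1.
have [m m1 Hm] := Phi_lower_div Phi_mono Phi0 p0 K1 Phi_lower Kp.
have m0 : 0 < m by exact: lt_le_trans m1.
have pi0 := pi_gt0 R.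
pose c : R := 4 * expR 1 * m.
have c1 : 1 <= c.
  have : 1 * 1 <= expR 1 * m by apply: ler_pM.
  by rewrite /c; lra.
have c0 : 0 < c by exact: lt_le_trans c1.
exists c; first exact: c0.
move=> G [hG GN] G0; split; first exact: (lists_zeros_exists hG G0).
move=> zs lz; have zsD := lz.1.
have [F [F0 hF FS FO]] := blaschke_quotients hG lz.
(* Working with [lam] strictly above the norm provides admissible values in every infimum; [hardyH]
   then lets [lam] decrease to the norm. *)
have meanG lam : (hardy_norm Phi G < lam%:E)%E -> 0 < lam /\ means_bounded (Psi Phi) lam G (K / p * (2 * pi)).
  move=> Glam; have H r : 0 <= r < 1 -> 0 < lam /\ circle_mean (gauge (Psi Phi) lam G) r <= K / p * (2 * pi).
    move=> hr; apply: (lux_lt_mean Phi_mono Phi0 Phi_cvg0 Phi_gt0 p0 K1 Phi_lower hG hr).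
    apply: le_lt_trans Glam; apply: ereal_sup_ubound; exists r; last by [].
    by rewrite /= in_itv.
  split; last by move=> r /H [].
  by have [|] := H 0; rewrite ?lexx ?ltr01.
have Gge0 := hardy_norm_ge0 Phi G.
have Gfin : hardy_norm Phi G \is a fin_num by rewrite ge0_fin_numE.
have [lam0 Glam0] : exists lam : R, (hardy_norm Phi G < lam%:E)%E.
  by exists (fine (hardy_norm Phi G) + 1); rewrite -{1}(fineK Gfin) lte_fin ltrDl.
have [l0 bG] := meanG lam0 Glam0.
have [S HS] := deficit_sums_bounded psi_cont psi_mono psi_ge0 psi_at0 psi_supp psi_unb zsD F0 hF FS FO l0 bG.
have [H [hH FH FleH HleF]] := quotient_limit zsD hF FS HS.
have GleF n w : unit_disk w -> modulus (G w) <= modulus (F n w).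
  by move=> wD; rewrite -F0; exact: (modulus_quotient_le zsD FS wD (leq0n n)).
have GleH w : unit_disk w -> modulus (G w) <= modulus (H w).
  by move=> wD; rewrite -F0; exact: FleH.
have luxH lam r : (hardy_norm Phi G < lam%:E)%E -> 0 <= r < 1 ->
    (lux_norm Phi (dilate H r) <= (c * lam)%:E)%E.
  move=> Glam hr; have [lam_gt0 bGl] := meanG lam Glam.
  have lam4 : 0 < 4 * lam by rewrite mulr_gt0.
  apply: (mean_le_lux Phi_mono Phi0 Phi_cvg0 Phi_gt0 p0 K1 Phi_lower hH hr lam4 m0 Hm).
    by rewrite /c; ring.
  (* The index [N] depends on [r], but the bound on the means of [F N] does not. *)
  case/andP: (hr) => r0 r1; have [N HN] := HleF r r1.
  apply: le_trans (quotient_means_bounded psi_cont psi_mono psi_ge0 psi_at0 psi_supp zsD F0 hF FS N lam_gt0 bGl hr).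
  have cH := @gauge_continuous_disk R (Psi Phi) psi_cont (4 * lam) H hH.
  have cF := @gauge_continuous_disk R (Psi Phi) psi_cont (2 * lam) (F N) (hF N).
  apply: (circle_mean_le hr cH cF) => w wr.
  apply: psi_mono; first by rewrite divr_ge0 ?modulus_ge0 // ltW.
  have := HN w; rewrite wr lexx => /(_ isT) h.
  have -> : modulus (F N w) / (2 * lam) = 2 * modulus (F N w) / (4 * lam) by field; rewrite gt_eqF.
  by rewrite ler_pM2r ?invr_gt0.
have hardyH_lam lam : (hardy_norm Phi G < lam%:E)%E -> (hardy_norm Phi H <= (c * lam)%:E)%E.
  move=> Glam; apply: ge_ereal_sup => _ [r hr <-]; apply: luxH Glam _.
  by move: hr; rewrite /= in_itv.
have hardyH : (hardy_norm Phi H <= c%:E * hardy_norm Phi G)%E.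
  rewrite -(fineK Gfin) -EFinM; apply/lee_addgt0Pr => e e_gt0.
  have -> : ((c * fine (hardy_norm Phi G))%:E + e%:E = (c * (fine (hardy_norm Phi G) + e / c))%:E)%E.
    by rewrite -EFinD; congr (_%:E); field; rewrite gt_eqF.
  apply: hardyH_lam; rewrite -{1}(fineK Gfin) lte_fin ltrDl; exact: divr_gt0.
pose Q := quotient_removed G (blaschke zs).
(* Zeros of [G] are isolated, so the punctured limit only sees points where [G] is nonzero and
   [G / B = H]. *)
have QH w : unit_disk w -> Q w = H w.
  move=> wD; apply: quotient_removed_eq; first exact: holomorphic_continuous.
  have [k Ok _] := lz.2 w wD.
  have [d1 d10 Hd1] := (dnbhs_modulusP _ _).1 (zero_order_isolated Ok).
  have [d2 d20 Hd2] := (nbhs_modulusP _ _).1 (near_unit_disk wD).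
  apply/dnbhs_modulusP; exists (Num.min d1 d2); first by rewrite lt_min d10.
  move=> v vw; rewrite lt_min => /andP[v1 v2]; have vD := Hd2 v v2.
  apply: (blaschke_quotient_eq (F := F) vD).
  - by move=> n; rewrite -F0; exact: (quotient_prod FS vD (leq0n n)).
  - exact: FH.
  - by move=> n; exact: GleF.
  - exact: GleH.
  - exact: Hd1.
have hQ : holomorphic_on_disk Q.
  move=> w wD; apply: (derivable_near_eq (f := H)); last exact: hH.
  by apply: filterS (near_unit_disk wD) => v vD; rewrite QH.
have NQ : hardy_norm Phi Q = hardy_norm Phi H by apply: eq_hardy_norm.
have HltY : (hardy_norm Phi H < +oo)%E.
  by apply: (le_lt_trans hardyH); rewrite -(fineK Gfin) -EFinM ltry.
rewrite /= -/Q NQ; split.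
- apply: (@le_lt_trans _ _ S%:E); last exact: ltry.
  apply: lime_le.
    by apply: is_cvg_nneseries => n _ _; rewrite lee_fin; exact: (deficit_ge0 zsD).
  by apply: nearW => n; rewrite sumEFin lee_fin; exact: HS.
- by split; rewrite ?NQ.
- by rewrite lee_pdivrMl.
- apply: (@le_trans _ _ (hardy_norm Phi H)).
    apply: ge_ereal_sup => _ [r hr <-].
    have hr' : 0 <= r < 1 by move: hr; rewrite /= in_itv.
    apply: le_trans (lux_norm_le Phi_mono Phi0 hG hH hr' GleH) _.
    by apply: ereal_sup_ubound; exists r.
  by rewrite lee_pemull ?hardy_norm_ge0 // lee_fin.
Qed.
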